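(* Let $\mathscr{R}\subset\mathbb{R}^m$ be a normalized root system with positive subsystem $\mathscr{R}_+$, and let $\kappa:\mathscr{R}\to\mathbb{R}$ be a multiplicity function with $\kappa\notin K^{\rm sing}$ and $\gamma_\kappa=(1-m)/2$. Suppose $f$ is a slice regular function of the form $f(x_0+\underline x)=\alpha(x_0,r)+\underline\omega\,\beta(x_0,r)$ with $r=|\underline x|$. Then the function $$\mathcal{T}f(x_0+\underline x)=\mathrm{Exp}\Big(\sum_{j=1}^m x_jT_j^{(\underline y)}\Big)f(x_0+\underline y)\Big|_{\underline y=0}$$ is monogenic, i.e. it is in the kernel of the generalized Cauchy-Riemann operator $\overline\partial_x=\partial_{x_0}+\sum_{j=1}^m e_j\partial_{x_j}$.
   Context: Clifford algebra: $\mathbb{R}_{0,m}$ is the real universal Clifford algebra generated by $e_1,\dots,e_m$ with $e_je_k=-e_ke_j$ ($j\ne k$), $e_j^2=-1$. A vector $(x_1,\dots,x_m)\in\mathbb{R}^m$ is identified with $\underline{x}=\sum_{j=1}^m x_je_j$, and $\mathbb{R}^{m+1}$ with the paravectors $x=x_0+\underline{x}$; $\underline{\omega}=\underline{x}/|\underline{x}|$. $\mathbb{S}^{m-1}$ is the unit sphere of $\mathbb{R}^m$. Scalar operators act componentwise on $\mathbb{R}_{0,m}$-valued functions. Root systems: $\sigma_{\underline\alpha}x=x-2\frac{\langle\underline\alpha,x\rangle}{|\underline\alpha|^2}\underline\alpha$ is the reflection in the hyperplane orthogonal to $\underline\alpha$. A root system is a finite set $\mathscr{R}\subset\mathbb{R}^m\setminus\{0\}$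 (with $\mathbb{R}^m\subset\mathbb{R}^{m+1}$ the space of vectors, so $x_0$ is fixed by all reflections) with $\mathscr{R}\cap\mathbb{R}\underline\alpha=\{\pm\underline\alpha\}$ and $\sigma_{\underline\alpha}\mathscr{R}=\mathscr{R}$ for all $\underline\alpha\in\mathscr{R}$; normalized means $\langle\underline\alpha,\underline\alpha\rangle=2$ for all roots. $\mathscr{R}=\mathscr{R}_+\cup(-\mathscr{R}_+)$ is a disjoint union separated by a hyperplane through $0$. A multiplicity function $\kappa:\mathscr{R}\to\mathbb{R}$ is a function invariant under the finite group generated by the reflections $\sigma_{\underline\alpha}$; $\gamma_\kappa=\sum_{\underline\alpha\in\mathscr{R}_+}\kappa(\underline\alpha)$. Dunkl operators: $T_jf(x)=\partial_{x_j}f(x)+\sum_{\underline\alpha\in\mathscr{R}_+}\kappa(\underline\alpha)\frac{f(x)-f(\sigma_{\underline\alpha}x)}{\langle\underline\alpha,\underline x\rangle}\alpha_j$, $j=1,\dots,m$, and $T_0=\partial_{x_0}$; they commute. $K^{\rm sing}$ is the set of multiplicity functions $\kappa$ for which the bilinear form $[p,q]_\kappa=(p(T)q)(0)$ on polynomials is degenerate. Inverse intertwining operator $\mathcal{T}$: in the definition of $\mathcal{T}f$, $T_j^{(\underline y)}$ is the Dunkl operator acting on the variable $\underline y$ of $f(x_0+\underline y)$; after it has acted one sets $\underline y=0$, obtaining a function of $x_0+\underline x$. $\mathrm{Exp}$ is the exponential series. Slice functions: let $D\subset\mathbb{C}$ be open and symmetric with respect to the real axis, and $\Omega_D=\{a+\underline\omega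 b: a+ib\in D,\ \underline\omega\in\mathbb{S}^{m-1}\}$. A stem function is $F=\alpha+i\beta:D\to\mathbb{R}_{0,m}\otimes\mathbb{C}$ with $\alpha,\beta$ $\mathbb{R}_{0,m}$-valued, $\alpha(\bar z)=\alpha(z)$, $\beta(\bar z)=-\beta(z)$. A function $f:\Omega_D\to\mathbb{R}_{0,m}$ is slice regular if $f(x_0+\underline x)=\alpha(x_0,|\underline x|)+\underline\omega\,\beta(x_0,|\underline x|)$ for a stem function $F=\alpha+i\beta$ that is holomorphic, i.e. $\partial_s\alpha=\partial_t\beta$, $\partial_t\alpha=-\partial_s\beta$ in $z=s+it$. *)

(* Defs.v *)
From HB Require Import structures.
From mathcomp Require Import all_boot all_order all_algebra.
From mathcomp Require Import finmap.
From mathcomp Require Import all_classical all_reals all_analysis.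
From mathcomp Require mpoly.
Import (canonicals, coercions) mpoly.

Set Implicit Arguments.
Unset Strict Implicit.
Unset Printing Implicit Defensive.

Import Order.TTheory GRing.Theory Num.Theory.
Import numFieldNormedType.Exports.

Local Open Scope classical_set_scope.
Local Open Scope ring_scope.

Definition symdiff (m : nat) (A B : {set 'I_m}) : {set 'I_m} :=
  ((A :\: B) :|: (B :\: A))%SET.

Lemma in_symdiff (m : nat) (A B : {set 'I_m}) i :
  (i \in symdiff A B) = (i \in A) (+) (i \in B).
Proof. by rewrite !inE; case: (i \in A); case: (i \in B). Qed.

Lemma symdiffA (m : nat) : associative (@symdiff m).
Proof. by move=> A B C; apply/finset.setP => i; rewrite !in_symdiff addbA. Qed.

Lemma symdiff0s (m : nat) : left_id finset.set0 (@symdiff m).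
Proof. by move=> A; apply/finset.setP => i; rewrite in_symdiff inE. Qed.

Lemma symdiffs0 (m : nat) : right_id finset.set0 (@symdiff m).
Proof. by move=> A; apply/finset.setP => i; rewrite in_symdiff inE addbF. Qed.

(* An element of the Clifford algebra R_{0,m} is the family of its 2^m real
   coordinates on the basis e_A = e_{i_1} ... e_{i_k}, where A ranges over the
   subsets {i_1 < ... < i_k} of 'I_m. *)
Definition clifford (R : realType) (m : nat) : Type :=
  'rV[R]_#|{set 'I_m}|.

HB.instance Definition _ (R : realType) (m : nat) :=
  NormedModule.on (clifford R m).

Section CliffordRing.
Variables (R : realType) (m : nat).
Local Notation Cl := (clifford R m).
Implicit Types (a b c : Cl) (A B C : {set 'I_m}).

Definition clcoef a A : R := (a : 'rV[R]_#|{set 'I_m}|) ord0 (enum_rank A).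

Definition clmake (F : {set 'I_m} -> R) : Cl :=
  (\row_k F (enum_val k) : 'rV[R]_#|{set 'I_m}|).

(* e_A e_B = clsign A B * e_(symdiff A B): one factor -1 for each transposition
   needed to sort the concatenated generators, and one for each repeated
   generator since e_j^2 = -1. *)
Definition clsign A B : R := \prod_(i in A) \prod_(j in B | (j <= i)%N) -1.

Definition clmul a b : Cl :=
  clmake (fun C => \sum_A \sum_(B | symdiff A B == C)
                     clsign A B * (clcoef a A * clcoef b B)).

Definition blade A : Cl := clmake (fun B => (B == A)%:R).

Lemma clmakeE F A : clcoef (clmake F) A = F A.
Proof. by rewrite /clcoef mxE enum_rankK. Qed.

Lemma clP a b : (forall A, clcoef a A = clcoef b A) -> a = b.
Proof.
move=> h; apply/rowP => k; have := h (enum_val k).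
by rewrite /clcoef enum_valK.
Qed.

Lemma clcoefD a b A : clcoef (a + b) A = clcoef a A + clcoef b A.
Proof. by rewrite /clcoef mxE. Qed.

Lemma clcoefZ (k : R) a A : clcoef (k *: a) A = k * clcoef a A.
Proof. by rewrite /clcoef mxE. Qed.

Lemma clsignE A B :
  clsign A B = \prod_i \prod_j (-1) ^+ [&& i \in A, j \in B & (j <= i)%N].
Proof.
rewrite /clsign big_mkcond /=; apply: eq_bigr => i _.
case: (i \in A); last by rewrite big1.
rewrite big_mkcond /=; apply: eq_bigr => j _.
by case: ifP => //= _; rewrite expr1.
Qed.

Lemma clsignDl A B C : clsign (symdiff A B) C = clsign A C * clsign B C.
Proof.
rewrite !clsignE -big_split /=; apply: eq_bigr => i _.
rewrite -big_split /=; apply: eq_bigr => j _.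
by rewrite in_symdiff -signr_addb !andb_addl.
Qed.

Lemma clsignDr A B C : clsign A (symdiff B C) = clsign A B * clsign A C.
Proof.
rewrite !clsignE -big_split /=; apply: eq_bigr => i _.
rewrite -big_split /=; apply: eq_bigr => j _.
by rewrite in_symdiff -signr_addb andb_addl andb_addr.
Qed.

Lemma clsign0s B : clsign finset.set0 B = 1.
Proof. by rewrite /clsign big_set0. Qed.

Lemma clsigns0 A : clsign A finset.set0 = 1.
Proof. by rewrite /clsign big1 // => i _; rewrite big1 // => j; rewrite inE. Qed.

Lemma clmulA : associative clmul.
Proof.
move=> a b c; apply: clP => D; rewrite !clmakeE.
transitivity (\sum_A \sum_B \sum_(C | symdiff A (symdiff B C) == D)
  clsign A (symdiff B C) * clsign B C * (clcoef a A * clcoef b B * clcoef c C)).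
  apply: eq_bigr => A _.
  transitivity (\sum_(E | symdiff A E == D) \sum_B \sum_(C | symdiff B C == E)
    clsign A (symdiff B C) * clsign B C *
      (clcoef a A * clcoef b B * clcoef c C)).
    apply: eq_bigr => E _; rewrite clmakeE !mulr_sumr; apply: eq_bigr => B _.
    rewrite !mulr_sumr; apply: eq_bigr => C /eqP ->.
    by rewrite -!mulrA; congr (_ * _); rewrite mulrCA.
  rewrite exchange_big /=; apply: eq_bigr => B _.
  rewrite (exchange_big_dep (fun C => symdiff A (symdiff B C) == D)) /=.
    apply: eq_bigr => C /eqP hC; rewrite (big_pred1 (symdiff B C)) //= => E.
    by rewrite [RHS]eq_sym andbC; case: eqP => // <-; rewrite hC eqxx.
  by move=> E C /eqP <- /eqP ->.
transitivity (\sum_A \sum_B \sum_(C | symdiff (symdiff A B) C == D)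
  clsign (symdiff A B) C * clsign A B *
    (clcoef a A * clcoef b B * clcoef c C)).
  apply: eq_bigr => A _; apply: eq_bigr => B _.
  apply: eq_big => [C|C _]; first by rewrite symdiffA.
  by rewrite clsignDr clsignDl; congr (_ * _); rewrite -mulrA [LHS]mulrC.
apply/esym.
transitivity (\sum_E \sum_(C | symdiff E C == D) \sum_A
   \sum_(B | symdiff A B == E)
  clsign (symdiff A B) C * clsign A B *
    (clcoef a A * clcoef b B * clcoef c C)).
  apply: eq_bigr => E _; apply: eq_bigr => C _; rewrite clmakeE.
  rewrite mulr_suml mulr_sumr; apply: eq_bigr => A _.
  rewrite mulr_suml mulr_sumr; apply: eq_bigr => B /eqP ->.
  by rewrite !mulrA.
under eq_bigr => E _ do rewrite exchange_big.
rewrite exchange_big /=; apply: eq_bigr => A _.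
under eq_bigr => E _ do rewrite exchange_big.
rewrite (exchange_big_dep xpredT) //=; apply: eq_bigr => B _.
by rewrite (big_pred1 (symdiff A B)) //= => E; rewrite eq_sym.
Qed.

Lemma clmulDl : left_distributive clmul +%R.
Proof.
move=> a b c; apply: clP => C; rewrite clcoefD !clmakeE -big_split /=.
apply: eq_bigr => A _; rewrite -big_split /=; apply: eq_bigr => B _.
by rewrite clcoefD mulrDl mulrDr.
Qed.

Lemma clmulDr : right_distributive clmul +%R.
Proof.
move=> a b c; apply: clP => C; rewrite clcoefD !clmakeE -big_split /=.
apply: eq_bigr => A _; rewrite -big_split /=; apply: eq_bigr => B _.
by rewrite clcoefD !mulrDr.
Qed.

Lemma clmul_blade A b C :
  clcoef (clmul (blade A) b) C =
  \sum_(B | symdiff A B == C) clsign A B * clcoef b B.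
Proof.
rewrite clmakeE (bigD1 A) //= [X in _ + X]big1 ?addr0.
  by apply: eq_bigr => B _; rewrite clmakeE eqxx mul1r.
move=> A' /negPf nA; rewrite big1 // => B _.
by rewrite clmakeE nA mul0r mulr0.
Qed.

Lemma clmul1r : left_id (blade finset.set0) clmul.
Proof.
move=> a; apply: clP => C; rewrite clmul_blade (big_pred1 C).
  by rewrite clsign0s mul1r.
by move=> B /=; rewrite symdiff0s.
Qed.

Lemma clmulr1 : right_id (blade finset.set0) clmul.
Proof.
move=> a; apply: clP => C; rewrite clmakeE (bigD1 C) //= [X in _ + X]big1.
  rewrite addr0 (bigD1 finset.set0) ?symdiffs0 //= big1 ?addr0.
    by rewrite clmakeE eqxx clsigns0 mul1r mulr1.
  by move=> B /andP[_ /negPf nB]; rewrite clmakeE nB !mulr0.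
move=> A nA; rewrite big1 // => B /eqP AB; rewrite clmakeE.
case: eqP => [B0|_]; last by rewrite !mulr0.
by move: nA; rewrite -AB B0 symdiffs0 eqxx.
Qed.

Lemma blade0_neq0 : blade finset.set0 != 0 :> Cl.
Proof.
apply/eqP => /(congr1 (clcoef^~ finset.set0)).
by rewrite clmakeE eqxx /clcoef mxE; apply/eqP; rewrite oner_eq0.
Qed.

HB.instance Definition _ := GRing.Zmodule_isNzRing.Build (clifford R m)
  clmulA clmul1r clmulr1 clmulDl clmulDr blade0_neq0.

Lemma clscaleAl (k : R) a b : k *: (a * b) = (k *: a) * b.
Proof.
apply: clP => C; rewrite clcoefZ !clmakeE mulr_sumr; apply: eq_bigr => A _.
rewrite mulr_sumr; apply: eq_bigr => B _.
by rewrite clcoefZ mulrCA !mulrA.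
Qed.

HB.instance Definition _ := GRing.Lmodule_isLalgebra.Build R (clifford R m)
  clscaleAl.

Lemma clscaleAr (k : R) a b : k *: (a * b) = a * (k *: b).
Proof.
apply: clP => C; rewrite clcoefZ !clmakeE mulr_sumr; apply: eq_bigr => A _.
rewrite mulr_sumr; apply: eq_bigr => B _.
by rewrite clcoefZ mulrCA; congr (_ * _); rewrite mulrCA.
Qed.

HB.instance Definition _ := GRing.Lalgebra_isAlgebra.Build R (clifford R m)
  clscaleAr.

Definition clgen (j : 'I_m) : Cl := blade [set j]%SET.

Lemma bladeM A B : blade A * blade B = clsign A B *: blade (symdiff A B).
Proof.
apply: clP => C; rewrite clcoefZ clmul_blade.
under eq_bigr => B' _ do rewrite clmakeE.
rewrite clmakeE eq_sym; case: eqP => [<-|nC].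
  rewrite (bigD1 B) //= eqxx big1 ?addr0 // => B' /andP[_ /negPf ->].
  by rewrite mulr0.
rewrite mulr0 big1 // => B' /eqP e; case: eqP => [eB|]; last by rewrite mulr0.
by case: nC; rewrite -eB.
Qed.

Lemma clsign1 (j k : 'I_m) :
  clsign [set j]%SET [set k]%SET = (-1) ^+ (k <= j)%N.
Proof.
rewrite /clsign big_set1 big_mkcondr /= big_set1.
by case: leqP.
Qed.

Lemma clgen_sqr j : clgen j * clgen j = -1.
Proof.
rewrite bladeM clsign1 leqnn expr1 scaleN1r; congr (- _).
suff -> : symdiff [set j]%SET [set j]%SET = finset.set0 by [].
by apply/finset.setP => i; rewrite in_symdiff addbb inE.
Qed.

Lemma clgen_anticomm j k : j != k -> clgen j * clgen k = - (clgen k * clgen j).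
Proof.
move=> njk; rewrite !bladeM !clsign1.
have -> : symdiff [set k]%SET [set j]%SET = symdiff [set j]%SET [set k]%SET.
  by apply/finset.setP => i; rewrite !in_symdiff addbC.
rewrite -scaleNr; congr (_ *: _).
have : (j : nat) != k by [].
by case: ltngtP => //= _ _; rewrite ?opprK.
Qed.

End CliffordRing.

Arguments clgen {R m} j.

Section EuclideanSpace.
Variables (R : realType) (m : nat).
Local Notation E := 'rV[R]_m.
Implicit Types u v : E.

Definition dotv u v : R := \sum_(j < m) u ord0 j * v ord0 j.

(* The norm `|v| that the library puts on 'rV[R]_m is the sup norm. *)
Definition enorm v : R := Num.sqrt (dotv v v).

Definition unitv (j : 'I_m) : E := delta_mx ord0 j.

Definition clvec v : clifford R m := \sum_(j < m) v ord0 j *: clgen j.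

Definition reflection (a x : E) : E := x - (2 * dotv a x / dotv a a) *: a.

End EuclideanSpace.

Section RootSystems.
Variables (R : realType) (m : nat).
Local Notation E := 'rV[R]_m.

Definition root_system (Rs : {fset E}) : Prop :=
  [/\ 0 \notin Rs,
      forall a, a \in Rs -> forall c : R, c *: a \in Rs <-> c = 1 \/ c = -1
    & forall a, a \in Rs -> [fset reflection a b | b in Rs]%fset = Rs].

Definition normalized (Rs : {fset E}) : Prop :=
  forall a, a \in Rs -> dotv a a = 2.

Definition positive_subsystem (Rs Rp : {fset E}) : Prop :=
  [/\ forall a, a \in Rs <-> a \in Rp \/ - a \in Rp,
      forall a, ~ (a \in Rp /\ - a \in Rp)
    & exists v : E, forall a, a \in Rp -> 0 < dotv v a].

(* [k] is only meaningful on [Rs].  An element of the reflection group is a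
   product of reflections in a sequence [s] of roots. *)
Definition multiplicity_function (Rs : {fset E}) (k : E -> R) : Prop :=
  forall (s : seq E) (b : E), {subset s <= Rs} -> b \in Rs ->
    k (foldr (fun a x => reflection a x) b s) = k b.

Definition gamma (Rp : {fset E}) (k : E -> R) : R := \sum_(a <- Rp) k a.

End RootSystems.

Section DunklOperators.
Variables (R : realType) (m : nat).
Local Notation E := 'rV[R]_m.
Variables (Rp : {fset E}) (k : E -> R).

(* On the reflecting hyperplane the difference quotient is a removable
   singularity, and stands for its continuous extension. *)
Definition reflection_quotient (V : normedModType R) (f : E -> V) (a y : E) :
    V :=
  let q z := (dotv a z)^-1 *: (f z - f (reflection a z)) in
  if dotv a y == 0
  then lim (q z @[z --> within [set z | dotv a z != 0] (nbhs y)])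
  else q y.

Definition dunkl (V : normedModType R) (j : 'I_m) (f : E -> V) (y : E) : V :=
  'D_(unitv R j) f y
  + \sum_(a <- Rp) (k a * a ord0 j) *: reflection_quotient f a y.

Definition dunkl_monomial (mu : mpoly.multinom m) (f : E -> R^o) : E -> R^o :=
  foldr (fun j g => iter (mu j) (dunkl j) g) f
    (enum 'I_m).

Definition dunkl_pairing (p q : mpoly.mpoly m R) : R :=
  \sum_(mu <- mpoly.msupp p)
    mpoly.mcoeff mu p *
    dunkl_monomial mu (fun y : E => mpoly.meval (fun j => y ord0 j) q) 0.

(* The form is symmetric, so that its left and right radicals coincide. *)
Definition singular_multiplicity : Prop :=
  exists p : mpoly.mpoly m R, p != 0 /\ forall q, dunkl_pairing p q = 0.

End DunklOperators.

(* The paravector x_0 + \underline{x} is the pair (x_0, \underline{x}), and the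
   complex number s + i t is the pair (s, t). *)
Section SliceFunctions.
Variables (R : realType) (m : nat).
Local Notation E := 'rV[R]_m.
Local Notation Cl := (clifford R m).

Definition conjp (z : R * R) : R * R := (z.1, - z.2).

Definition conj_symmetric (D : set (R * R)) : Prop :=
  forall z, D z -> D (conjp z).

Definition axial_domain (D : set (R * R)) : set (R * E) :=
  [set x | exists a b w, [/\ D (a, b), enorm w = 1 & x = (a, b *: w)]].

Definition stem_function (D : set (R * R)) (alpha beta : R * R -> Cl) : Prop :=
  forall z, D z -> alpha (conjp z) = alpha z /\ beta (conjp z) = - beta z.

Definition holomorphic_stem (D : set (R * R)) (alpha beta : R * R -> Cl) :
    Prop :=
  forall z, D z ->
  [/\ differentiable alpha z, differentiable beta z,
      'D_(1, 0) alpha z = 'D_(0, 1) beta z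
    & 'D_(0, 1) alpha z = - 'D_(1, 0) beta z].

(* At \underline{x} = 0 the direction x/|x| is read as 0, which is harmless
   because beta vanishes on the real axis. *)
Definition slice_regular (D : set (R * R)) (f : R * E -> Cl) : Prop :=
  exists alpha beta : R * R -> Cl,
  [/\ stem_function D alpha beta,
      holomorphic_stem D alpha beta
    & forall x, axial_domain D x ->
        f x = alpha (x.1, enorm x.2)
              + clvec ((enorm x.2)^-1 *: x.2) * beta (x.1, enorm x.2)].

End SliceFunctions.

Section InverseIntertwining.
Variables (R : realType) (m : nat).
Local Notation E := 'rV[R]_m.
Local Notation Cl := (clifford R m).
Variables (Rp : {fset E}) (k : E -> R).

Definition dunkl_along (v : E) (g : E -> Cl) (y : E) : Cl :=
  \sum_(j < m) v ord0 j *: dunkl Rp k j g y.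

Definition exp_dunkl_term (f : R * E -> Cl) (x : R * E) (n : nat) : Cl :=
  (n`!%:R : R)^-1 *: iter n (dunkl_along x.2) (fun y => f (x.1, y)) 0.

Definition exp_dunkl (f : R * E -> Cl) (x : R * E) : Cl :=
  lim (series (exp_dunkl_term f x) @ \oo).

(* The points x_0 + \underline{x} near which Exp(sum_j x_j T_j) f(x_0 + y)|_(y=0)
   makes sense: the exponential series converges uniformly around the point, and
   x_0 lies in the domain of f, as required by the evaluation at y = 0. *)
Definition exp_dunkl_domain (D : set (R * R)) (f : R * E -> Cl) :
    set (R * E) :=
  [set x | D (x.1, 0) /\
    exists2 U, nbhs x U &
      {uniform U, (fun n z => series (exp_dunkl_term f z) n) @ \oo
        --> exp_dunkl f}].

End InverseIntertwining.

Section Monogenic.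
Variables (R : realType) (m : nat).
Local Notation E := 'rV[R]_m.
Local Notation Cl := (clifford R m).

Definition cauchy_riemann (g : R * E -> Cl) (x : R * E) : Cl :=
  'D_(1, 0) g x + \sum_(j < m) clgen j * 'D_(0, unitv R j) g x.

Definition monogenic_on (U : set (R * E)) (g : R * E -> Cl) : Prop :=
  forall x, U x ->
  [/\ differentiable g x,
      forall v, {for x, continuous ('D_v g)}
    & cauchy_riemann g x = 0].

End Monogenic.

(* Main.v *)
(* Near the real axis f(x_0 + y) = sum_(n < 2L) y^n a_n(x_0) + O(|y|^(2L)), where
   a_n(x_0) is the n-th Taylor coefficient of the stem function at x_0; the stem
   function is smooth by Goursat's argument and Cauchy's estimates.  A Dunkl
   operator lowers by one both the degree of a homogeneous polynomial and the
   order of vanishing at 0, so the n-th term of the exponential series is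
   Q_n(x) a_n(x_0) with Q_n(x) = (sum_j x_j T_j)^n y^n / n!.

   Since the T_j commute, Q_n has partial derivatives T_j (sum_i x_i T_i)^(n-1) y^n
   / (n-1)!, and m + 2 gamma = 1 gives sum_j e_j T_j y^n = - n y^(n-1); hence
   sum_j e_j d_j Q_n = - n Q_(n-1).  As a_n' = (n+1) a_(n+1), the Cauchy-Riemann
   operator turns the series into the telescoping sum of
   (n+1) Q_n a_(n+1) - n Q_(n-1) a_n.

   To differentiate termwise: uniform convergence near a point bounds the terms,
   homogeneity in x upgrades the bound to geometric decay on a smaller
   neighbourhood, Markov's inequality on lines extends the decay to the
   x-derivatives, and the x_0-derivative of a term is minus the Dirac derivative
   of the next one. *)

Require Import Defs.
From HB Require Import structures.
From mathcomp Require Import all_boot all_order all_algebra.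
From mathcomp Require Import finmap.
From mathcomp Require Import all_classical all_reals all_analysis.
From mathcomp Require Import ring lra zify.

Set Implicit Arguments.
Unset Strict Implicit.
Unset Printing Implicit Defensive.

Import Order.TTheory GRing.Theory Num.Theory.
Import numFieldNormedType.Exports.

Local Open Scope classical_set_scope.
Local Open Scope ring_scope.

(** * Goursat's theorem on rectangles *)

(** Goursat's bisection replaces it, applied in polar coordinates (r, t), where circles become
    segments and Cauchy's formula for the derivative comes from a closed form on a rectangle. The
    second obstacle is the difference quotient of a Dunkl operator, a limit on the reflecting
    hyperplane. On an inductive class of functions the numerator factors explicitly through the
    linear form, which determines that limit; linearity, equivariance and commutativity are then
    proved from such factorizations. The Taylor expansion of f is used only as a finite sum with an
    exact remainder |y|^(2L) g, with g in the class, so that no infinite sum is exchanged with a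
    Dunkl operator: n operators followed by evaluation at 0 kill the remainder once L > n. Taylor
    coefficients multiply on the right, Dunkl operators act on scalar coordinates and the e_j
    multiply on the left, so noncommutativity never interferes. *)

Section SegmentIntegral.
Variable R : realType.
Implicit Types (a b c M : R) (f g : R -> R).

(** Two-sided continuity at every point of the closed segment, endpoints included: it passes to sums
    and products pointwise, without subspace topologies. *)
Definition ccont a b f := forall x, a <= x <= b -> {for x, continuous f}.

Definition sint a b f : R := \int[lebesgue_measure]_(x in `[a, b]) f x.

Lemma ccont_cst a b c : ccont a b (fun=> c).
Proof. by move=> x _; exact: cvg_cst. Qed.

Lemma ccontD a b f g : ccont a b f -> ccont a b g -> ccont a b (fun x => f x + g x).
Proof. by move=> cf cg x h; apply: cvgD; [exact: cf|exact: cg]. Qed.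

Lemma ccontB a b f g : ccont a b f -> ccont a b g -> ccont a b (fun x => f x - g x).
Proof. by move=> cf cg x h; apply: cvgB; [exact: cf|exact: cg]. Qed.

Lemma ccontM a b f g : ccont a b f -> ccont a b g -> ccont a b (fun x => f x * g x).
Proof. by move=> cf cg x h; apply: cvgM; [exact: cf|exact: cg]. Qed.

Lemma ccont_integrable a b f : ccont a b f ->
  lebesgue_measure.-integrable `[a, b] (EFin \o f).
Proof.
move=> cf; apply: continuous_compact_integrable; first exact: segment_compact.
apply: continuous_in_subspaceT => x; rewrite inE /= in_itv /=; exact: cf.
Qed.

Lemma sintD a b f g : ccont a b f -> ccont a b g ->
  sint a b (fun x => f x + g x) = sint a b f + sint a b g.
Proof. by move=> cf cg; rewrite /sint RintegralD//; exact: ccont_integrable. Qed.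

Lemma sintB a b f g : ccont a b f -> ccont a b g ->
  sint a b (fun x => f x - g x) = sint a b f - sint a b g.
Proof. by move=> cf cg; rewrite /sint RintegralB//; exact: ccont_integrable. Qed.

Lemma sintZ a b c f : ccont a b f -> sint a b (fun x => c * f x) = c * sint a b f.
Proof. by move=> cf; rewrite /sint RintegralZl//; exact: ccont_integrable. Qed.

Lemma sint_cst a b c : a <= b -> sint a b (fun=> c) = c * (b - a).
Proof.
move=> ab; rewrite /sint Rintegral_cst//= lebesgue_measure_itv/= lte_fin.
by move: ab; rewrite le_eqVlt => /predU1P[->|->]; rewrite ?ltxx ?subrr.
Qed.

Lemma eq_sint a b f g : (forall x, a <= x <= b -> f x = g x) ->
  sint a b f = sint a b g.
Proof. by move=> fg; apply: eq_Rintegral => x; rewrite inE/= in_itv/=; exact: fg. Qed.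

Lemma sint_bound a b M f : a <= b -> ccont a b f ->
  (forall x, a <= x <= b -> `|f x| <= M) -> `|sint a b f| <= M * (b - a).
Proof.
move=> ab cf fM; rewrite -(sint_cst _ ab).
have mc r : ccont a b (fun=> r) by exact: ccont_cst.
rewrite ler_norml; apply/andP; split.
  rewrite -mulN1r -sintZ//; apply: le_Rintegral => //=; try exact: ccont_integrable.
  by move=> x; rewrite in_itv/= => /fM; rewrite mulN1r ler_norml => /andP[].
apply: le_Rintegral => //=; try exact: ccont_integrable.
by move=> x; rewrite in_itv/= => /fM; rewrite ler_norml => /andP[].
Qed.

Lemma sint_chasles a b c f : a <= c -> c <= b -> ccont a b f ->
  sint a b f = sint a c f + sint c b f.
Proof.
move=> ac cb cf; rewrite /sint.
have := @Rintegral_itvB R f (BLeft a) (BRight b) c (ccont_integrable cf).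
rewrite !bnd_simp => /(_ ac cb) h.
have <- := @Rintegral_itv_obnd_cbnd R c (BRight b) f.
  by rewrite -h addrC subrK.
apply: integrableS (ccont_integrable cf) => //=.
by apply: subset_itvr; rewrite bnd_simp.
Qed.

Lemma sint_FTC a b (F : R -> R) f : a < b -> ccont a b f ->
  (forall x : R, is_derive x 1 F (f x)) -> sint a b f = F b - F a.
Proof.
move=> ab cf dF; rewrite /sint /Rintegral (@continuous_FTC2 _ f F)//.
- apply: continuous_in_subspaceT => x; rewrite inE /= in_itv /=; exact: cf.
- have cF x : {for x, continuous F}.
    by apply/differentiable_continuous/derivable1_diffP; have [] := dF x.
  split => [x _||]; first by have [] := dF x.
  + exact/cvg_at_right_filter/cF.
  + exact/cvg_at_left_filter/cF.
- by move=> x _; rewrite derive1E; have [] := dF x.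
Qed.

End SegmentIntegral.

(** * Differentiability through epsilon-delta estimates *)

Section EpsDiff.
Variables (R : realType) (V W : normedModType R).
Implicit Types (f : V -> W) (x : V).

(** This and its converse below replace little-o by explicit inequalities, which can be integrated
    over a circle or summed over a series. *)
Lemma differentiable_approx f x : differentiable f x ->
  forall e, 0 < e -> exists2 d, 0 < d &
    forall z, `|z - x| < d -> `|f z - f x - 'D_(z - x) f x| <= e * `|z - x|.
Proof.
move=> df e e0; have /diff_locallyP[_ /eqaddoP fo] := df.
have /nbhs_normP[d /= d0 h] := fo _ e0.
exists d => // z zx; have /= := h (z - x).
rewrite sub0r normrN => /(_ zx); rewrite !fctE /= subrK.
by rewrite opprD addrA deriveE.
Qed.

Lemma approx_differentiable f x (L : {linear V -> W}) : continuous L ->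
  (forall e, 0 < e -> exists2 d, 0 < d &
    forall z, `|z - x| < d -> `|f z - f x - L (z - x)| <= e * `|z - x|) ->
  differentiable f x /\ forall v, 'D_v f x = L v.
Proof.
move=> cL h.
have fL : f \o shift x = cst (f x) + L +o_ 0 id.
  apply/eqaddoP => e e0; have [d d0 {}h] := h _ e0.
  apply/nbhs_normP; exists d => //= y /=; rewrite sub0r normrN => yd.
  have := h (y + x); rewrite addrK => /(_ yd).
  by rewrite !fctE /= opprD addrA.
have dL := diff_unique cL fL.
have df : differentiable f x by apply/diff_locallyP; rewrite dL.
by split => // v; rewrite deriveE// dL.
Qed.

End EpsDiff.

Section Plane.
Variable R : realType.
Implicit Types (f : R * R -> R) (z h : R * R).

(** The norm of the product is the max norm: balls are squares, which contain the Euclidean circles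
    of the same radius. *)
Lemma plane_norm_ltP (h : R * R) d : (`|h| < d) = (`|h.1| < d) && (`|h.2| < d).
Proof. by rewrite prod_normE gt_max. Qed.

Lemma plane_norm_leP (h : R * R) d : (`|h| <= d) = (`|h.1| <= d) && (`|h.2| <= d).
Proof. by rewrite prod_normE ge_max. Qed.

Lemma derive_plane f z h : differentiable f z ->
  'D_h f z = 'D_(1, 0) f z * h.1 + 'D_(0, 1) f z * h.2.
Proof.
move=> df; rewrite !deriveE//.
have {1}-> : h = h.1 *: (1, 0) + h.2 *: (0, 1).
  case: h => a b; apply/pair_equal_spec; split => /=; rewrite /GRing.scale /=; ring.
by rewrite linearD !linearZ /= /GRing.scale /=; ring.
Qed.

Definition plane_form (a b : R) (h : R * R) : R := a * h.1 + b * h.2.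

Lemma plane_form_linear a b : linear (plane_form a b).
Proof. by move=> k u v; rewrite /plane_form /= /GRing.scale /=; ring. Qed.

HB.instance Definition _ a b :=
  GRing.isLinear.Build R (R * R)%type R *:%R (plane_form a b) (plane_form_linear a b).

Lemma plane_form_continuous a b : continuous (plane_form a b).
Proof.
move=> z; apply: cvgD; apply: cvgMr; [exact: cvg_fst|exact: cvg_snd].
Qed.

Lemma plane_differentiable f z a b :
  (forall e, 0 < e -> exists2 d, 0 < d &
    forall y, `|y - z| < d ->
      `|f y - f z - (a * (y.1 - z.1) + b * (y.2 - z.2))| <= e * `|y - z|) ->
  [/\ differentiable f z, 'D_(1, 0) f z = a & 'D_(0, 1) f z = b].
Proof.
move=> h; have [] := @approx_differentiable _ _ _ f z (plane_form a b).
- exact: plane_form_continuous.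
- exact: h.
- by move=> df D; split => //; rewrite D /= /plane_form /= ?mulr1 ?mulr0 ?addr0 ?add0r.
Qed.

Lemma plane_differentiable_sqr f z a b C r : 0 < r ->
  (forall y, `|y - z| < r ->
      `|f y - f z - (a * (y.1 - z.1) + b * (y.2 - z.2))| <= C * `|y - z| ^+ 2) ->
  [/\ differentiable f z, 'D_(1, 0) f z = a & 'D_(0, 1) f z = b].
Proof.
move=> r0 h; apply: plane_differentiable => e e0.
have C0 : 0 < `|C| + 1 by rewrite ltr_wpDl.
exists (Num.min r (e / (`|C| + 1))); first by rewrite lt_min r0 divr_gt0.
move=> y; rewrite lt_min => /andP[yr ye]; apply: le_trans (h _ yr) _.
rewrite expr2 mulrA ler_wpM2r//.
apply: (@le_trans _ _ ((`|C| + 1) * `|y - z|)).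
  by rewrite ler_wpM2r// (le_trans (ler_norm _))// lerDl.
by rewrite mulrC -ler_pdivlMr// ltW.
Qed.

End Plane.

Section Goursat.
Variable R : realType.
Implicit Types (p q : R * R -> R) (a c w h : R) (z : R * R).

Lemma continuous_slice1 p s c : {for (s, c), continuous p} ->
  {for s, continuous (fun s => p (s, c))}.
Proof.
move=> cp; apply: (@continuous_comp _ _ _ (fun s : R => (s, c)) p) => //.
exact/differentiable_continuous/differentiable_pair.
Qed.

Lemma continuous_slice2 p s c : {for (s, c), continuous p} ->
  {for c, continuous (fun c => p (s, c))}.
Proof.
move=> cp; apply: (@continuous_comp _ _ _ (fun c : R => (s, c)) p) => //.
exact/differentiable_continuous/differentiable_pair.
Qed.

(** The integral of p ds + q dt along the boundary of [a, a + w] x [c, c + h], counterclockwise.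
    Opposite sides share an integral, so that estimates only involve differences across the
    rectangle. *)
Definition bdry p q a w c h : R :=
  sint a (a + w) (fun s => p (s, c) - p (s, c + h)) +
  sint c (c + h) (fun t => q (a + w, t) - q (a, t)).

Definition inrect a w c h z := a <= z.1 <= a + w /\ c <= z.2 <= c + h.

Lemma bdryE p q a w c h : 0 <= w -> 0 <= h ->
  (forall z, inrect a w c h z -> {for z, continuous p}) ->
  (forall z, inrect a w c h z -> {for z, continuous q}) ->
  bdry p q a w c h = sint a (a + w) (fun s => p (s, c))
    - sint a (a + w) (fun s => p (s, c + h))
    + (sint c (c + h) (fun t => q (a + w, t)) - sint c (c + h) (fun t => q (a, t))).
Proof.
move=> w0 h0 cp cq; rewrite /bdry !sintB//.
- by move=> t tc; apply/continuous_slice2/cq; split; rewrite //= ?lexx ?lerDl ?w0.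
- by move=> t tc; apply/continuous_slice2/cq; split; rewrite //= ?lexx ?lerDl ?w0.
- by move=> t tc; apply/continuous_slice1/cp; split; rewrite //= ?lexx ?lerDl ?h0.
- by move=> t tc; apply/continuous_slice1/cp; split; rewrite //= ?lexx ?lerDl ?h0.
Qed.

Lemma inrect_sub a w c h a' w' c' h' : a <= a' -> a' + w' <= a + w ->
  c <= c' -> c' + h' <= c + h -> inrect a' w' c' h' `<=` inrect a w c h.
Proof. by move=> ? ? ? ? z [/andP[? ?] /andP[? ?]]; split; lra. Qed.

Lemma bdry_split p q a w c h : 0 <= w -> 0 <= h ->
  (forall z, inrect a (w + w) c (h + h) z -> {for z, continuous p}) ->
  (forall z, inrect a (w + w) c (h + h) z -> {for z, continuous q}) ->
  bdry p q a (w + w) c (h + h) =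
    bdry p q a w c h + bdry p q (a + w) w c h +
    bdry p q a w (c + h) h + bdry p q (a + w) w (c + h) h.
Proof.
move=> w0 h0 cp cq; rewrite !bdryE//; try lra;
  try by move=> z zr; first [apply: cp|apply: cq]; apply: inrect_sub zr; lra.
have P y : c <= y <= c + (h + h) -> sint a (a + (w + w)) (fun s => p (s, y)) =
  sint a (a + w) (fun s => p (s, y)) + sint (a + w) (a + w + w) (fun s => p (s, y)).
  move=> yc; rewrite (@sint_chasles _ a (a + (w + w)) (a + w)) ?addrA//; try lra.
  by move=> s sa; apply/continuous_slice1/cp; split => //=; lra.
have Q x : a <= x <= a + (w + w) -> sint c (c + (h + h)) (fun t => q (x, t)) =
  sint c (c + h) (fun t => q (x, t)) + sint (c + h) (c + h + h) (fun t => q (x, t)).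
  move=> xa; rewrite (@sint_chasles _ c (c + (h + h)) (c + h)) ?addrA//; try lra.
  by move=> s sa; apply/continuous_slice2/cq; split => //=; lra.
rewrite !P ?Q ?addrA; try lra.
Qed.

(** The first-order parts of the two differences integrate to - B h w and B w h, which cancel
    because of the equality of cross derivatives. What remains is at most 2 e (w + h) on sides of
    total length w + h. *)
Lemma bdry_small p q z e : differentiable p z -> differentiable q z ->
  'D_(0, 1) p z = 'D_(1, 0) q z -> 0 < e ->
  exists2 d, 0 < d & forall a w c h, inrect a w c h z -> w + h < d ->
    0 <= w -> 0 <= h ->
    (forall z, inrect a w c h z -> {for z, continuous p}) ->
    (forall z, inrect a w c h z -> {for z, continuous q}) ->
    `|bdry p q a w c h| <= 2 * e * (w + h) ^+ 2.
Proof.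
move=> dp dq pq e0.
have [d1 d10 h1] := differentiable_approx dp e0.
have [d2 d20 h2] := differentiable_approx dq e0.
exists (Num.min d1 d2); first by rewrite lt_min d10.
move=> a w c h zr; rewrite lt_min => /andP[wd1 wd2] w0 h0 cp cq.
have near y : inrect a w c h y -> `|y - z| <= w + h.
  case: zr => /andP[? ?] /andP[? ?] [/andP[? ?] /andP[? ?]].
  by rewrite plane_norm_leP /= !ler_norml; lra.
set A := 'D_(1, 0) p z; set B := 'D_(0, 1) p z; set C := 'D_(0, 1) q z.
have Hp y : inrect a w c h y ->
  `|p y - p z - (A * (y.1 - z.1) + B * (y.2 - z.2))| <= e * (w + h).
  move=> yr; have yz := near y yr.
  rewrite -(derive_plane (y - z) dp); apply: le_trans (h1 y (le_lt_trans yz wd1)) _.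
  by rewrite ler_wpM2l// ltW.
have Hq y : inrect a w c h y ->
  `|q y - q z - (B * (y.1 - z.1) + C * (y.2 - z.2))| <= e * (w + h).
  move=> yr; have yz := near y yr.
  rewrite /B pq -(derive_plane (y - z) dq).
  apply: le_trans (h2 y (le_lt_trans yz wd2)) _.
  by rewrite ler_wpM2l// ltW.
(* The added constants have opposite integrals, so [F] and [G] still integrate to [bdry]. *)
pose F s := p (s, c) - p (s, c + h) + B * h.
pose G t := q (a + w, t) - q (a, t) - B * w.
have cont1 : ccont a (a + w) (fun s => p (s, c) - p (s, c + h)).
  by apply: ccontB => s sa; apply/continuous_slice1/cp; split; rewrite //= ?lexx ?lerDl ?h0.
have cont2 : ccont c (c + h) (fun t => q (a + w, t) - q (a, t)).
  by apply: ccontB => s sa; apply/continuous_slice2/cq; split; rewrite //= ?lexx ?lerDl ?w0.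
have cst (u v r : R) : ccont u v (fun=> r) by exact: ccont_cst.
have -> : bdry p q a w c h = sint a (a + w) F + sint c (c + h) G.
  rewrite (sintD cont1 (cst _ _ (B * h))) (sintB cont2 (cst _ _ (B * w))).
  by rewrite !sint_cst ?lerDl// /bdry; ring.
have bF : `|sint a (a + w) F| <= 2 * e * (w + h) * (a + w - a).
  apply: sint_bound; rewrite ?lerDl//; first exact: ccontD.
  move=> s sa; have := Hp (s, c); have := Hp (s, c + h).
  rewrite /inrect /= sa lexx lerDl h0 ?lerD2l ?lexx/= => /(_ (conj isT isT)) k2.
  move=> /(_ (conj isT isT)) k1.
  have := le_trans (ler_normB _ _) (lerD k1 k2).
  by congr (`|_| <= _); rewrite /F; ring.
have bG : `|sint c (c + h) G| <= 2 * e * (w + h) * (c + h - c).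
  apply: sint_bound; rewrite ?lerDl//; first exact: ccontB.
  move=> s sa; have := Hq (a + w, s); have := Hq (a, s).
  rewrite /inrect /= sa lexx lerDl w0 ?lerD2l ?lexx/= => /(_ (conj isT isT)) k2.
  move=> /(_ (conj isT isT)) k1.
  have := le_trans (ler_normB _ _) (lerD k1 k2).
  by congr (`|_| <= _); rewrite /G; ring.
apply: le_trans (ler_normD _ _) _; apply: le_trans (lerD bF bG) _.
by rewrite le_eqVlt; apply/orP; left; apply/eqP; ring.
Qed.

(** The intervals [u n, u n + w / 2^n] are nested; the supremum of their left ends lies in all of
    them. *)
Lemma bisect_limit (u : nat -> R) w : 0 <= w ->
  (forall n, u n <= u n.+1 <= u n + w / 2 ^+ n.+1) ->
  exists l, forall n, u n <= l <= u n + w / 2 ^+ n.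
Proof.
move=> w0 hu.
have upn k n : u n <= u (n + k)%N /\ u (n + k)%N + w / 2 ^+ (n + k) <= u n + w / 2 ^+ n.
  elim: k => [|k [IH1 IH2]]; first by rewrite addn0.
  have /andP[h1 h2] := hu (n + k)%N; rewrite addnS; split; first exact: le_trans h1.
  apply: le_trans IH2; have -> : w / 2 ^+ (n + k) = w / 2 ^+ (n + k).+1 + w / 2 ^+ (n + k).+1.
    by rewrite exprS; field; rewrite expf_neq0.
  by rewrite addrA lerD2r.
have pw n : 0 <= w / 2 ^+ n by rewrite divr_ge0// exprn_ge0.
have ub n m : u m <= u n + w / 2 ^+ n.
  have [nm|mn] := leqP n m.
    have [_] := upn (m - n)%N n; rewrite subnKC// => h.
    by apply: le_trans h; rewrite lerDl.
  have [h _] := upn (n - m)%N m; rewrite subnKC ?(ltnW mn)// in h.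
  by apply: le_trans h _; rewrite lerDl.
exists (sup (range u)) => n; apply/andP; split.
  apply: ub_le_sup; last by exists n.
  by exists (u n + w / 2 ^+ n) => _ [m _ <-].
by apply: ge_sup; [exists (u 0%N), 0%N|move=> _ [m _ <-]].
Qed.

(* By Goursat's bisection argument: a stem function is only assumed to be
   differentiable, with no continuity of its partial derivatives. *)
Lemma bdry_closed_form p q a w c h : 0 <= w -> 0 <= h ->
  (forall z, inrect a w c h z -> [/\ differentiable p z, differentiable q z
     & 'D_(0, 1) p z = 'D_(1, 0) q z]) ->
  bdry p q a w c h = 0.
Proof.
move=> w0 h0 pq; apply/eqP; apply: contraT => J0.
have cp z : inrect a w c h z -> {for z, continuous p}.
  by case/pq => dp _ _; exact: differentiable_continuous.
have cq z : inrect a w c h z -> {for z, continuous q}.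
  by case/pq => _ dq _; exact: differentiable_continuous.
pose W n := w / 2 ^+ n; pose H n := h / 2 ^+ n.
have W0 n : 0 <= W n by rewrite divr_ge0// exprn_ge0.
have H0 n : 0 <= H n by rewrite divr_ge0// exprn_ge0.
have WS n : W n = W n.+1 + W n.+1 by rewrite /W exprS; field; rewrite expf_neq0.
have HS n : H n = H n.+1 + H n.+1 by rewrite /H exprS; field; rewrite expf_neq0.
set J := `|bdry p q a w c h|; have {}J0 : 0 < J by rewrite normr_gt0.
(* The corner [x] of a subrectangle of generation n that keeps at least its share 4^(-n) of the
   boundary integral. *)
pose good n (x : R * R) := [/\ inrect x.1 (W n) x.2 (H n) `<=` inrect a w c h
  & J / 4 ^+ n <= `|bdry p q x.1 (W n) x.2 (H n)|].
pose next n (x y : R * R) := (x.1 <= y.1 <= x.1 + W n.+1) /\ (x.2 <= y.2 <= x.2 + H n.+1).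
have step (nx : nat * (R * R)) : exists y, good nx.1 nx.2 -> good nx.1.+1 y /\ next nx.1 nx.2 y.
  case: nx => n x /=.
  have [gx|] := pselect (good n x); last by exists x.
  case: gx => sub big.
  suff [y [gy ny]] : exists y, good n.+1 y /\ next n x y by exists y.
  have subs (y : R * R) : next n x y ->
      inrect y.1 (W n.+1) y.2 (H n.+1) `<=` inrect a w c h.
    move=> [/andP[y1 y2] /andP[y3 y4]]; apply: subset_trans sub.
    by apply: inrect_sub => //; rewrite ?(WS n) ?(HS n) addrA lerD2r.
  have := big; rewrite (WS n) (HS n) bdry_split//.
  - have J4 : J / 4 ^+ n = 4 * (J / 4 ^+ n.+1).
      by rewrite exprS; field; rewrite expf_neq0.
    rewrite J4 => tot; apply: contrapT => nogood.
    have small y : next n x y -> `|bdry p q y.1 (W n.+1) y.2 (H n.+1)| < J / 4 ^+ n.+1.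
      move=> ny; rewrite ltNge; apply/negP => ge; apply: nogood.
      by exists y; split => //; split => //; exact: subs.
    have W1 := W0 n.+1; have H1 := H0 n.+1.
    have k1 := small (x.1, x.2); have k2 := small (x.1 + W n.+1, x.2).
    have k3 := small (x.1, x.2 + H n.+1).
    have k4 := small (x.1 + W n.+1, x.2 + H n.+1).
    move: k1 k2 k3 k4; rewrite /next /= !lexx !lerDl W1 H1 /=.
    move=> /(_ (conj isT isT)) k1 /(_ (conj isT isT)) k2.
    move=> /(_ (conj isT isT)) k3 /(_ (conj isT isT)) k4.
    have := le_trans tot (le_trans (ler_normD _ _) (lerD (le_trans (ler_normD _ _)
      (lerD (ler_normD _ _) (lexx _))) (lexx _))).
    lra.
  - by move=> z; rewrite -(WS n) -(HS n) => /sub /cp.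
  - by move=> z; rewrite -(WS n) -(HS n) => /sub /cq.
have [f fP] := choice step.
pose s := fix s n := if n is n'.+1 then f (n', s n') else (a, c).
have W_0 : W 0%N = w by rewrite /W expr0 divr1.
have H_0 : H 0%N = h by rewrite /H expr0 divr1.
have gs n : good n (s n).
  elim: n => [|n IH]; first by split; rewrite /= ?W_0 ?H_0// expr0 divr1.
  by have [] := fP (n, s n) IH.
have ns n : next n (s n) (s n.+1) by have [] := fP (n, s n) (gs n).
have [x1 hx1] := @bisect_limit (fun n => (s n).1) w w0 (fun n => (ns n).1).
have [x2 hx2] := @bisect_limit (fun n => (s n).2) h h0 (fun n => (ns n).2).
have inx n : inrect (s n).1 (W n) (s n).2 (H n) (x1, x2) by split.
have [dp dq dpq] : [/\ differentiable p (x1, x2), differentiable q (x1, x2)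
    & 'D_(0, 1) p (x1, x2) = 'D_(1, 0) q (x1, x2)].
  by apply: pq; have := inx 0%N; rewrite /= W_0 H_0.
(* Then J = 4 e (w + h)^2 + 4 e, larger than the bound 2 e (w + h)^2 obtained below; the summand 1
   covers w + h = 0. *)
pose e := J / (4 * ((w + h) ^+ 2 + 1)).
have q0 : 0 < (w + h) ^+ 2 + 1 by rewrite ltr_wpDl// sqr_ge0.
have e0 : 0 < e by rewrite divr_gt0// mulr_gt0.
have [d d0 hd] := bdry_small dp dq dpq e0.
have [n wn] : exists n, W n + H n < d.
  exists (Num.truncn ((w + h) / d)).+1.
  set N := _.+1; rewrite /W /H -mulrDl ltr_pdivrMr ?exprn_gt0// mulrC -ltr_pdivrMr//.
  apply: lt_le_trans (truncnS_gt _) _.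
  by rewrite -natrX ler_nat ltnW// ltn_expl.
have [sub big] := gs n.
have := le_trans big (hd _ _ _ _ (inx n) wn (W0 n) (H0 n) _ _).
move=> /(_ (fun z zr => cp z (sub z zr)) (fun z zr => cq z (sub z zr))).
rewrite /W /H -mulrDl exprMn exprVn -exprM mulnC exprM (_ : 2 ^+ 2 = 4); last by ring.
rewrite mulrA ler_pM2r ?invr_gt0 ?exprn_gt0// => k.
have Je : J = 4 * (e * (w + h) ^+ 2) + 4 * e by rewrite /e; field; rewrite gt_eqF.
have : 0 <= e * (w + h) ^+ 2 by rewrite mulr_ge0 ?sqr_ge0// ltW.
lra.
Qed.

End Goursat.

(** * Derivatives of lambda-terms, projections and plane chain rules *)

Section DeriveLambda.
Variables (R : realType) (V : normedModType R).
Implicit Types (f g : V -> R) (x v : V).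

Lemma is_deriveMl f g x v a b : is_derive x v f a -> is_derive x v g b ->
  is_derive x v (fun y => f y * g y) (a * g x + f x * b).
Proof.
move=> df dg; apply: (is_derive_eq (is_deriveM df dg)).
by rewrite /GRing.scale /=; ring.
Qed.

Lemma is_deriveDl f g x v a b : is_derive x v f a -> is_derive x v g b ->
  is_derive x v (fun y => f y + g y) (a + b).
Proof. exact: is_deriveD. Qed.

Lemma is_deriveBl f g x v a b : is_derive x v f a -> is_derive x v g b ->
  is_derive x v (fun y => f y - g y) (a - b).
Proof. exact: is_deriveB. Qed.

Lemma is_derive_inv (r : R) : r != 0 -> is_derive r (1 : R) (fun x : R => x^-1) (- r ^- 2).
Proof.
move=> r0; split; first exact: (@derivableV _ _ id).
by rewrite (@deriveV _ _ id)// derive_id /GRing.scale /= mulr1.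
Qed.

End DeriveLambda.

Section Projections.
Variables (R : realType) (U V : normedModType R).

Lemma differentiable_proj1 (z : U * V) : differentiable (fst : U * V -> U) z.
Proof.
apply: (@linear_differentiable _ _ _ (fst : {linear (U * V)%type -> U})) => y.
exact: cvg_fst.
Qed.

Lemma differentiable_proj2 (z : U * V) : differentiable (snd : U * V -> V) z.
Proof.
apply: (@linear_differentiable _ _ _ (snd : {linear (U * V)%type -> V})) => y.
exact: cvg_snd.
Qed.

End Projections.

Section PlaneChain.
Variable R : realType.
Implicit Types (f u v : R * R -> R) (g : R -> R) (z : R * R).

Lemma is_derive_slice1 f (x y a : R) : is_derive x 1 (fun t => f (t, y)) a <->
  is_derive ((x, y) : R * R) (1, 0) f a.
Proof.
suff E : (fun h : R => h^-1 *: (f (h *: ((1, 0) : R * R) + (x, y)) - f (x, y))) =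
    (fun h : R => h^-1 *: (f (h *: (1 : R) + x, y) - f (x, y))).
  by split => -[]; rewrite /derivable /derive ?E => d <-; split; rewrite /derivable /derive ?E.
apply/funext => h; congr (_ *: (f _ - _)); apply/pair_equal_spec; split => //=.
by rewrite /GRing.scale /= mulr0 add0r.
Qed.

Lemma is_derive_slice2 f (x y a : R) : is_derive y 1 (fun t => f (x, t)) a <->
  is_derive ((x, y) : R * R) (0, 1) f a.
Proof.
suff E : (fun h : R => h^-1 *: (f (h *: ((0, 1) : R * R) + (x, y)) - f (x, y))) =
    (fun h : R => h^-1 *: (f (x, h *: (1 : R) + y) - f (x, y))).
  by split => -[]; rewrite /derivable /derive ?E => d <-; split; rewrite /derivable /derive ?E.
apply/funext => h; congr (_ *: (f _ - _)); apply/pair_equal_spec; split => //=.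
by rewrite /GRing.scale /= mulr0 add0r.
Qed.

Lemma is_derive_plane_chain u (g1 g2 : R -> R) (x a b : R) :
  differentiable u (g1 x, g2 x) -> is_derive x 1 g1 a -> is_derive x 1 g2 b ->
  is_derive x 1 (fun t => u (g1 t, g2 t))
    ('D_(1, 0) u (g1 x, g2 x) * a + 'D_(0, 1) u (g1 x, g2 x) * b).
Proof.
move=> du [d1 e1] [d2 e2].
have D1 : differentiable g1 x by apply/derivable1_diffP.
have D2 : differentiable g2 x by exact/derivable1_diffP.
have DG : differentiable (fun t => (g1 t, g2 t)) x by exact: differentiable_pair.
have D : differentiable (u \o (fun t => (g1 t, g2 t))) x.
  exact: differentiable_comp.
split; first exact/derivable1_diffP.
rewrite (deriveE _ D) diff_comp//= diff_pair//= -!deriveE//.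
by rewrite derive_plane//= -e1 -e2.
Qed.

Lemma differentiable_plane_comp u (g1 g2 : R * R -> R) z :
  differentiable g1 z -> differentiable g2 z -> differentiable u (g1 z, g2 z) ->
  differentiable (fun y => u (g1 y, g2 y)) z.
Proof.
move=> d1 d2 du; apply: (@differentiable_comp _ _ _ _ (fun y => (g1 y, g2 y)) u) => //.
exact: differentiable_pair.
Qed.

Lemma differentiable_comp_snd (g : R -> R) z : derivable g z.2 1 ->
  differentiable (fun y : R * R => g y.2) z.
Proof.
move=> /derivable1_diffP dg.
by apply: (@differentiable_comp _ _ _ _ snd g) => //; exact: differentiable_proj2.
Qed.

End PlaneChain.

(** * Cauchy's estimates and Taylor expansion of stem functions *)

Section CauchyDerivative.
Variable R : realType.
Implicit Types (D : set (R * R)) (u v : R * R -> R) (z : R * R) (r t : R).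

Definition cr_pair D u v := forall z, D z ->
  [/\ differentiable u z, differentiable v z,
      'D_(1, 0) u z = 'D_(0, 1) v z & 'D_(0, 1) u z = - 'D_(1, 0) v z].

Definition circle z r t : R * R := (z.1 + r * cos t, z.2 + r * sin t).

(** With F = u + i v this is the real part of the integral of F e^(-it) over the circle, which
    Cauchy's formula evaluates to 2 pi r F'(z). *)
Definition cauchy_avg u v z r : R := sint 0 (2 * pi)
  (fun t => u (circle z r t) * cos t + v (circle z r t) * sin t).

Lemma circle_norm z r t : 0 <= r -> `|circle z r t - z| <= r.
Proof.
move=> r0; rewrite plane_norm_leP /= ![_ + _ - _]addrAC !subrr !add0r !normrM ger0_norm//.
by rewrite !ler_piMr// ler_norml ?cos_geN1 ?cos_le1 ?sin_geN1 ?sin_le1.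
Qed.

Lemma differentiable_circle_comp u z (y : R * R) :
  differentiable u (circle z y.1 y.2) ->
  differentiable (fun y : R * R => u (circle z y.1 y.2)) y.
Proof.
move=> du; apply: differentiable_plane_comp => //.
- apply: differentiableD => //; apply: differentiableM; first exact: differentiable_proj1.
  by apply: differentiable_comp_snd; have [] := is_derive_cos y.2.
- apply: differentiableD => //; apply: differentiableM; first exact: differentiable_proj1.
  by apply: differentiable_comp_snd; have [] := is_derive_sin y.2.
Qed.

(** In polar coordinates the imaginary part of F(x) dx / (x - z)^2 is p dr + q dt, with the [p] and
    [q] of the proof. It is closed on the rectangle [r1, r2] x [0, 2 pi], to which Goursat's theorem
    applies. *)
Lemma cauchy_avg_scale D u v z r1 r2 : cr_pair D u v -> 0 < r1 -> r1 <= r2 ->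
  (forall y, `|y - z| <= r2 -> D y) ->
  cauchy_avg u v z r1 / r1 = cauchy_avg u v z r2 / r2.
Proof.
move=> uv r10 r12 zD.
pose U (y : R * R) := u (circle z y.1 y.2); pose V (y : R * R) := v (circle z y.1 y.2).
pose p (y : R * R) := (V y * cos y.2 - U y * sin y.2) * (y.1^-1 * y.1^-1).
pose q (y : R * R) := (U y * cos y.2 + V y * sin y.2) * y.1^-1.
have r20 : 0 < r2 by exact: lt_le_trans r12.
have pi0 : 0 <= 2 * pi :> R by rewrite mulr_ge0// pi_ge0.
have inD (y : R * R) : r1 <= y.1 <= r2 -> D (circle z y.1 y.2).
  move=> /andP[ry yr]; apply: zD; apply: le_trans (circle_norm _ _ _) _ => //.
  by apply: le_trans ry; exact: ltW.
have Q r : r1 <= r <= r2 ->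
    sint 0 (2 * pi) (fun t => q (r, t)) = cauchy_avg u v z r / r.
  move=> rr; rewrite /q /= [RHS]mulrC /cauchy_avg -sintZ.
    by apply: eq_sint => t _; rewrite mulrC.
  have du := uv _ (inD (r, _) rr).
  have cu t : {for t, continuous (fun t => u (circle z r t))}.
    have [du1 _ _ _] := uv _ (inD (r, t) rr).
    apply: (@continuous_slice2 _ (fun y => u (circle z y.1 y.2)) r t).
    by apply/differentiable_continuous/differentiable_circle_comp.
  have cv t : {for t, continuous (fun t => v (circle z r t))}.
    have [_ du1 _ _] := uv _ (inD (r, t) rr).
    apply: (@continuous_slice2 _ (fun y => v (circle z y.1 y.2)) r t).
    by apply/differentiable_continuous/differentiable_circle_comp.
  apply: ccontD; apply: ccontM => t _.
  - exact: cu.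
  - exact: continuous_cos.
  - exact: cv.
  - exact: continuous_sin.
have := @bdry_closed_form _ p q r1 (r2 - r1) 0 (2 * pi).
rewrite subr_ge0 => /(_ r12 pi0).
have rE : r1 + (r2 - r1) = r2 by rewrite addrC subrK.
move=> bd; apply/eqP; rewrite -!Q ?lexx ?r12//.
have H : forall z0, inrect r1 (r2 - r1) 0 (2 * pi) z0 ->
  [/\ differentiable p z0, differentiable q z0 & 'D_(0, 1) p z0 = 'D_(1, 0) q z0].
  move=> [r t] [] /=; rewrite rE => rr _.
  have [du dv e1 e2] := uv _ (inD (r, t) rr).
  have r0 : 0 < r by case/andP: rr => + _; exact: lt_le_trans.
  have dU : differentiable U (r, t) by exact: differentiable_circle_comp.
  have dV : differentiable V (r, t) by exact: differentiable_circle_comp.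
  have dc : differentiable (fun y : R * R => cos y.2) (r, t).
    by apply: differentiable_comp_snd; have [] := is_derive_cos t.
  have ds : differentiable (fun y : R * R => sin y.2) (r, t).
    by apply: differentiable_comp_snd; have [] := is_derive_sin t.
  have di : differentiable (fun y : R * R => y.1^-1) (r, t).
    by apply: differentiableV; [exact: differentiable_proj1|rewrite gt_eqF].
  split.
  - apply: differentiableM; last exact: differentiableM.
    by apply: differentiableB; exact: differentiableM.
  - apply: differentiableM => //.
    by apply: differentiableD; exact: differentiableM.
  set c := circle z r t in du dv e1 e2.
  set A := 'D_(0, 1) v c in e1; set B := 'D_(1, 0) v c in e2.
  have dline (g : R * R -> R) : differentiable g c ->
      is_derive r 1 (fun r => g (circle z r t)) ('D_(1, 0) g c * cos t + 'D_(0, 1) g c * sin t).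
    have H0 (a b : R) : is_derive r (1 : R) (fun r => a + r * b) b.
      apply: (is_derive_eq (is_deriveDl (is_derive_cst a r (1 : R))
        (is_deriveMl (is_derive_id r (1 : R)) (is_derive_cst b r (1 : R))))).
      by rewrite /=; ring.
    by move=> dg; exact: (@is_derive_plane_chain _ g (fun r => z.1 + r * cos t)
      (fun r => z.2 + r * sin t)).
  have dcirc (g : R * R -> R) : differentiable g c ->
      is_derive t 1 (fun t => g (circle z r t))
        ('D_(1, 0) g c * (r * - sin t) + 'D_(0, 1) g c * (r * cos t)).
    have H0 (a a' : R) f : is_derive t 1 f a' -> is_derive t (1 : R) (fun t => a + r * f t) (r * a').
      move=> df; apply: (is_derive_eq (is_deriveDl (is_derive_cst a t (1 : R))
        (is_deriveMl (is_derive_cst r t (1 : R)) df))).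
      by rewrite /=; ring.
    by move=> dg; apply: (@is_derive_plane_chain _ g (fun t => z.1 + r * cos t)
      (fun t => z.2 + r * sin t)) => //; apply: H0.
  have Dp : is_derive t (1 : R) (fun t => p (r, t)) _ :=
    is_deriveMl (is_deriveBl (is_deriveMl (dcirc _ dv) (is_derive_cos t))
      (is_deriveMl (dcirc _ du) (is_derive_sin t))) (is_derive_cst (r^-1 * r^-1) t 1).
  have rn0 : r != 0 by rewrite gt_eqF.
  have Dq : is_derive r (1 : R) (fun r => q (r, t)) _ :=
    is_deriveMl (is_deriveDl (is_deriveMl (dline _ du) (is_derive_cst (cos t) r 1))
      (is_deriveMl (dline _ dv) (is_derive_cst (sin t) r 1))) (is_derive_inv rn0).
  move/is_derive_slice2 : Dp => [_ ->]; move/is_derive_slice1 : Dq => [_ ->].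
  by rewrite /= ?e1 ?e2 -/A -/B; field.
have := bd H; rewrite bdryE ?subr_ge0//; last 2 first.
- by move=> y /H[+ _ _]; exact: differentiable_continuous.
- by move=> y /H[_ + _]; exact: differentiable_continuous.
rewrite rE add0r => /eqP; rewrite addr_eq0 opprB => /eqP.
(* By periodicity the two radial sides cancel, leaving the two circles. *)
have -> : (fun s => p (s, 2 * pi)) = (fun s => p (s, 0)).
  apply/funext => s; rewrite /p /U /V /circle /= .
  by rewrite -[2 * pi]/(2%:R * pi) mulr_natl cos2pi sin2pi cos0 sin0.
by rewrite subrr => /esym/eqP; rewrite subr_eq0.
Qed.
End CauchyDerivative.

(** * Mean values along segments of the plane *)

Section PlaneMVT.
Variable R : realType.
Implicit Types (u : R * R -> R) (x y z : R * R) (s L : R).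

Definition segpt x y s : R * R := (x.1 + s * (y.1 - x.1), x.2 + s * (y.2 - x.2)).

Lemma plane_MVT u x y : (forall s, 0 <= s <= 1 -> differentiable u (segpt x y s)) ->
  exists2 s, 0 <= s <= 1 & u y - u x =
    'D_(1, 0) u (segpt x y s) * (y.1 - x.1) + 'D_(0, 1) u (segpt x y s) * (y.2 - x.2).
Proof.
move=> du; pose g s := u (segpt x y s).
have dg s : 0 <= s <= 1 -> is_derive s 1 g
    ('D_(1, 0) u (segpt x y s) * (y.1 - x.1) + 'D_(0, 1) u (segpt x y s) * (y.2 - x.2)).
  move=> s01; have H (a b : R) : is_derive s (1 : R) (fun s => a + s * b) b.
    apply: (is_derive_eq (is_deriveDl (is_derive_cst a s (1 : R))
      (is_deriveMl (is_derive_id s (1 : R)) (is_derive_cst b s (1 : R))))).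
    by rewrite /=; ring.
  exact: (@is_derive_plane_chain _ u (fun s => x.1 + s * (y.1 - x.1))
     (fun s => x.2 + s * (y.2 - x.2)) s _ _ (du _ s01)).
have [||s] := @MVT_segment R g (fun s => 'D_(1, 0) u (segpt x y s) * (y.1 - x.1) +
  'D_(0, 1) u (segpt x y s) * (y.2 - x.2)) 0 1 ler01.
- by move=> s; rewrite in_itv/= => /andP[s0 s1]; apply: dg; rewrite !ltW.
- apply: continuous_in_subspaceT => s; rewrite inE /= in_itv /= => s01.
  apply/differentiable_continuous/derivable1_diffP.
  by have [] := dg _ s01.
rewrite in_itv /= => s01; rewrite subr0 mulr1 => e; exists s => //; rewrite -e /g.
have -> : segpt x y 1 = y.
  by case: (y) => y1 y2; rewrite /segpt /= !mul1r ![_ + (_ - _)]addrC !subrK.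
by have -> : segpt x y 0 = x by case: (x) => x1 x2; rewrite /segpt /= !mul0r !addr0.
Qed.

Lemma segpt_norm x y s : 0 <= s <= 1 -> `|segpt x y s - x| <= `|y - x|.
Proof.
move=> /andP[s0 s1]; have := lexx `|y - x|; rewrite {1}plane_norm_leP => /andP[h1 h2].
rewrite plane_norm_leP /= ![_ + _ - _]addrAC !subrr !add0r !normrM ger0_norm//.
by apply/andP; split; apply: le_trans (ler_piMl _ _) _.
Qed.

Lemma conv_lt (a b r s : R) : 0 <= s <= 1 -> a < r -> b < r -> a + s * (b - a) < r.
Proof.
move=> /andP[s0 s1] ar br; have [ab|ba] := leP a b.
  by apply: le_lt_trans br; rewrite -lerBrDl ler_piMl// subr_ge0.
apply: le_lt_trans ar; rewrite gerDl mulr_ge0_le0// subr_le0; exact: ltW.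
Qed.

Lemma segpt_ball x y z s (r : R) : 0 <= s <= 1 -> `|x - z| < r -> `|y - z| < r ->
  `|segpt x y s - z| < r.
Proof.
move=> s01; rewrite !plane_norm_ltP /= !ltr_norml.
move=> /andP[/andP[a1 a2] /andP[a3 a4]] /andP[/andP[b1 b2] /andP[b3 b4]].
have k1 := conv_lt s01 a2 b2; have k2 := conv_lt s01 a4 b4.
have := @conv_lt (- (x.1 - z.1)) (- (y.1 - z.1)) r s s01.
have := @conv_lt (- (x.2 - z.2)) (- (y.2 - z.2)) r s s01.
by rewrite !(ltrNl _ r) => /(_ a3 b3) k3 /(_ a1 b1) k4; lra.
Qed.

End PlaneMVT.

Section CauchyEstimate.
Variable R : realType.
Implicit Types (D : set (R * R)) (u v : R * R -> R) (x y z : R * R) (r t M : R).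

(** Multiplication by -i. It lets statements about the real part alone apply to the imaginary part
    as well. *)
Lemma cr_pair_rot D u v : cr_pair D u v -> cr_pair D v (fun x => - u x).
Proof.
move=> uv z /uv[du dv e1 e2]; split => //; first exact: differentiableN.
- have -> : (fun x => - u x) = - u by [].
  by rewrite deriveN ?e2 ?opprK//; exact: diff_derivable.
- have -> : (fun x => - u x) = - u by [].
  by rewrite deriveN ?opprK//; exact: diff_derivable.
Qed.

Lemma pi2_gt0 : 0 < 2 * pi :> R. Proof. by rewrite mulr_gt0// pi_gt0. Qed.

Lemma sint_cos : sint 0 (2 * pi) (@cos R) = 0.
Proof.
rewrite (@sint_FTC _ _ _ sin).
- by rewrite -[2 * pi]/(2%:R * pi) mulr_natl sin2pi sin0 subrr.
- exact: pi2_gt0.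
- by move=> x _; exact: continuous_cos.
Qed.

Lemma sint_sin : sint 0 (2 * pi) (@sin R) = 0.
Proof.
have dF t : is_derive t (1 : R) (fun t => - cos t) (sin t).
  by apply: is_derive_eq; rewrite opprK.
rewrite (sint_FTC pi2_gt0 _ dF); last by move=> x _; exact: continuous_sin.
by rewrite -[2 * pi]/(2%:R * pi) mulr_natl cos2pi cos0 subrr.
Qed.

Lemma cos_norm_le t : `|cos t : R| <= 1.
Proof. by rewrite ler_norml cos_geN1 cos_le1. Qed.

Lemma sin_norm_le t : `|sin t : R| <= 1.
Proof. by rewrite ler_norml sin_geN1 sin_le1. Qed.

Lemma circleB1 z r t : (circle z r t - z).1 = r * cos t.
Proof. by rewrite /= addrAC subrr add0r. Qed.

Lemma circleB2 z r t : (circle z r t - z).2 = r * sin t.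
Proof. by rewrite /= addrAC subrr add0r. Qed.

Lemma ccont_circle u z r a b : 0 <= r ->
  (forall y, `|y - z| <= r -> differentiable u y) ->
  ccont a b (fun t => u (circle z r t)).
Proof.
move=> r0 du t _; apply: (@continuous_slice2 _ (fun y => u (circle z y.1 y.2)) r t).
apply/differentiable_continuous/differentiable_circle_comp.
exact/du/circle_norm.
Qed.

Lemma sint_trig_bound (f g : R -> R) M : ccont 0 (2 * pi) f -> ccont 0 (2 * pi) g ->
  (forall t, `|f t| <= M) -> (forall t, `|g t| <= M) ->
  `|sint 0 (2 * pi) (fun t => f t * cos t + g t * sin t)| <= 2 * M * (2 * pi).
Proof.
move=> cf cg fM gM.
have := @sint_bound R 0 (2 * pi) (2 * M) (fun t => f t * cos t + g t * sin t).
rewrite subr0; apply; first by rewrite ltW// pi2_gt0.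
  by apply: ccontD; apply: ccontM => //= x _; [exact: continuous_cos|exact: continuous_sin].
move=> t _; apply: le_trans (ler_normD _ _) _; rewrite !normrM.
rewrite -[2]/(1 + 1) mulrDl mul1r; apply: lerD.
  by apply: le_trans (fM t); rewrite ler_piMr// cos_norm_le.
by apply: le_trans (gM t); rewrite ler_piMr// sin_norm_le.
Qed.

(** Since [cauchy_avg] divided by the radius does not depend on the radius, the circle may shrink to
    z, where differentiability at the single point z determines the value. *)
Lemma cauchy_derivative D u v z r : cr_pair D u v -> 0 < r ->
  (forall y, `|y - z| <= r -> D y) ->
  cauchy_avg u v z r = 2 * pi * r * 'D_(1, 0) u z.
Proof.
move=> uv r0 zD.
suff : cauchy_avg u v z r / r - 2 * pi * 'D_(1, 0) u z = 0.
  move/eqP; rewrite subr_eq0 => /eqP h.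
  by rewrite -[LHS](@divfK _ r) ?gt_eqF// h; ring.
apply/eqP; rewrite -normr_le0; apply/ler_addgt0Pl => e e0; rewrite addr0.
have [du dv e1 e2] : [/\ differentiable u z, differentiable v z,
  'D_(1, 0) u z = 'D_(0, 1) v z & 'D_(0, 1) u z = - 'D_(1, 0) v z].
  by apply/uv/zD; rewrite subrr normr0 ltW.
(* [sint_trig_bound] turns a remainder e' p on the circle of radius p into 2 e' p (2 pi), which is e
   after division by p. *)
pose e' := e / (2 * (2 * pi)).
have pi0 := pi2_gt0.
have e'0 : 0 < e' by rewrite divr_gt0// mulr_gt0.
have [d1 d10 h1] := differentiable_approx du e'0.
have [d2 d20 h2] := differentiable_approx dv e'0.
pose p := Num.min r (Num.min (d1 / 2) (d2 / 2)).
have p0 : 0 < p by rewrite !lt_min r0 !divr_gt0.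
have [pr p1 p2] : [/\ p <= r, p < d1 & p < d2].
  have : p <= Num.min r (Num.min (d1 / 2) (d2 / 2)) by [].
  by rewrite !le_min => /andP[? /andP[? ?]]; split => //; lra.
rewrite -(cauchy_avg_scale uv p0 pr zD).
have near t : `|circle z p t - z| <= p by exact/circle_norm/ltW.
set A := 'D_(1, 0) u z; set B := 'D_(0, 1) u z.
(* Remainders of the first-order expansions; by the Cauchy-Riemann equations v has gradient (- B,
   A). Against cos and sin the constants integrate to 0 and the linear parts add up to p A (cos^2 +
   sin^2). *)
pose f t := u (circle z p t) - u z - p * (A * cos t + B * sin t).
pose g t := v (circle z p t) - v z - p * (- B * cos t + A * sin t).
have fb t : `|f t| <= e' * p.
  have := h1 (circle z p t) (le_lt_trans (near t) p1).
  rewrite (derive_plane _ du) circleB1 circleB2 => h.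
  apply: le_trans (_ : e' * `|circle z p t - z| <= _); last by rewrite ler_wpM2l// ltW.
  apply: le_trans h; rewrite le_eqVlt; apply/orP; left; apply/eqP; congr `|_|.
  by rewrite /f /A /B; ring.
have gb t : `|g t| <= e' * p.
  have := h2 (circle z p t) (le_lt_trans (near t) p2).
  rewrite (derive_plane _ dv) circleB1 circleB2 => h.
  apply: le_trans (_ : e' * `|circle z p t - z| <= _); last by rewrite ler_wpM2l// ltW.
  apply: le_trans h; rewrite le_eqVlt; apply/orP; left; apply/eqP; congr `|_|.
  by rewrite /g /A /B e1 e2; ring.
have cc : ccont 0 (2 * pi) (@cos R) by move=> x _; exact: continuous_cos.
have cs : ccont 0 (2 * pi) (@sin R) by move=> x _; exact: continuous_sin.
have k (a : R) : ccont 0 (2 * pi) (fun=> a) by exact: ccont_cst.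
have inD y : `|y - z| <= p -> D y by move=> yp; apply/zD/(le_trans yp).
have cu : ccont 0 (2 * pi) (fun t => u (circle z p t)).
  by apply: ccont_circle; [exact: ltW|move=> y /inD/uv[]].
have cv : ccont 0 (2 * pi) (fun t => v (circle z p t)).
  by apply: ccont_circle; [exact: ltW|move=> y /inD/uv[]].
have cf : ccont 0 (2 * pi) f.
  by do !(apply: ccontB || apply: ccontM || apply: ccontD).
have cg : ccont 0 (2 * pi) g.
  by do !(apply: ccontB || apply: ccontM || apply: ccontD).
have E : cauchy_avg u v z p = u z * sint 0 (2 * pi) (@cos R) +
   v z * sint 0 (2 * pi) (@sin R) + p * A * (2 * pi) +
   sint 0 (2 * pi) (fun t => f t * cos t + g t * sin t).
  rewrite -!sintZ// -[in p * A * (2 * pi)](subr0 (2 * pi)) -sint_cst ?ltW//.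
  have cfg : ccont 0 (2 * pi) (fun t => f t * cos t + g t * sin t).
    by apply: ccontD; apply: ccontM.
  have c1 : ccont 0 (2 * pi) (fun t => u z * cos t) by apply: ccontM.
  have c2 : ccont 0 (2 * pi) (fun t => v z * sin t) by apply: ccontM.
  rewrite -(sintD c1 c2) -(sintD (ccontD c1 c2) (k _)) -(sintD _ cfg); last first.
    by apply: ccontD => //; exact: ccontD.
  apply: eq_sint => t _; rewrite /f /g.
  rewrite -[p * A in RHS]mulr1 -(cos2Dsin2 t); ring.
rewrite E sint_cos sint_sin !mulr0 !add0r mulrDl.
have -> : p * A * (2 * pi) / p = 2 * pi * A by field; rewrite gt_eqF.
rewrite addrAC subrr add0r normrM normfV (gtr0_norm p0) ler_pdivrMr//.
apply: le_trans (sint_trig_bound cf cg fb gb) _.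
rewrite /e' le_eqVlt; apply/orP; left; apply/eqP.
by move: (2 * pi) pi0 => P P0; field; rewrite gt_eqF.
Qed.

(** Only the first partial derivative of u is estimated; rotation by -i gives that of v, and the
    Cauchy-Riemann equations give the other two. *)
Lemma cauchy_estimate D u v z r M : cr_pair D u v -> 0 < r ->
  (forall y, `|y - z| <= r -> [/\ D y, `|u y| <= M & `|v y| <= M]) ->
  [/\ `|'D_(1, 0) u z| <= 2 * M / r, `|'D_(0, 1) u z| <= 2 * M / r,
      `|'D_(1, 0) v z| <= 2 * M / r & `|'D_(0, 1) v z| <= 2 * M / r].
Proof.
have main u' v' : cr_pair D u' v' -> 0 < r ->
  (forall y, `|y - z| <= r -> [/\ D y, `|u' y| <= M & `|v' y| <= M]) ->
  `|'D_(1, 0) u' z| <= 2 * M / r.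
  move=> uv r0 hM; have k := @cauchy_derivative D u' v' z r uv r0.
  have {}k := k (fun y yr => let: And3 h _ _ := hM y yr in h).
  have near t : `|circle z r t - z| <= r by exact/circle_norm/ltW.
  have := @sint_trig_bound (fun t => u' (circle z r t)) (fun t => v' (circle z r t)) M.
  rewrite -/(cauchy_avg u' v' z r) k => h.
  have : `|2 * pi * r * 'D_(1, 0) u' z| <= 2 * M * (2 * pi).
    apply: h.
    - by apply: ccont_circle; [exact: ltW|move=> y /hM[/uv[]]].
    - by apply: ccont_circle; [exact: ltW|move=> y /hM[/uv[]]].
    - by move=> t; have [] := hM _ (near t).
    - by move=> t; have [] := hM _ (near t).
  rewrite !normrM (gtr0_norm r0) (gtr0_norm (pi_gt0 _)) gtr0_norm// => h'.
  rewrite ler_pdivlMr// -(ler_pM2l pi2_gt0); apply: le_trans _ (le_trans h' _).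
    by rewrite le_eqVlt; apply/orP; left; apply/eqP; ring.
  by rewrite le_eqVlt; apply/orP; left; apply/eqP; ring.
move=> uv r0 hM; have Dz : D z by have [] := hM z _; rewrite // subrr normr0 ltW.
have h1 := main _ _ uv r0 hM.
have h2 : `|'D_(1, 0) v z| <= 2 * M / r.
  apply: main (cr_pair_rot uv) r0 _ => y /hM[? ? ?]; split => //.
  by rewrite normrN.
have [_ _ e1 e2] := uv _ Dz.
by split; rewrite // ?e2 ?normrN// -e1.
Qed.
End CauchyEstimate.

(** * From one complex derivative to the next *)

Section Bootstrap.
Variable R : realType.
Implicit Types (D : set (R * R)) (u v : R * R -> R) (x y z : R * R) (r t M L : R).

Lemma lipschitz_bound u z r L : 0 <= L ->
  (forall y, `|y - z| < r -> [/\ differentiable u y, `|'D_(1, 0) u y| <= L & `|'D_(0, 1) u y| <= L]) ->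
  forall x y, `|x - z| < r -> `|y - z| < r -> `|u y - u x| <= 2 * L * `|y - x|.
Proof.
move=> L0 hu x y xz yz.
have [|s s01 ->] := @plane_MVT R u x y.
  by move=> s s01; have [] := hu _ (segpt_ball s01 xz yz).
have [_ h1 h2] := hu _ (segpt_ball s01 xz yz).
have := lexx `|y - x|; rewrite {1}plane_norm_leP => /andP[k1 k2].
apply: le_trans (ler_normD _ _) _; rewrite !normrM -[2]/(1 + 1) -mulrA mulrDl mul1r.
by apply: lerD; apply: ler_pM.
Qed.

Lemma quadratic_bound u z r L : 0 <= L ->
  (forall y, `|y - z| < r -> differentiable u y) ->
  (forall x y, `|x - z| < r -> `|y - z| < r ->
     `|'D_(1, 0) u y - 'D_(1, 0) u x| <= L * `|y - x| /\
     `|'D_(0, 1) u y - 'D_(0, 1) u x| <= L * `|y - x|) ->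
  forall x y, `|x - z| < r -> `|y - z| < r ->
  `|u y - u x - ('D_(1, 0) u x * (y.1 - x.1) + 'D_(0, 1) u x * (y.2 - x.2))|
     <= 2 * L * `|y - x| ^+ 2.
Proof.
move=> L0 du hu x y xz yz.
have [|s s01 ->] := @plane_MVT R u x y.
  by move=> s s01; exact/du/segpt_ball.
have wz := segpt_ball s01 xz yz; set w := segpt x y s.
have [h1 h2] := hu _ _ xz wz; rewrite -/w in h1 h2.
have wx : `|w - x| <= `|y - x| by exact: segpt_norm.
have := lexx `|y - x|; rewrite {1}plane_norm_leP => /andP[k1 k2].
rewrite opprD addrACA -!mulrBl.
apply: le_trans (ler_normD _ _) _; rewrite !normrM -[2]/(1 + 1) -mulrA mulrDl mul1r.
rewrite expr2 mulrA; apply: lerD; apply: ler_pM => //.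
- by apply: le_trans h1 _; rewrite ler_wpM2l.
- by apply: le_trans h2 _; rewrite ler_wpM2l.
Qed.

Lemma lipschitz_continuous u z r L :
  (forall x y, `|x - z| < r -> `|y - z| < r -> `|u y - u x| <= L * `|y - x|) ->
  forall x, `|x - z| < r -> {for x, continuous u}.
Proof.
move=> hu x xz; apply/cvgrPdist_le => e e0.
have L1 : 0 < `|L| + 1 by rewrite ltr_wpDl.
apply/(@nbhs_normP _ (R * R)%type x); exists (Num.min (r - `|x - z|) (e / (`|L| + 1))) => /=.
  by rewrite lt_min subr_gt0 xz divr_gt0.
move=> y /=; rewrite lt_min => /andP[y1 y2].
have yz : `|y - z| < r.
  rewrite -(subrK x y) -addrA; apply: le_lt_trans (ler_normD _ _) _.
  by rewrite distrC -ltrBrDr.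
rewrite distrC; apply: le_trans (hu _ _ xz yz) _.
rewrite distrC; apply: (@le_trans _ _ ((`|L| + 1) * `|x - y|)).
  by rewrite ler_wpM2r// (le_trans (ler_norm _))// lerDl.
by rewrite mulrC -ler_pdivlMr// ltW.
Qed.

Lemma ccont_circle_continuous u z r a b : 0 <= r ->
  (forall y, `|y - z| <= r -> {for y, continuous u}) ->
  ccont a b (fun t => u (circle z r t)).
Proof.
move=> r0 du t _; apply: (@continuous_comp _ _ _ (fun t => circle z r t) u); last first.
  exact/du/circle_norm.
apply/differentiable_continuous/differentiable_pair; apply: differentiableD => //;
  apply/differentiableM => //; apply/derivable1_diffP.
- by have [] := is_derive_cos t.
- by have [] := is_derive_sin t.
Qed.

Lemma cr_local_bound D u v z : open D -> cr_pair D u v -> D z ->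
  exists2 r, 0 < r & exists2 M, 0 < M &
    forall y, `|y - z| < r -> [/\ D y, `|u y| <= M & `|v y| <= M].
Proof.
move=> oD uv Dz; have [du dv _ _] := uv _ Dz.
have /nbhs_normP[r1 /= r10 h1] : nbhs z D by exact: open_nbhs_nbhs.
have /cvgrPdist_lt/(_ 1 ltr01)/nbhs_normP[r2 /= r20 h2] := differentiable_continuous du.
have /cvgrPdist_lt/(_ 1 ltr01)/nbhs_normP[r3 /= r30 h3] := differentiable_continuous dv.
exists (Num.min r1 (Num.min r2 r3)); first by rewrite !lt_min r10 r20.
exists (`|u z| + `|v z| + 1); first by rewrite ltr_wpDl// addr_ge0.
move=> y; rewrite !lt_min distrC => /andP[y1 /andP[y2 y3]]; split; first exact: h1.
- have := h2 _ y2; rewrite /= distrC => k.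
  rewrite -(subrK (u z) (u y)); apply: le_trans (ler_normD _ _) _.
  by have := normr_ge0 (v z); lra.
- have := h3 _ y3; rewrite /= distrC => k.
  rewrite -(subrK (v z) (v y)); apply: le_trans (ler_normD _ _) _.
  by have := normr_ge0 (u z); lra.
Qed.

(** Cauchy's estimate on circles of radius r / 2, which stay in the larger ball, bounds the gradient
    by 4 M / r; the mean value theorem in the max norm doubles this. *)
Lemma cr_lipschitz D u v z r M : cr_pair D u v -> 0 < r -> 0 < M ->
  (forall y, `|y - z| < 2 * r -> [/\ D y, `|u y| <= M & `|v y| <= M]) ->
  forall x y, `|x - z| < r -> `|y - z| < r ->
    `|u y - u x| <= (8 * M / r) * `|y - x| /\ `|v y - v x| <= (8 * M / r) * `|y - x|.
Proof.
move=> uv r0 M0 hM.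
have L0 : 0 <= 4 * M / r by rewrite divr_ge0 ?mulr_ge0// ltW.
have est y : `|y - z| < r -> [/\ `|'D_(1, 0) u y| <= 4 * M / r, `|'D_(0, 1) u y| <= 4 * M / r,
      `|'D_(1, 0) v y| <= 4 * M / r & `|'D_(0, 1) v y| <= 4 * M / r].
  move=> yz; have r20 : 0 < r / 2 by rewrite divr_gt0.
  have -> : 4 * M / r = 2 * M / (r / 2) by field; rewrite gt_eqF.
  apply: (cauchy_estimate uv r20) => w wy; apply: hM.
  rewrite -(subrK y w) -addrA; apply: le_lt_trans (ler_normD _ _) _; lra.
have r2 : r <= 2 * r by lra.
have inD y : `|y - z| < r -> D y by move=> yz; case: (hM y (lt_le_trans yz r2)).
have -> : 8 * M / r = 2 * (4 * M / r) by field; rewrite gt_eqF.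
move=> x y xz yz; split; apply: (@lipschitz_bound _ z r) => // w wz.
- by have [] := est w wz; have [] := uv _ (inD _ wz).
- by have [] := est w wz; have [] := uv _ (inD _ wz).
Qed.

(** Cauchy's formula at x and at y over circles of the same radius: points with the same angle
    differ by y - x, so the Lipschitz bound can be used under the integral. *)
Lemma cr_deriv_lipschitz D u v z r L : cr_pair D u v -> 0 < r -> 0 < L ->
  (forall y, `|y - z| < 2 * r -> D y) ->
  (forall x y, `|x - z| < 2 * r -> `|y - z| < 2 * r ->
    `|u y - u x| <= L * `|y - x| /\ `|v y - v x| <= L * `|y - x|) ->
  forall x y, `|x - z| < r -> `|y - z| < r ->
    `|'D_(1, 0) u y - 'D_(1, 0) u x| <= (4 * L / r) * `|y - x|.
Proof.
move=> uv r0 L0 hD hL x y xz yz.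
have r20 : 0 < r / 2 by rewrite divr_gt0.
have near (a w : R * R) : `|a - z| < r -> `|w - a| <= r / 2 -> `|w - z| < 2 * r.
  move=> az wa; rewrite -(subrK a w) -addrA; apply: le_lt_trans (ler_normD _ _) _; lra.
have kx := cauchy_derivative uv r20 (fun w wx => hD w (near x w xz wx)).
have ky := cauchy_derivative uv r20 (fun w wx => hD w (near y w yz wx)).
have cu w : `|w - z| < r -> ccont 0 (2 * pi) (fun t => u (circle w (r / 2) t)).
  move=> wz; apply: ccont_circle; first exact: ltW.
  by move=> q qw; have [] := uv _ (hD _ (near w q wz qw)).
have cv w : `|w - z| < r -> ccont 0 (2 * pi) (fun t => v (circle w (r / 2) t)).
  move=> wz; apply: ccont_circle; first exact: ltW.
  by move=> q qw; have [] := uv _ (hD _ (near w q wz qw)).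
have cc : ccont 0 (2 * pi) (@cos R) by move=> ? _; exact: continuous_cos.
have cs : ccont 0 (2 * pi) (@sin R) by move=> ? _; exact: continuous_sin.
have E : cauchy_avg u v y (r / 2) - cauchy_avg u v x (r / 2) =
  sint 0 (2 * pi) (fun t => (u (circle y (r / 2) t) - u (circle x (r / 2) t)) * cos t +
     (v (circle y (r / 2) t) - v (circle x (r / 2) t)) * sin t).
  rewrite /cauchy_avg -sintB; first by apply: eq_sint => t _; ring.
  - by apply: ccontD; apply: ccontM => //; [exact: cu|exact: cv].
  - by apply: ccontD; apply: ccontM => //; [exact: cu|exact: cv].
have tr t : circle y (r / 2) t - circle x (r / 2) t = y - x.
  by apply/pair_equal_spec; split => /=; ring.
have cn w t : `|w - z| < r -> `|circle w (r / 2) t - z| < 2 * r.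
  by move=> wz; apply: near wz _; exact/circle_norm/ltW.
have := @sint_trig_bound R (fun t => u (circle y (r / 2) t) - u (circle x (r / 2) t))
  (fun t => v (circle y (r / 2) t) - v (circle x (r / 2) t)) (L * `|y - x|)
  (ccontB (cu _ yz) (cu _ xz)) (ccontB (cv _ yz) (cv _ xz)).
have pi0 := pi2_gt0 R.
rewrite -E kx ky -mulrBr normrM (gtr0_norm (mulr_gt0 pi0 r20)) => h.
have h1 t : `|u (circle y (r / 2) t) - u (circle x (r / 2) t)| <= L * `|y - x|.
  by rewrite -(tr t); have [] := hL _ _ (cn x t xz) (cn y t yz).
have h2 t : `|v (circle y (r / 2) t) - v (circle x (r / 2) t)| <= L * `|y - x|.
  by rewrite -(tr t); have [] := hL _ _ (cn x t xz) (cn y t yz).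
rewrite -(ler_pM2l (mulr_gt0 pi0 r20)); apply: le_trans (h h1 h2) _.
by rewrite le_eqVlt; apply/orP; left; apply/eqP;
  move: (2 * pi) pi0 => P P0; field; rewrite gt_eqF.
Qed.

(** Differentiation of Cauchy's formula under the integral. The derivatives are Lipschitz by now, so
    u and v have quadratic remainders uniformly on the circle, and so has the formula. All small
    radii are allowed, so that the formulas for (u, v) and for its rotation can be compared on one
    circle. *)
Lemma cr_deriv_approx D u v z : open D -> cr_pair D u v -> D z ->
  exists r0, 0 < r0 /\ forall r, 0 < r -> r <= r0 ->
  [/\ differentiable ('D_(1, 0) u) z,
    2 * pi * r * 'D_(1, 0) ('D_(1, 0) u) z = sint 0 (2 * pi)
       (fun t => 'D_(1, 0) u (circle z r t) * cos t + 'D_(1, 0) v (circle z r t) * sin t) &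
    2 * pi * r * 'D_(0, 1) ('D_(1, 0) u) z = sint 0 (2 * pi)
       (fun t => - 'D_(1, 0) v (circle z r t) * cos t + 'D_(1, 0) u (circle z r t) * sin t)].
Proof.
move=> oD uv Dz; have [s s0 [M M0 hM]] := cr_local_bound oD uv Dz.
have s20 : 0 < s / 2 by rewrite divr_gt0.
have s40 : 0 < s / 2 / 2 by rewrite divr_gt0.
have ss : 2 * (s / 2) = s by field.
have ss2 : 2 * (s / 2 / 2) = s / 2 by field.
have hD y : `|y - z| < s -> D y by move=> ys; case: (hM y ys).
have lip := @cr_lipschitz D u v z (s / 2) M uv s20 M0.
rewrite ss in lip; have {}lip := lip hM.
set L := 8 * M / (s / 2) in lip.
have L0 : 0 < L by rewrite divr_gt0 ?mulr_gt0.
have s2s : s / 2 < s by lra.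
have hD2 y : `|y - z| < s / 2 -> D y by move=> ys; exact/hD/(lt_trans ys).
have lipu := @cr_deriv_lipschitz D u v z (s / 2 / 2) L uv s40 L0.
have lipv := @cr_deriv_lipschitz D v (fun x => - u x) z (s / 2 / 2) L (cr_pair_rot uv) s40 L0.
rewrite !ss2 in lipu lipv; have {}lipu := lipu hD2 lip.
have {}lipv := lipv hD2.
have {lipv}lipv := lipv _.
set L' := 4 * L / (s / 2 / 2) in lipu lipv.
have L'0 : 0 < L' by apply: divr_gt0 => //; apply: mulr_gt0.
have lipv' : forall x y : R * R, `|x - z| < s / 2 / 2 -> `|y - z| < s / 2 / 2 ->
    `|'D_(1, 0) v y - 'D_(1, 0) v x| <= L' * `|y - x|.
  apply: lipv => x y xz yz; have [h1 h2] := lip x y xz yz; split => //.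
  by rewrite -opprD normrN.
set q := s / 2 / 2 in lipu lipv lipv' s40 ss2 *.
have qs : q < s by rewrite /q; lra.
have hDq y : `|y - z| < q -> D y by move=> yq; exact/hD/(lt_trans yq).
have quadu := @quadratic_bound u z q L' (ltW L'0) (fun y yq => let: And4 h _ _ _ := uv y (hDq y yq) in h).
have quadv := @quadratic_bound v z q L' (ltW L'0) (fun y yq => let: And4 _ h _ _ := uv y (hDq y yq) in h).
(* The Cauchy-Riemann equations leave only derivatives in the real direction, whose Lipschitz bounds
   are known. *)
have {}quadu x y : `|x - z| < q -> `|y - z| < q ->
  `|u y - u x - ('D_(1, 0) u x * (y.1 - x.1) - 'D_(1, 0) v x * (y.2 - x.2))|
     <= 2 * L' * `|y - x| ^+ 2.
  move=> xq yq; have [_ _ _ e] := uv _ (hDq _ xq); rewrite -mulNr -e.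
  apply: quadu => // {xq yq e}x {}y xq yq; split; first exact: lipu.
  have [_ _ _ ->] := uv _ (hDq _ xq); have [_ _ _ ->] := uv _ (hDq _ yq).
  by rewrite -opprD normrN; exact: lipv'.
have {}quadv x y : `|x - z| < q -> `|y - z| < q ->
  `|v y - v x - ('D_(1, 0) v x * (y.1 - x.1) + 'D_(1, 0) u x * (y.2 - x.2))|
     <= 2 * L' * `|y - x| ^+ 2.
  move=> xq yq; have [_ _ e _] := uv _ (hDq _ xq); rewrite e.
  apply: quadv => // {xq yq e}x {}y xq yq; split; first exact: lipv'.
  have [_ _ <- _] := uv _ (hDq _ xq); have [_ _ <- _] := uv _ (hDq _ yq).
  exact: lipu.
have contu := lipschitz_continuous lipu.
have contv := lipschitz_continuous lipv'.
exists (q / 2); split; first by rewrite divr_gt0.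
move=> r r0 rq.
have rq2 : r < q by lra.
have pi0 := pi2_gt0 R; have pr0 := mulr_gt0 pi0 r0.
pose U t := 'D_(1, 0) u (circle z r t); pose V t := 'D_(1, 0) v (circle z r t).
have cc : ccont 0 (2 * pi) (@cos R) by move=> ? _; exact: continuous_cos.
have cs : ccont 0 (2 * pi) (@sin R) by move=> ? _; exact: continuous_sin.
have cU : ccont 0 (2 * pi) U.
  exact: (@ccont_circle_continuous ('D_(1, 0) u) z r _ _ (ltW r0) (fun y yr => contu y (le_lt_trans yr rq2))).
have cV : ccont 0 (2 * pi) V.
  exact: (@ccont_circle_continuous ('D_(1, 0) v) z r _ _ (ltW r0) (fun y yr => contv y (le_lt_trans yr rq2))).
pose A := sint 0 (2 * pi) (fun t => U t * cos t + V t * sin t).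
pose B := sint 0 (2 * pi) (fun t => - V t * cos t + U t * sin t).
(* The constant: [sint_trig_bound] doubles the quadratic remainder 2 L' |y - z|^2 and multiplies it
   by 2 pi, and Cauchy's formula divides by 2 pi r. *)
have [] := @plane_differentiable_sqr R ('D_(1, 0) u) z (A / (2 * pi * r)) (B / (2 * pi * r))
   (4 * L' / r) (q / 2).
- by rewrite divr_gt0.
- move=> y yz.
  have cir w t : `|w - z| < q / 2 -> `|circle w r t - z| < q.
    move=> wz; rewrite -(subrK w (circle w r t)) -addrA; apply: le_lt_trans (ler_normD _ _) _.
    by have := circle_norm w t (ltW r0); lra.
  have zz : `|z - z| < q / 2 by rewrite subrr normr0 divr_gt0.
  have inD w y' : `|w - z| < q / 2 -> `|y' - w| <= r -> D y'.
    move=> wz yw; apply: hDq; rewrite -(subrK w y') -addrA; apply: le_lt_trans (ler_normD _ _) _.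
    lra.
  have cD w g : `|w - z| < q / 2 -> (forall y, D y -> differentiable g y) ->
     ccont 0 (2 * pi) (fun t => g (circle w r t)).
    move=> wz dg; apply: ccont_circle; [exact: ltW|move=> y' yr].
    by apply: dg; exact: (inD w).
  have du y' : D y' -> differentiable u y' by case/uv.
  have dv y' : D y' -> differentiable v y' by case/uv.
  have k1 := cauchy_derivative uv r0 (fun y' yr => inD z y' zz yr).
  have k2 := cauchy_derivative uv r0 (fun y' yr => inD y y' yz yr).
  pose h1 := y.1 - z.1; pose h2 := y.2 - z.2.
  pose f t := u (circle y r t) - u (circle z r t) - (U t * h1 - V t * h2).
  pose g t := v (circle y r t) - v (circle z r t) - (V t * h1 + U t * h2).
  have kst (a : R) : ccont 0 (2 * pi) (fun=> a) by exact: ccont_cst.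
  have cf : ccont 0 (2 * pi) f.
    by apply: ccontB; apply: ccontB; (apply: cD || apply: ccontM).
  have cg : ccont 0 (2 * pi) g.
    apply: ccontB; first by apply: ccontB; exact: cD.
    by apply: ccontD; apply: ccontM.
  have tr t : circle y r t - circle z r t = y - z.
    by apply/pair_equal_spec; split => /=; ring.
  have tr1 t : (circle y r t).1 - (circle z r t).1 = h1 by rewrite /= /h1; ring.
  have tr2 t : (circle y r t).2 - (circle z r t).2 = h2 by rewrite /= /h2; ring.
  have fb t : `|f t| <= 2 * L' * `|y - z| ^+ 2.
    have := quadu _ _ (cir z t zz) (cir y t yz).
    by rewrite tr tr1 tr2.
  have gb t : `|g t| <= 2 * L' * `|y - z| ^+ 2.
    have := quadv _ _ (cir z t zz) (cir y t yz).
    by rewrite tr tr1 tr2.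
  have := sint_trig_bound cf cg fb gb.
  have -> : sint 0 (2 * pi) (fun t => f t * cos t + g t * sin t) =
     2 * pi * r * ('D_(1, 0) u y - 'D_(1, 0) u z - (A / (2 * pi * r) * h1 + B / (2 * pi * r) * h2)).
    have alg (P a b C C' h h' : R) : 0 < P ->
        P * (a - b - (C / P * h + C' / P * h')) = P * a - P * b - (h * C + h' * C').
      by move=> P0; field; rewrite gt_eqF.
    rewrite (alg _ _ _ _ _ _ _ pr0) -k1 -k2.
    have b1 : ccont 0 (2 * pi) (fun t => U t * cos t + V t * sin t).
      by apply: ccontD; apply: ccontM.
    have b2 : ccont 0 (2 * pi) (fun t => - V t * cos t + U t * sin t).
      apply: ccontD; apply: ccontM => //.
      by move=> t tt; apply: cvgN; exact: cV.
    rewrite /A /B -(sintZ h1 b1) -(sintZ h2 b2).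
    have c1 := ccontM (kst h1) b1; have c2 := ccontM (kst h2) b2.
    rewrite -(sintD c1 c2) /cauchy_avg -sintB.
    - rewrite -sintB; first by apply: eq_sint => t _; rewrite /f /g; ring.
      + by apply: ccontB; apply: ccontD; apply: ccontM => //; exact: cD.
      + exact: ccontD.
    - by apply: ccontD; apply: ccontM => //; exact: cD.
    - by apply: ccontD; apply: ccontM => //; exact: cD.
  rewrite normrM (gtr0_norm pr0) -/h1 -/h2 => k.
  rewrite -(ler_pM2l pr0); apply: le_trans k _.
  by rewrite le_eqVlt; apply/orP; left; apply/eqP;
    move: (2 * pi) pi0 => P P0; field; rewrite gt_eqF.
by move=> d e1 e2; split; rewrite ?e1 ?e2 // mulrC divfK// lt0r_neq0.
Qed.
End Bootstrap.

Section IteratedDerivatives.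
Variable R : realType.
Implicit Types (D : set (R * R)) (u v : R * R -> R) (x y z : R * R) (r t M L : R).

(** The integral formulas for the second derivatives of u and, by rotation, of v have equal or
    opposite integrands; these are the Cauchy-Riemann equations of the derivative. *)
Lemma cr_pair_deriv D u v : open D -> cr_pair D u v ->
  cr_pair D ('D_(1, 0) u) ('D_(1, 0) v).
Proof.
move=> oD uv z Dz.
have uv' := cr_pair_rot uv.
have du y : D y -> differentiable ('D_(1, 0) u) y.
  by move=> /(cr_deriv_approx oD uv)[r [r0 /(_ r r0 (lexx r))[]]].
have dv y : D y -> differentiable ('D_(1, 0) v) y.
  by move=> /(cr_deriv_approx oD uv')[r [r0 /(_ r r0 (lexx r))[]]].
have [r1 [r10 h1]] := cr_deriv_approx oD uv Dz.
have [r2 [r20 h2]] := cr_deriv_approx oD uv' Dz.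
have /nbhs_normP[r3 /= r30 h3] : nbhs z D by exact: open_nbhs_nbhs.
have [r [r0 rr1 rr2 rr3]] : exists r, [/\ 0 < r, r <= r1, r <= r2 & r <= r3 / 2].
  exists (Num.min r1 (Num.min r2 (r3 / 2))).
  by split; rewrite ?lt_min ?r10 ?r20 ?divr_gt0// !ge_min lexx ?orbT.
have [_ a1 a2] := h1 r r0 rr1; have [_ b1 b2] := h2 r r0 rr2.
have inD y : `|y - z| <= r -> D y.
  move=> yr; apply: h3; rewrite /= distrC; apply: le_lt_trans yr (le_lt_trans rr3 _).
  by rewrite ltr_pdivrMr// ltr_pMr// ltr1n.
have DN y : D y -> 'D_(1, 0) (fun x => - u x) y = - 'D_(1, 0) u y.
  move=> /uv[duy _ _ _]; have -> : (fun x => - u x) = - u by [].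
  by rewrite deriveN//; exact: diff_derivable.
have pr0 : 2 * pi * r != 0 by rewrite lt0r_neq0// mulr_gt0// pi2_gt0.
have cirD t : D (circle z r t) by apply: inD; exact/circle_norm/ltW.
split; [exact: du|exact: dv| |]; apply: (mulfI pr0).
  by apply: (etrans a1); apply: (etrans _ (esym b2)); apply: eq_sint => t _; rewrite DN ?opprK.
rewrite mulrN; apply: (etrans a2); apply: (etrans _ (esym (congr1 -%R b1))).
rewrite -mulN1r -sintZ.
  by apply: eq_sint => t _; rewrite DN//; ring.
have cu : ccont 0 (2 * pi) (fun t => 'D_(1, 0) u (circle z r t)).
  exact: (@ccont_circle _ ('D_(1, 0) u) z r _ _ (ltW r0) (fun y yr => du y (inD y yr))).
have cv : ccont 0 (2 * pi) (fun t => 'D_(1, 0) v (circle z r t)).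
  exact: (@ccont_circle _ ('D_(1, 0) v) z r _ _ (ltW r0) (fun y yr => dv y (inD y yr))).
have cN : ccont 0 (2 * pi) (fun t => 'D_(1, 0) (fun x => - u x) (circle z r t)).
  have -> : (fun t => 'D_(1, 0) (fun x => - u x) (circle z r t)) =
      (fun t => - 'D_(1, 0) u (circle z r t)) by apply/funext => t; exact: DN.
  by move=> t tt; exact: (@cvgN _ _ _ _ _ _ _ (cu t tt)).
by apply: ccontD; apply: ccontM => // t _; [exact: continuous_cos|exact: continuous_sin].
Qed.

(** For u the real part of a holomorphic F, this is the real part of the n-th complex derivative of
    F. *)
Definition dreal n u : R * R -> R := iter n (fun g => 'D_((1, 0) : R * R) g) u.

Lemma dreal_cr D u v n : open D -> cr_pair D u v -> cr_pair D (dreal n u) (dreal n v).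
Proof.
move=> oD uv; elim: n => [|n IH]; [exact: uv|exact: (cr_pair_deriv oD IH)].
Qed.

(** Each derivative costs a distance r and a factor 2 / r. *)
Lemma dreal_estimate D n u v z r M : open D -> cr_pair D u v -> 0 < r ->
  (forall y, `|y - z| <= n%:R * r -> [/\ D y, `|u y| <= M & `|v y| <= M]) ->
  `|dreal n u z| <= M * (2 / r) ^+ n /\ `|dreal n v z| <= M * (2 / r) ^+ n.
Proof.
move=> oD; elim: n u v M => [|n IH] u v M uv r0 hM.
  rewrite expr0 mulr1; have [] := hM z _; last by split.
  by rewrite subrr normr0 mul0r.
rewrite /dreal !iterSr -!/(dreal n _) exprS mulrA.
have -> : M * (2 / r) = 2 * M / r by ring.
apply: (IH _ _ _ (cr_pair_deriv oD uv) r0).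
move=> y yz.
have near w : `|w - y| <= r -> [/\ D w, `|u w| <= M & `|v w| <= M].
  move=> wy; apply: hM; rewrite -(subrK y w) -addrA; apply: le_trans (ler_normD _ _) _.
  by apply: le_trans (lerD wy yz) _; rewrite -natr1 mulrDl mul1r [r + _]addrC.
have [h1 _ h2 _] := cauchy_estimate uv r0 near.
have [Dy _ _] : [/\ D y, `|u y| <= M & `|v y| <= M].
  by apply: near; rewrite subrr normr0 ltW.
by split.
Qed.

(** n^n / n! is one term of the exponential series of e^n. It turns the factor n^n of the iterated
    Cauchy estimates into n!. *)
Lemma natr_exp_fact n : n%:R ^+ n <= n`!%:R * expR 1 ^+ n :> R.
Proof.
case: n => [|n]; first by rewrite !expr0 mulr1 fact0.
have := @expR_ge1Dxn R n.+1%:R n (ler0n _ _).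
rewrite -[X in expR X]mulr1 expRM_natl => h.
have {}h : n.+1%:R ^+ n.+1 / n.+1`!%:R <= expR 1 ^+ n.+1 :> R by apply: le_trans h; rewrite lerDr.
by rewrite -ler_pdivrMl ?ltr0n ?fact_gt0// mulrC.
Qed.

Lemma dreal_local_bound D u v z : open D -> cr_pair D u v -> D z ->
  exists2 r, 0 < r & exists C K, [/\ 0 < C, 0 < K & forall y, `|y - z| < r -> D y /\
    forall n, `|dreal n u y| <= C * n`!%:R * K ^+ n /\ `|dreal n v y| <= C * n`!%:R * K ^+ n].
Proof.
move=> oD uv Dz; have [r r0 [M M0 hM]] := cr_local_bound oD uv Dz.
exists (r / 2); first by rewrite divr_gt0.
pose q := r / 4; have q0 : 0 < q by rewrite divr_gt0.
have e0 : 0 < expR 1 :> R by exact: expR_gt0.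
exists M, (2 / q * expR 1); split => //; first by rewrite mulr_gt0// divr_gt0.
move=> y yz; split; first by case: (hM y) => //; lra.
move=> n.
have hM' w : `|w - y| <= q -> [/\ D w, `|u w| <= M & `|v w| <= M].
  move=> wy; apply: hM; rewrite -(subrK y w) -addrA; apply: le_lt_trans (ler_normD _ _) _.
  by rewrite /q in wy; lra.
have [->|n0] := eqVneq n 0%N.
  rewrite fact0 expr0 !mulr1; have [] := hM' y; first by rewrite subrr normr0 ltW.
  by split.
(* The available distance q is divided into n equal steps, one for each derivative. *)
have nq : 0 < q / n%:R by rewrite divr_gt0// ltr0n lt0n.
have := @dreal_estimate D n u v y (q / n%:R) M oD uv nq.
rewrite mulrC divfK ?pnatr_eq0// => /(_ hM').
have -> : 2 / (q / n%:R) = 2 / q * n%:R by field; rewrite pnatr_eq0 n0 gt_eqF.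
have k : M * (2 / q * n%:R) ^+ n <= M * n`!%:R * (2 / q * expR 1) ^+ n.
  have EX (a b : R) : (a * b) ^+ n = a ^+ n * b ^+ n by exact: exprMn.
  rewrite -[leRHS]mulrA; apply: ler_wpM2l; first exact: ltW.
  rewrite !(EX (2 / q)) [leRHS]mulrCA; apply: ler_wpM2l; last exact: natr_exp_fact.
  by rewrite exprn_ge0// divr_ge0// ltW.
by move=> [h1 h2]; split; apply: le_trans k.
Qed.

(** The derivative is taken along the real axis, on which v vanishes near every point of D. *)
Lemma dreal_axis D u v s n : open D -> cr_pair D u v ->
  (forall s, D (s, 0) -> v (s, 0) = 0) -> D (s, 0) -> dreal n v (s, 0) = 0.
Proof.
move=> oD uv v0; elim: n s => [|n IH] s Ds; first exact: v0.
have [_ dv _ _] := dreal_cr n oD uv Ds.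
have hd : is_derive ((s, 0) : R * R) (1, 0) (dreal n v) (dreal n.+1 v (s, 0)).
  by split => //; exact: diff_derivable.
move/is_derive_slice1 : hd => [_ <-].
have -> : 'D_1 (fun t => dreal n v (t, 0)) s = 'D_1 (fun=> 0 : R) s.
  apply: near_eq_derive.
  have /nbhs_normP[r /= r0 h] : nbhs (s, 0) D by exact: open_nbhs_nbhs.
  apply/nbhs_normP; exists r => //= t ts; apply: IH; apply: h => /=.
  by rewrite plane_norm_ltP /= subrr normr0 r0 andbT.
by rewrite derive_cst.
Qed.

End IteratedDerivatives.

(** * Taylor's formula with bounds from the derivatives *)

Section Taylor.
Variable R : realType.
Implicit Types (r t C K A : R).

Lemma is_derive_expn n (x : R) :
  is_derive x (1 : R) (fun x : R => x ^+ n) (n%:R * x ^+ n.-1).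
Proof.
split; first exact: (@exprn_derivable _ n x 1).
by rewrite exp_derive /GRing.scale /= mulr1.
Qed.

(** The mean value theorem in place of an integral: A x^(n+1) / (n+1) - e g(x) has a nonnegative
    derivative for both signs e. *)
Lemma growth_bound (g dg : R -> R) A n t : 0 <= t ->
  (forall x : R, 0 <= x <= t -> is_derive x 1 g (dg x)) -> g 0 = 0 ->
  (forall x : R, 0 <= x <= t -> `|dg x| <= A * x ^+ n) ->
  `|g t| <= A * t ^+ n.+1 / n.+1%:R.
Proof.
move=> t0 hg g0 hd.
have main (e : R) : e = 1 \/ e = -1 -> e * g t <= A * t ^+ n.+1 / n.+1%:R.
  move=> he; pose h x := A / n.+1%:R * x ^+ n.+1 - e * g x.
  have dh (x : R) : 0 <= x <= t -> is_derive x 1 h (A * x ^+ n - e * dg x).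
    move=> xt; have dp := is_derive_expn n.+1 x.
    apply: (is_derive_eq (is_deriveBl (is_deriveMl (is_derive_cst (A / n.+1%:R) x (1 : R)) dp)
      (is_deriveMl (is_derive_cst e x (1 : R)) (hg x xt)))).
    rewrite /= !mul0r !add0r mulrA divfK ?pnatr_eq0//.
  have dh' x : x \in `]0, t[%R -> is_derive x 1 h (A * x ^+ n - e * dg x).
    by rewrite in_itv /= => /andP[? ?]; apply: dh; rewrite !ltW.
  have ch : {within `[0, t], continuous h}.
    apply: continuous_in_subspaceT => x; rewrite inE /= in_itv /= => xt.
    by apply/differentiable_continuous/derivable1_diffP; have [] := dh _ xt.
  have [c] := MVT_segment t0 dh' ch.
  rewrite in_itv /= => ct; rewrite /h g0 expr0n /= !mulr0 !subr0 => E.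
  have : 0 <= (A * c ^+ n - e * dg c) * t.
    apply: mulr_ge0 => //; rewrite subr_ge0; apply: le_trans (hd _ ct).
    by case: he => ->; rewrite ?mul1r ?mulN1r ?ler_norm// -normrN ler_norm.
  by rewrite -E subr_ge0 mulrAC.
rewrite ler_norml lerNl -mulN1r main; last by right.
by rewrite -[g t]mul1r main//; left.
Qed.

(** The remainder of order n + 1 of [w k] vanishes at 0 and its derivative is the remainder of order
    n of [w k.+1]; hence an induction on n for all k at once. *)
Lemma taylor_bound (w : nat -> R -> R) r C K : 0 < C -> 0 < K ->
  (forall k (x : R), 0 <= x < r -> is_derive x 1 (w k) (w k.+1 x)) ->
  (forall k (x : R), 0 <= x < r -> `|w k x| <= C * k`!%:R * K ^+ k) ->
  forall n k t, 0 <= t < r ->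
  `|w k t - \sum_(j < n) w (k + j)%N 0 * t ^+ j / j`!%:R| <=
   C * (n + k)`!%:R * K ^+ (n + k) * t ^+ n / n`!%:R.
Proof.
move=> C0 K0 dw bw; elim=> [|n IH] k t /andP[t0 tr].
  rewrite big_ord0 subr0 expr0 fact0 divr1 mulr1 add0n; apply: bw.
  by rewrite t0.
pose g x := w k x - \sum_(j < n.+1) w (k + j)%N 0 * x ^+ j / j`!%:R.
pose dg x := w k.+1 x - \sum_(j < n) w (k.+1 + j)%N 0 * x ^+ j / j`!%:R.
have := @growth_bound g dg (C * (n + k.+1)`!%:R * K ^+ (n + k.+1) / n`!%:R) n t t0.
rewrite addSnnS => h; apply: le_trans (h _ _ _) _.
- move=> x /andP[x0 xt].
  have dp j := is_derive_expn j x.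
  have ds m : is_derive x (1 : R) (fun x => \sum_(j < m) w (k + j)%N 0 * x ^+ j / j`!%:R)
     (\sum_(j < m) w (k + j)%N 0 * (j%:R * x ^+ j.-1) / j`!%:R).
    elim: m => [|m IHm].
      by under eq_fun do rewrite big_ord0; rewrite big_ord0; exact: is_derive_cst.
    under eq_fun do rewrite big_ord_recr /=.
    rewrite big_ord_recr /=.
    have d1 : is_derive x (1 : R) (fun x => w (k + m)%N 0 * x ^+ m / m`!%:R)
        (w (k + m)%N 0 * (m%:R * x ^+ m.-1) / m`!%:R).
      apply: (is_derive_eq (is_deriveMl (is_deriveMl (is_derive_cst (w (k + m)%N 0) x (1:R)) (dp m))
       (is_derive_cst (m`!%:R^-1 : R) x (1:R)))).
      by rewrite /=; ring.
    exact: (is_deriveDl IHm d1).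
  apply: (is_derive_eq (is_deriveBl (dw k x _) (ds n.+1))).
    by rewrite x0 (le_lt_trans xt).
  rewrite /dg; congr (_ - _); rewrite big_ord_recl /= !mul0r mulr0 mul0r add0r.
  apply: eq_bigr => j _; rewrite /bump /= add1n addnS -addSn factS natrM -!mulrA; congr (_ * _).
  have jn : j`!%:R != 0 :> R by rewrite pnatr_eq0 -lt0n fact_gt0.
  by field; rewrite jn ?natr1 ?nat1r pnatr_eq0.
- rewrite /g big_ord_recl /= addn0 expr0 fact0 divr1 mulr1 opprD addrA subrr add0r.
  by rewrite big1 ?oppr0// => j _; rewrite /bump /= add1n expr0n /= mulr0 mul0r.
- move=> x /andP[x0 xt]; rewrite /dg -mulrA [_^-1 * _]mulrC mulrA; apply: IH.
  by rewrite x0 (le_lt_trans xt).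
rewrite le_eqVlt; apply/orP; left; apply/eqP; rewrite factS natrM.
have nn : n`!%:R != 0 :> R by rewrite pnatr_eq0 -lt0n fact_gt0.
by field; rewrite nn ?natr1 ?nat1r pnatr_eq0.
Qed.

End Taylor.

Section StemExpansion.
Variable R : realType.
Implicit Types (D : set (R * R)) (u v : R * R -> R) (s t : R).

(** Multiplication by i. As d/dt F = i F', the k-th derivative of (u, v) in the imaginary direction
    is [rot90] iterated k times on the k-th derivatives in the real direction. *)
Definition rot90 (p : R * R) : R * R := (- p.2, p.1).

Lemma rot90_even l (p : R * R) : iter l.*2 rot90 p = ((-1) ^+ l * p.1, (-1) ^+ l * p.2).
Proof.
elim: l => [|l IH]; first by rewrite /= expr0 !mul1r; case: p.
by rewrite doubleS !iterS IH /rot90 /= !exprS !mulN1r !mulNr.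
Qed.

Lemma rot90E l (a b : R) :
  [/\ (iter l.*2 rot90 (a, b)).1 = (-1) ^+ l * a, (iter l.*2 rot90 (a, b)).2 = (-1) ^+ l * b,
      (iter l.*2.+1 rot90 (a, b)).1 = - ((-1) ^+ l * b) &
      (iter l.*2.+1 rot90 (a, b)).2 = (-1) ^+ l * a].
Proof. by rewrite iterS rot90_even. Qed.

(* If [u] is the real part of a holomorphic function, this is the real part of
   its n-th Taylor coefficient at the real point [s]. *)
Definition axis_coef u n s : R := dreal n u (s, 0) / n`!%:R.

Lemma axis_coef_derive D u v n s : open D -> cr_pair D u v -> D (s, 0) ->
  is_derive s 1 (axis_coef u n) (n.+1%:R * axis_coef u n.+1 s).
Proof.
move=> oD uv Ds; have [du _ _ _] := dreal_cr n oD uv Ds.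
have hd : is_derive ((s, 0) : R * R) (1, 0) (dreal n u) (dreal n.+1 u (s, 0)).
  by split => //; exact: diff_derivable.
move/is_derive_slice1 : hd => hd.
apply: (is_derive_eq (is_deriveMl hd (is_derive_cst (n`!%:R^-1 : R) s (1 : R)))).
rewrite /axis_coef /cst mulr0 addr0 factS natrM.
have nn : n`!%:R != 0 :> R by rewrite pnatr_eq0 -lt0n fact_gt0.
by field; rewrite nn ?natr1 ?nat1r pnatr_eq0.
Qed.

Lemma rot90_derive k (g1 g2 : R -> R) (x d1 d2 : R) :
  is_derive x 1 g1 d1 -> is_derive x 1 g2 d2 ->
  is_derive x 1 (fun x => (iter k rot90 (g1 x, g2 x)).1) (iter k rot90 (d1, d2)).1 /\
  is_derive x 1 (fun x => (iter k rot90 (g1 x, g2 x)).2) (iter k rot90 (d1, d2)).2.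
Proof.
move=> h1 h2; elim: k => [//|k [IH1 IH2]]; split => //.
exact: (@is_deriveN _ _ _ _ _ _ _ IH2).
Qed.

Lemma rot90_bound k (p : R * R) M : `|p.1| <= M -> `|p.2| <= M ->
  `|(iter k rot90 p).1| <= M /\ `|(iter k rot90 p).2| <= M.
Proof. by move=> h1 h2; elim: k => [//|k [IH1 IH2]]; split; rewrite ?iterS /= ?normrN. Qed.

Lemma sum_double (V : nmodType) (F : nat -> V) L :
  \sum_(j < L.*2) F j = \sum_(l < L) (F l.*2 + F l.*2.+1).
Proof.
elim: L => [|L IH]; first by rewrite !big_ord0.
by rewrite doubleS !big_ord_recr /= IH addrA.
Qed.

(** All real derivatives of v vanish on the axis, so u keeps the even powers of t and v the odd
    ones, both with coefficients taken from u alone. The constants are uniform in s near s0 and in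
    the order, as the later passage to power series requires. *)
Lemma stem_expansion D u v s0 : open D -> cr_pair D u v ->
  (forall s, D (s, 0) -> v (s, 0) = 0) -> D (s0, 0) ->
  exists r C K : R, [/\ 0 < r, 0 < C, 0 < K & forall s, `|s - s0| < r ->
    [/\ D (s, 0), forall n, `|axis_coef u n s| <= C * K ^+ n &
      forall t, 0 <= t < r -> D (s, t) /\ forall L,
        `|u (s, t) - \sum_(l < L) (-1) ^+ l * axis_coef u l.*2 s * t ^+ l.*2|
           <= C * (K * t) ^+ L.*2 /\
        `|v (s, t) - \sum_(l < L) (-1) ^+ l * axis_coef u l.*2.+1 s * t ^+ l.*2.+1|
           <= C * (K * t) ^+ L.*2]].
Proof.
move=> oD uv v0 Ds0; have [r r0 [C [K [C0 K0 h]]]] := dreal_local_bound oD uv Ds0.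
exists r, C, K; split => // s ss.
have near t : 0 <= t < r -> `|((s, t) : R * R) - (s0, 0)| < r.
  by move=> /andP[t0 tr]; rewrite plane_norm_ltP /= ss subr0 ger0_norm.
have r00 : 0 <= (0 : R) < r by rewrite lexx.
have Ds t : 0 <= t < r -> D (s, t) by move=> /near /h[].
have nf n : 0 < n`!%:R :> R by rewrite ltr0n fact_gt0.
split; first exact: Ds.
  move=> n; rewrite /axis_coef normrM normfV (gtr0_norm (nf n)) ler_pdivrMr//.
  by rewrite mulrAC; case: (h _ (near 0 r00)) => _ /(_ n)[].
move=> t tr; split; first exact: Ds.
move=> L.
have dd k x : 0 <= x < r -> is_derive x 1 (fun t => dreal k u (s, t)) (- dreal k.+1 v (s, x)) /\
     is_derive x 1 (fun t => dreal k v (s, t)) (dreal k.+1 u (s, x)).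
  move=> xr; have [d1 d2 e1 e2] := dreal_cr k oD uv (Ds x xr); split.
    apply/is_derive_slice2; split; first exact: diff_derivable.
    exact: e2.
  by apply/is_derive_slice2; split; [exact: diff_derivable|exact: esym e1].
pose w1 k t := (iter k rot90 (dreal k u (s, t), dreal k v (s, t))).1.
pose w2 k t := (iter k rot90 (dreal k u (s, t), dreal k v (s, t))).2.
have dw k x : 0 <= x < r -> is_derive x 1 (w1 k) (w1 k.+1 x) /\ is_derive x 1 (w2 k) (w2 k.+1 x).
  move=> xr; have [e1 e2] := dd k x xr.
  have := rot90_derive k e1 e2.
  by rewrite -[(- dreal k.+1 v (s, x), dreal k.+1 u (s, x))]
    /(rot90 (dreal k.+1 u (s, x), dreal k.+1 v (s, x))) -!iterSr.
have bw k x : 0 <= x < r -> `|w1 k x| <= C * k`!%:R * K ^+ k /\ `|w2 k x| <= C * k`!%:R * K ^+ k.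
  by move=> /near /h[_ /(_ k)[h1 h2]]; exact: rot90_bound.
have ax k : dreal k v (s, 0) = 0 by apply: dreal_axis oD uv v0 _; exact: Ds.
have T1 := taylor_bound C0 K0 (fun k x xr => (dw k x xr).1) (fun k x xr => (bw k x xr).1) L.*2 0%N tr.
have T2 := taylor_bound C0 K0 (fun k x xr => (dw k x xr).2) (fun k x xr => (bw k x xr).2) L.*2 0%N tr.
have E : C * (L.*2 + 0)`!%:R * K ^+ (L.*2 + 0) * t ^+ L.*2 / (L.*2)`!%:R = C * (K * t) ^+ L.*2.
  by rewrite addn0 exprMn; field; rewrite gt_eqF.
rewrite E (sum_double (fun j => w1 (0 + j)%N 0 * t ^+ j / j`!%:R)) in T1.
rewrite E (sum_double (fun j => w2 (0 + j)%N 0 * t ^+ j / j`!%:R)) in T2.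
have W1 l : w1 l.*2 0 = (-1) ^+ l * dreal l.*2 u (s, 0) /\ w1 l.*2.+1 0 = 0.
  have [h0 _ _ _] := rot90E l (dreal l.*2 u (s, 0)) (dreal l.*2 v (s, 0)).
  have [_ _ h1 _] := rot90E l (dreal l.*2.+1 u (s, 0)) (dreal l.*2.+1 v (s, 0)).
  by split; [exact: h0|rewrite /w1 h1 ax mulr0 oppr0].
have W2 l : w2 l.*2 0 = 0 /\ w2 l.*2.+1 0 = (-1) ^+ l * dreal l.*2.+1 u (s, 0).
  have [_ h1 _ _] := rot90E l (dreal l.*2 u (s, 0)) (dreal l.*2 v (s, 0)).
  have [_ _ _ h0] := rot90E l (dreal l.*2.+1 u (s, 0)) (dreal l.*2.+1 v (s, 0)).
  by split; [rewrite /w2 h1 ax mulr0|exact: h0].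
split.
- apply: le_trans T1; rewrite le_eqVlt; apply/orP; left; apply/eqP; congr (`|_ - _|).
  apply: eq_bigr => l _; have [e1 e2] := W1 l; rewrite !add0n e1 e2 !mul0r addr0 /axis_coef.
  by ring.
- apply: le_trans T2; rewrite le_eqVlt; apply/orP; left; apply/eqP; congr (`|_ - _|).
  apply: eq_bigr => l _; have [e1 e2] := W2 l; rewrite !add0n e1 e2 !mul0r add0r /axis_coef.
  by ring.
Qed.

End StemExpansion.

(** * Power series and the class of smooth functions *)

Section PowerSeries.
Variable R : realType.
Implicit Types (c : nat -> R) (q r C K x : R).

(** n x^n is at most the sum of the x^i with i < n, a partial geometric sum. *)
Lemma linear_geometric_bound x n : 0 <= x -> x < 1 -> n%:R * x ^+ n <= (1 - x)^-1.
Proof.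
move=> x0 x1; have x10 : 0 < 1 - x by rewrite subr_gt0.
rewrite -[leRHS]mul1r ler_pdivlMr//.
have H : \sum_(i < n) x ^+ i * (1 - x) <= 1.
  rewrite -mulr_suml mulrC -[1 - x]opprB mulNr -subrX1 opprB.
  by rewrite gerBl exprn_ge0.
apply: le_trans H; rewrite -mulr_suml ler_wpM2r ?(ltW x10)//.
have -> : n%:R * x ^+ n = \sum_(i < n) x ^+ n by rewrite sumr_const card_ord mulr_natl.
apply: ler_sum => i _.
by apply: ler_wiXn2l => //; [exact: ltW|exact: ltnW (ltn_ord i)].
Qed.

(* The radius of convergence of the power series with coefficients [c] is at
   least [r]. *)
Definition radius_ge r c := forall q, 0 <= q < r -> exists C, forall n, `|c n| * q ^+ n <= C.

Lemma radius_geP r c C K : 0 < K -> (forall n, `|c n| <= C * K ^+ n) -> r * K <= 1 ->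
  radius_ge r c.
Proof.
move=> K0 h rK q /andP[q0 qr]; exists C => n.
have C0 : 0 <= C by have := h 0%N; rewrite expr0 mulr1; apply: le_trans.
apply: le_trans (ler_wpM2r (exprn_ge0 _ q0) (h n)) _.
rewrite -mulrA -exprMn ler_piMr// exprn_ile1 ?mulr_ge0//; first exact: ltW.
by apply: le_trans rK; rewrite mulrC ler_wpM2r ?ltW.
Qed.

(** An intermediate radius p between q and r leaves a factor (q / p)^n to absorb the new factor n +
    1. *)
Lemma radius_ge_diffs r c : radius_ge r c -> radius_ge r (pseries_diffs c).
Proof.
move=> h q /andP[q0 qr]; pose p := (q + r) / 2.
have qp : q < p by rewrite /p; lra.
have pr : p < r by rewrite /p; lra.
have p0 : 0 < p by apply: le_lt_trans qp.
have [|C hC] := h p; first by rewrite ltW.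
have s1 : q / p < 1 by rewrite ltr_pdivrMr// mul1r.
have s0 : 0 <= q / p by rewrite divr_ge0// ltW.
exists ((1 - q / p)^-1 * (C / p) + C / p) => n.
rewrite /pseries_diffs normrM ger0_norm// -natr1.
have -> : q ^+ n = (q / p) ^+ n * p ^+ n by rewrite -exprMn divfK// gt_eqF.
have hn : `|c n.+1| * p ^+ n <= C / p.
  by rewrite ler_pdivlMr// -mulrA -exprSr.
have C0 : 0 <= C / p by apply: le_trans hn; rewrite mulr_ge0// exprn_ge0// ltW.
have -> : (n%:R + 1) * `|c n.+1| * ((q / p) ^+ n * p ^+ n) =
  (n%:R * (q / p) ^+ n) * (`|c n.+1| * p ^+ n) + (q / p) ^+ n * (`|c n.+1| * p ^+ n) by ring.
have cp0 : 0 <= `|c n.+1| * p ^+ n by rewrite mulr_ge0// exprn_ge0// ltW.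
apply: lerD.
  apply: ler_pM => //; first by rewrite mulr_ge0// exprn_ge0.
  exact: linear_geometric_bound.
by apply: le_trans hn; rewrite ler_piMl// exprn_ile1// ltW.
Qed.

Lemma radius_ge_cvg r c x : radius_ge r c -> `|x| < r -> cvgn (pseries c x).
Proof.
move=> h xr; pose p := (`|x| + r) / 2.
have xp : `|x| < p by rewrite /p; lra.
have pr : p < r by rewrite /p; lra.
have p0 : 0 < p by apply: le_lt_trans xp.
have [|C hC] := h p; first by rewrite ltW.
have s1 : `|x| / p < 1 by rewrite ltr_pdivrMr// mul1r.
have s0 : 0 <= `|x| / p by rewrite divr_ge0// ltW.
apply: normed_cvg.
have geo : cvgn (series (geometric C (`|x| / p))).
  by apply: is_cvg_geometric_series; rewrite ger0_norm.
apply: series_le_cvg geo => n; rewrite /= ?normr_ge0//.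
  have C0 : 0 <= C by apply: le_trans (hC 0%N); rewrite expr0 mulr1.
  by rewrite mulr_ge0// exprn_ge0.
rewrite normrM normrX.
have -> : `|x| ^+ n = (`|x| / p) ^+ n * p ^+ n by rewrite -exprMn divfK// gt_eqF.
by rewrite mulrCA mulrC ler_wpM2r// exprn_ge0.
Qed.

(** The successive derivatives are part of the witness, so passing to the derivative is a shift of
    the sequence. *)
Definition smooth r (phi : R -> R) := exists Phi : nat -> R -> R, Phi 0%N = phi /\
  forall i x, `|x| < r -> is_derive x 1 (Phi i) (Phi i.+1 x).

Definition psum c x : R := limn (pseries c x).

Lemma psum_derive r c x : radius_ge r c -> `|x| < r ->
  is_derive x 1 (psum c) (psum (pseries_diffs c) x).
Proof.
move=> h xr; pose p := (`|x| + r) / 2.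
have xp : `|x| < p by rewrite /p; lra.
have p0 : 0 < p by apply: le_lt_trans xp.
have pr : `|p| < r by rewrite gtr0_norm// /p; lra.
apply: (@pseries_snd_diffs _ c p).
- exact: radius_ge_cvg pr.
- exact: (radius_ge_cvg (radius_ge_diffs h) pr).
- exact: (radius_ge_cvg (radius_ge_diffs (radius_ge_diffs h)) pr).
- by rewrite (gtr0_norm p0).
Qed.

Lemma psum_smooth r c : radius_ge r c -> smooth r (psum c).
Proof.
move=> h; exists (fun i => psum (iter i (@pseries_diffs R) c)); split => // i x xr.
have hi : radius_ge r (iter i (@pseries_diffs R) c).
  by elim: i => //= i; exact: radius_ge_diffs.
exact: psum_derive hi xr.
Qed.

Lemma psum_shift r c x : radius_ge r c -> `|x| < r ->
  psum c x = c 0%N + x * psum (fun n => c n.+1) x.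
Proof.
move=> h xr; have hc := radius_ge_cvg h xr.
have [x0|x0] := eqVneq x 0.
  rewrite x0 mul0r addr0 /psum /pseries; apply: lim_near_cst => //.
  near=> n; have n0 : (0 < n)%N by near: n; exact: nbhs_infty_gt.
  rewrite -(prednK n0) seriesEnat /= big_nat_recl//= expr0 mulr1 big1_seq ?addr0//.
  by move=> i _; rewrite expr0n mulr0.
have E : pseries (fun n => c n.+1) x = (fun n => x^-1 * (pseries c x n.+1 - c 0%N)).
  apply/funext => n; rewrite /pseries !seriesEnat /= [in RHS]big_nat_recl//= expr0 mulr1.
  rewrite [c 0%N + _]addrC addrK mulr_sumr; apply: eq_bigr => i _.
  by rewrite exprS; field.
have cv : pseries (fun n => c n.+1) x n @[n --> \oo] --> x^-1 * (psum c x - c 0%N).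
  rewrite E; apply: cvgM; first exact: cvg_cst.
  apply: cvgB; last exact: cvg_cst.
  by rewrite (cvg_shiftS (pseries c x)); exact: hc.
have -> : psum (fun n => c n.+1) x = x^-1 * (psum c x - c 0%N) by exact/cvg_lim.
by rewrite mulVKf// addrC subrK.
Unshelve. all: by end_near.
Qed.

(** The passage from Taylor remainders of geometric size to the sum of the power series. *)
Lemma psum_cvg c x (l : R) (C q : R) : 0 <= q < 1 ->
  (forall L, `|l - \sum_(i < L) c i * x ^+ i| <= C * q ^+ L) -> psum c x = l.
Proof.
move=> /andP[q0 q1] h; apply/cvg_lim => //.
have : (fun n => C * q ^+ n) @ \oo --> (0 : R).
  rewrite -[X in _ --> X](mulr0 C); apply: cvgM; first exact: cvg_cst.
  by apply: cvg_expr; rewrite ger0_norm.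
move/cvgrPdist_le => hq; apply/cvgrPdist_le => e e0; have := hq e e0.
apply: filterS => n; rewrite sub0r normrN => k.
rewrite /pseries seriesEnat /= big_mkord; apply: le_trans (h n) _.
by apply: le_trans (ler_norm _) k.
Qed.

End PowerSeries.

(** * Inner product and reflections *)

Section Dot.
Variables (R : realType) (m : nat).
Local Notation E := 'rV[R]_m.
Implicit Types (a b u v w x y z : E) (c : R).

Lemma dotvC u v : dotv u v = dotv v u.
Proof. by apply: eq_bigr => j _; rewrite mulrC. Qed.

Lemma dotvDr u v w : dotv u (v + w) = dotv u v + dotv u w.
Proof. by rewrite /dotv -big_split /=; apply: eq_bigr => j _; rewrite mxE mulrDr. Qed.

Lemma dotvZr u c v : dotv u (c *: v) = c * dotv u v.
Proof. by rewrite /dotv mulr_sumr; apply: eq_bigr => j _; rewrite mxE mulrCA. Qed.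

Lemma dotvDl u v w : dotv (v + w) u = dotv v u + dotv w u.
Proof. by rewrite !(dotvC _ u) dotvDr. Qed.

Lemma dotvZl u c v : dotv (c *: v) u = c * dotv v u.
Proof. by rewrite !(dotvC _ u) dotvZr. Qed.

Lemma dotvNr u v : dotv u (- v) = - dotv u v.
Proof. by rewrite -scaleN1r dotvZr mulN1r. Qed.

Lemma dotvNl u v : dotv (- v) u = - dotv v u.
Proof. by rewrite -scaleN1r dotvZl mulN1r. Qed.

Lemma dotv0 u : dotv u 0 = 0.
Proof. by rewrite -(scale0r 0) dotvZr mul0r. Qed.

Lemma dotv_ge0 u : 0 <= dotv u u.
Proof. by apply: sumr_ge0 => j _; rewrite -expr2 sqr_ge0. Qed.

Lemma dotv_delta u j : dotv u (unitv R j) = u ord0 j.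
Proof.
rewrite /dotv (bigD1 j)//= mxE !eqxx mulr1 big1 ?addr0// => i /negPf ij.
by rewrite mxE eqxx ij mulr0.
Qed.

Lemma row_sum_unitv v : v = \sum_(j < m) v ord0 j *: unitv R j.
Proof. by rewrite {1}(row_sum_delta v). Qed.

Lemma reflectionD a x y : reflection a (x + y) = reflection a x + reflection a y.
Proof. by rewrite /reflection dotvDr mulrDr mulrDl scalerDl opprD addrACA. Qed.

Lemma reflectionZ a c x : reflection a (c *: x) = c *: reflection a x.
Proof. by rewrite /reflection dotvZr scalerBr scalerA; congr (_ - _ *: _); ring. Qed.

Lemma reflection_root a b : dotv a a = 2 -> reflection a b = b - dotv a b *: a.
Proof. by move=> a2; rewrite /reflection a2 mulrAC divff ?mul1r// pnatr_eq0. Qed.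

Lemma reflectionNl a b : reflection (- a) b = reflection a b.
Proof. by rewrite /reflection !dotvNl dotvNr opprK mulrN mulNr scalerN scaleNr opprK. Qed.

Section Root.
Variables (a : E) (a2 : dotv a a = 2).

Lemma reflection_self : reflection a a = - a.
Proof. by rewrite reflection_root// a2 scaler_nat mulr2n opprD addrA subrr add0r. Qed.

Lemma dotv_reflection_root x : dotv a (reflection a x) = - dotv a x.
Proof. by rewrite reflection_root// dotvDr dotvNr dotvZr a2; ring. Qed.

Lemma reflectionK x : reflection a (reflection a x) = x.
Proof.
by rewrite [LHS]reflection_root// dotv_reflection_root reflection_root// scaleNr opprK subrK.
Qed.

Lemma dotv_reflection x y : dotv x (reflection a y) = dotv (reflection a x) y.
Proof.
by rewrite !reflection_root// dotvDr dotvDl dotvNr dotvNl dotvZr dotvZl (dotvC x a); ring.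
Qed.

Lemma reflection_isometry x y : dotv (reflection a x) (reflection a y) = dotv x y.
Proof. by rewrite dotv_reflection reflectionK. Qed.

(** Conjugation of reflections: s_a s_b = s_c s_a with c = s_a b. *)
Lemma reflection_conj b x : dotv b b = 2 ->
  reflection a (reflection b x) = reflection (reflection a b) (reflection a x).
Proof.
move=> b2; rewrite (@reflection_root (reflection a b)); last by rewrite reflection_isometry.
rewrite reflection_isometry [in LHS](reflection_root x b2) reflectionD -scaleN1r.
by rewrite reflectionZ reflectionZ scaleN1r.
Qed.

End Root.

Lemma dotv_linear w : linear (dotv w).
Proof. by move=> c u v; rewrite dotvDr dotvZr. Qed.

HB.instance Definition _ w := GRing.isLinear.Build R E R *:%R (dotv w) (dotv_linear w).

Lemma dotv_sum_fun w : dotv w = \sum_(j < m) (fun y : E => w ord0 j * y ord0 j).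
Proof. by apply/funext => y; rewrite fct_sumE. Qed.

Lemma dotv_differentiable w y : differentiable (dotv w) y.
Proof.
rewrite dotv_sum_fun; apply: differentiable_sum => j.
by apply: differentiableM => //; exact: differentiable_coord.
Qed.

Lemma dotv_derive w y v : 'D_v (dotv w) y = dotv w v.
Proof.
rewrite deriveE; last exact: dotv_differentiable.
rewrite diff_lin// => z; apply: differentiable_continuous; exact: dotv_differentiable.
Qed.

Lemma sqnorm_differentiable y : differentiable (fun y : E => dotv y y) y.
Proof.
have -> : (fun y : E => dotv y y) = \sum_(j < m) (fun y : E => y ord0 j * y ord0 j).
  by apply/funext => z; rewrite fct_sumE.
apply: differentiable_sum => j.
by apply: differentiableM => //; exact: differentiable_coord.
Qed.

Lemma sqnorm_derive y v : 'D_v (fun y : E => dotv y y) y = 2 * dotv v y.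
Proof.
have -> : (fun y : E => dotv y y) = \sum_(j < m) (fun y : E => dotv (unitv R j) y * dotv (unitv R j) y).
  by apply/funext => z; rewrite fct_sumE; apply: eq_bigr => j _; rewrite dotvC dotv_delta.
rewrite derive_sum; last first.
  by move=> j; apply: derivableM; apply: diff_derivable; exact: dotv_differentiable.
rewrite [in RHS]/dotv mulr_sumr; apply: eq_bigr => j _.
rewrite deriveM; try by apply: diff_derivable; exact: dotv_differentiable.
by rewrite !dotv_derive !(dotvC (unitv R j)) !dotv_delta /GRing.scale /=; ring.
Qed.

Lemma reflection_linear a : linear (reflection a).
Proof. by move=> c u v; rewrite reflectionD reflectionZ. Qed.

HB.instance Definition _ a := GRing.isLinear.Build R E E *:%R (reflection a) (reflection_linear a).

Lemma reflection_differentiable a y : differentiable (reflection a) y.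
Proof.
have -> : reflection a = id - (fun y => (2 * dotv a y / dotv a a) *: a) by [].
apply: differentiableB => //; apply: differentiableZl.
by do 2!apply: differentiableM => //; exact: dotv_differentiable.
Qed.

End Dot.

(** * A function class stable under Dunkl operators *)

Section SmoothClass.
Variables (R : realType) (m : nat) (rho : R).
Local Notation E := 'rV[R]_m.
Implicit Types (a b u v w x y z : E) (f g : E -> R).

(** [rho] bounds the squared Euclidean norm: the ball is invariant under reflections, and radial
    functions are functions of |y|^2 without square roots. *)
Definition inball y := dotv y y < rho.

(* The functions generated by smooth radial functions and linear forms: a class
   stable under Dunkl operators, in which their properties go by induction. *)
Inductive sm : (E -> R) -> Prop :=
| sm_rad phi : smooth rho phi -> sm (fun y => phi (dotv y y))
| sm_lin w f : sm f -> sm (fun y => dotv w y * f y)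
| sm_add f g : sm f -> sm g -> sm (fun y => f y + g y)
| sm_ext f g : (forall y, inball y -> f y = g y) -> sm f -> sm g.

Lemma inball_nbhs y : inball y -> \forall z \near y, inball z.
Proof.
move=> yB; have := @differentiable_continuous _ _ _ _ _ (sqnorm_differentiable y).
move=> /cvgrPdist_lt /(_ (rho - dotv y y)); rewrite subr_gt0 => /(_ yB).
apply: filterS => z; rewrite distrC => /(le_lt_trans (ler_norm _)).
by rewrite ltrD2r.
Qed.

Lemma inball_reflection a y : dotv a a = 2 -> inball (reflection a y) = inball y.
Proof. by move=> a2; rewrite /inball reflection_isometry. Qed.

Lemma smooth_cst c : smooth rho (fun=> c).
Proof.
exists (fun i => if i is 0%N then fun=> c else fun=> 0); split => // i x _.
by case: i => [|i]; exact: is_derive_cst.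
Qed.

Lemma sm_cst c : sm (fun=> c).
Proof. exact: (sm_rad (smooth_cst c)). Qed.

Lemma sm_scale c f : sm f -> sm (fun y => c * f y).
Proof.
elim=> {f} [phi [Phi [P0 dP]]|w f _ IH|f g _ IHf _ IHg|f g fg _ IH].
- have sc : smooth rho (fun t => c * phi t); last exact: (sm_rad sc).
  exists (fun i t => c * Phi i t); split; first by rewrite P0.
  move=> i x xr.
  apply: (is_derive_eq (is_deriveMl (is_derive_cst (c : R) x (1 : R)) (dP i x xr))).
  by rewrite /cst mul0r add0r.
- apply: sm_ext (sm_lin w IH) => y _; ring.
- apply: sm_ext (sm_add IHf IHg) => y _; ring.
- by apply: sm_ext IH => y yB; rewrite fg.
Qed.

Lemma sm_opp f : sm f -> sm (fun y => - f y).
Proof. by move=> /(sm_scale (-1)); apply: sm_ext => y _; rewrite mulN1r. Qed.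

Lemma sm_sum (I : Type) (r : seq I) (P : pred I) (F : I -> E -> R) :
  (forall i, P i -> sm (F i)) -> sm (fun y => \sum_(i <- r | P i) F i y).
Proof.
move=> h; elim: r => [|i r IH].
  by apply: sm_ext (sm_cst 0) => y _; rewrite big_nil.
have [Pi|nPi] := boolP (P i).
  by apply: sm_ext (sm_add (h i Pi) IH) => y _; rewrite big_cons Pi.
by apply: sm_ext IH => y _; rewrite big_cons (negPf nPi).
Qed.

Lemma sm_sqnorm f : sm f -> sm (fun y => dotv y y * f y).
Proof.
move=> h; apply: (@sm_ext (fun y => \sum_(j < m) dotv (unitv R j) y * (dotv (unitv R j) y * f y))).
  move=> y _; rewrite {3}/dotv mulr_suml; apply: eq_bigr => j _.
  by rewrite dotvC dotv_delta mulrA.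
by apply: sm_sum => j _; do 2!apply: sm_lin.
Qed.

Lemma sm_sqnormX L f : sm f -> sm (fun y => dotv y y ^+ L * f y).
Proof.
move=> h; elim: L => [|L /sm_sqnorm]; first by apply: sm_ext h => y _; rewrite expr0 mul1r.
by apply: sm_ext => y _; rewrite exprS mulrA.
Qed.

Lemma sm_reflection a f : dotv a a = 2 -> sm f -> sm (fun y => f (reflection a y)).
Proof.
move=> a2; elim=> {f} [phi h|w f _ IH|f g _ IHf _ IHg|f g fg _ IH].
- by apply: sm_ext (sm_rad h) => y _; rewrite reflection_isometry.
- by apply: sm_ext (sm_lin (reflection a w) IH) => y _; rewrite dotv_reflection.
- exact: sm_add.
- by apply: sm_ext IH => y yB; rewrite fg// inball_reflection.
Qed.

Lemma rad_derive (phi : R -> R) d v y : is_derive (dotv y y) 1 phi d ->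
  differentiable (fun y : E => phi (dotv y y)) y /\
  'D_v (fun y : E => phi (dotv y y)) y = 2 * dotv v y * d.
Proof.
move=> [d1 d2].
have D1 : differentiable phi (dotv y y) by apply/derivable1_diffP.
have D2 := sqnorm_differentiable y.
have D : differentiable (phi \o (fun y : E => dotv y y)) y by exact: differentiable_comp.
have E2 : 'd (fun y : E => dotv y y) y v = 2 * dotv v y.
  by rewrite -deriveE// sqnorm_derive.
have E1 (h : R) : 'd phi (dotv y y) h = h * d by rewrite deriv1E// derive1E d2.
by split => //; rewrite (deriveE _ D) diff_comp// /= E2 E1.
Qed.

(** Closure under derivatives and differentiability are proved together. In the case of [sm_ext]
    differentiability has to be carried over to a function that agrees with f on the open ball
    only. *)
Lemma sm_derive f v : sm f -> exists2 g, sm g &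
  forall y, inball y -> differentiable f y /\ 'D_v f y = g y.
Proof.
elim=> {f} [phi [Phi [P0 dP]]|w f smf [g smg hg]|f f' _ [g smg hg] _ [g' smg' hg']|f f' ff' _ [g smg hg]].
- exists (fun y => dotv (2 *: v) y * Phi 1%N (dotv y y)).
    apply: sm_lin; apply: sm_rad; exists (fun i => Phi i.+1); split => // i x xr.
    exact: dP.
  move=> y yB; have y1 : `|dotv y y| < rho by rewrite ger0_norm// dotv_ge0.
  by have := rad_derive v (dP 0%N _ y1); rewrite P0 dotvZl.
- exists (fun y => dotv w v * f y + dotv w y * g y).
    by apply: sm_add; [exact: sm_scale|exact: sm_lin].
  move=> y yB; have [df e] := hg y yB; have dw := dotv_differentiable w y.
  split; first exact: differentiableM.
  have h1 : is_derive y v (dotv w) (dotv w v).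
    by split; [exact: diff_derivable|exact: dotv_derive].
  have h2 : is_derive y v f (g y) by split => //; exact: diff_derivable.
  by have [_ ->] := is_deriveMl h1 h2.
- exists (fun y => g y + g' y); first exact: sm_add.
  move=> y yB; have [df e] := hg y yB; have [df' e'] := hg' y yB.
  split; first exact: differentiableD.
  have h1 : is_derive y v f (g y) by split => //; exact: diff_derivable.
  have h2 : is_derive y v f' (g' y) by split => //; exact: diff_derivable.
  by have [_ ->] := is_deriveDl h1 h2.
- exists g => // y yB; have [df e] := hg y yB.
  have near_eq : {near y, f =1 f'} by apply: filterS (inball_nbhs yB) => z /ff'.
  split; last by rewrite -(near_eq_derive _ near_eq).
  have [||df' _] := @approx_differentiable R E R f' y ('d f y); last by [].
    by have /diff_locallyP[] := df.
  move=> e' e'0; have [d d0 hd] := differentiable_approx df e'0.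
  have /nbhs_normP[r /= r0 hr] := near_eq.
  exists (Num.min d r); first by rewrite lt_min d0.
  move=> z; rewrite lt_min => /andP[zd zr]; have := hd z zd; rewrite deriveE//.
  rewrite (hr z)/=; last by rewrite distrC.
  by rewrite (hr y)//= subrr normr0.
Qed.

Lemma sm_differentiable f y : sm f -> inball y -> differentiable f y.
Proof. by move=> /(@sm_derive _ 0)[g _ h] /h[]. Qed.

Lemma sm_continuous f y : sm f -> inball y -> {for y, continuous f}.
Proof. by move=> h /(sm_differentiable h); exact: differentiable_continuous. Qed.

(** Divisibility by <a, .> comes from the construction of f: radial functions give quotient 0, and a
    linear factor obeys a twisted Leibniz rule. No Taylor formula across the hyperplane is
    needed. *)
Lemma sm_quotient f a : dotv a a = 2 -> sm f -> exists2 d, sm d &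
  forall y, inball y -> f y - f (reflection a y) = dotv a y * d y.
Proof.
move=> a2; elim=> {f} [phi h|w f smf [d smd hd]|f f' _ [d smd hd] _ [d' smd' hd']|f f' ff' _ [d smd hd]].
- exists (fun=> 0); first exact: sm_cst.
  by move=> y _; rewrite reflection_isometry// subrr mulr0.
(* Twisted Leibniz rule, from <w, y> - <w, s_a y> = <a, y> <w, a>. *)
- exists (fun y => dotv w y * d y + dotv w a * f (reflection a y)).
    by apply: sm_add; [exact: sm_lin|apply: sm_scale; exact: sm_reflection].
  move=> y yB; have {hd}hd := hd y yB.
  rewrite dotv_reflection// reflection_root// dotvDl dotvNl dotvZl (dotvC a w).
  have -> : f y = f (reflection a y) + dotv a y * d y by rewrite -hd addrC subrK.
  by rewrite reflection_root//; ring.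
- exists (fun y => d y + d' y); first exact: sm_add.
  by move=> y yB; rewrite mulrDr -hd// -hd'//; ring.
- by exists d => // y yB; rewrite -hd// !ff'// inball_reflection.
Qed.

End SmoothClass.

(** * Dunkl operators *)

Section Dunkl.
Variables (R : realType) (m : nat) (rho : R).
Local Notation E := 'rV[R]_m.
Variables (Rs Rp : {fset E}) (k : E -> R).
Implicit Types (a b u v w x y z : E) (f g d : E -> R).
Local Notation sm := (sm rho).
Local Notation inball := (inball rho).
Local Notation Q a f := (reflection_quotient f a).

(** Makes the filter of the limit in [reflection_quotient] proper, so that this limit is unique. *)
Lemma root_dir_dense a y (P : set E) : dotv a a = 2 -> nbhs y P ->
  exists z, P z /\ dotv a z != 0.
Proof.
move=> a2 /nbhs_normP[r /= r0 hP].
have [ay|ay] := eqVneq (dotv a y) 0; last first.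
  by exists y; split => //; apply: hP => /=; rewrite subrr normr0.
have n0 : 0 < `|a| + 1 by rewrite ltr_wpDl.
exists (y + (r / 2 / (`|a| + 1)) *: a); split.
  apply: hP; rewrite /= opprD addrA subrr add0r normrN normrZ.
  rewrite ger0_norm; last by rewrite !divr_ge0// ltW.
  apply: (@le_lt_trans _ _ (r / 2)); last by rewrite ltr_pdivrMr// ltr_pMr// ltr1n.
  by rewrite mulrAC ler_pdivrMr// ler_wpM2l ?divr_ge0 ?(ltW r0)// lerDl.
rewrite dotvDr ay add0r dotvZr a2; apply: lt0r_neq0.
by rewrite mulr_gt0// !divr_gt0.
Qed.

(** Any factorization through a function of the class computes the quotient, also on the hyperplane.
    The calculation rules for quotients below are proved by exhibiting such factorizations. *)
Lemma reflection_quotientE f a d y : dotv a a = 2 ->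
  (forall z, inball z -> f z - f (reflection a z) = dotv a z * d z) ->
  sm d -> inball y -> Q a f y = d y.
Proof.
move=> a2 fd smd yB; rewrite /reflection_quotient.
case: ifPn => [_|ay]; last by rewrite fd// /GRing.scale /= mulKf.
set q := fun z : E => _; set F := within _ _.
have FP : ProperFilter F.
  apply: Build_ProperFilter_ex => // P; rewrite /F /within /= => nP.
  by have [z [Pz az]] := root_dir_dense a2 nP; exists z; exact: Pz.
apply/cvg_lim => //.
have cd : d z @[z --> F] --> d y.
  apply: cvg_trans (sm_continuous smd yB); exact: cvg_fmap2 (@cvg_within _ _ _ _).
apply: cvg_trans cd; apply: near_eq_cvg; rewrite /F !near_withinE.
have := inball_nbhs yB; apply: filterS => z zB az.
by rewrite /q fd// /GRing.scale /= mulKf.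
Qed.

Section Quotient.
Variables (a : E) (a2 : dotv a a = 2).

Lemma quot_sm f : sm f -> sm (Q a f).
Proof.
move=> smf; have [d smd hd] := sm_quotient a2 smf.
by apply: sm_ext (smd) => y yB; rewrite (reflection_quotientE a2 hd smd yB).
Qed.

Lemma quot_eq f y : sm f -> inball y -> f y - f (reflection a y) = dotv a y * Q a f y.
Proof.
move=> smf yB; have [d smd hd] := sm_quotient a2 smf.
by rewrite (reflection_quotientE a2 hd smd yB) hd.
Qed.

Lemma quot_ext f g y : sm f -> (forall z, inball z -> f z = g z) -> inball y ->
  Q a f y = Q a g y.
Proof.
move=> smf fg yB; have [d smd hd] := sm_quotient a2 smf.
rewrite (reflection_quotientE a2 hd smd yB); symmetry.
apply: (reflection_quotientE a2 _ smd yB) => z zB.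
by rewrite -!fg// ?hd// inball_reflection.
Qed.

Lemma quot_rad (phi : R -> R) y : inball y -> Q a (fun y => phi (dotv y y)) y = 0.
Proof.
move=> yB; apply: (reflection_quotientE a2 _ (sm_cst m rho 0) yB) => z _.
by rewrite reflection_isometry// subrr mulr0.
Qed.

Lemma quot_add f g y : sm f -> sm g -> inball y ->
  Q a (fun y => f y + g y) y = Q a f y + Q a g y.
Proof.
move=> smf smg yB; apply: (@reflection_quotientE _ a (fun y => Q a f y + Q a g y)) => //.
  by move=> z zB; rewrite mulrDr -!quot_eq//; ring.
by apply: sm_add; exact: quot_sm.
Qed.

Lemma quot_lin w f y : sm f -> inball y -> Q a (fun y => dotv w y * f y) y =
  dotv w y * Q a f y + dotv a w * f (reflection a y).
Proof.
move=> smf yB; apply: (@reflection_quotientE _ a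
  (fun y => dotv w y * Q a f y + dotv a w * f (reflection a y))) => //.
  move=> z zB; rewrite dotv_reflection// reflection_root// dotvDl dotvNl dotvZl.
  have -> : f z = f (reflection a z) + dotv a z * Q a f z by rewrite -quot_eq// addrC subrK.
  by rewrite reflection_root//; ring.
by apply: sm_add; [apply: sm_lin; exact: quot_sm|apply: sm_scale; exact: sm_reflection].
Qed.

Lemma quot_sqnorm f y : sm f -> inball y -> Q a (fun y => dotv y y * f y) y =
  dotv y y * Q a f y.
Proof.
move=> smf yB; apply: (@reflection_quotientE _ a (fun y => dotv y y * Q a f y)) => //.
  by move=> z zB; rewrite reflection_isometry// mulrCA -quot_eq//; ring.
by apply: sm_sqnorm; exact: quot_sm.
Qed.

Lemma quot_scale c f y : sm f -> inball y -> Q a (fun y => c * f y) y = c * Q a f y.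
Proof.
move=> smf yB; apply: (@reflection_quotientE _ a (fun y => c * Q a f y)) => //.
  by move=> z zB; rewrite mulrCA -quot_eq//; ring.
by apply: sm_scale; exact: quot_sm.
Qed.

End Quotient.

Lemma quot_opp a f y : dotv a a = 2 -> sm f -> inball y -> Q (- a) f y = - Q a f y.
Proof.
move=> a2 smf yB; have Na2 : dotv (- a) (- a) = 2 by rewrite dotvNl dotvNr opprK.
apply: (@reflection_quotientE _ (- a) (fun y => - Q a f y)) => //.
  by move=> z zB; rewrite reflectionNl dotvNl mulrNN quot_eq.
by apply: sm_opp; exact: quot_sm.
Qed.

Lemma quot_reflection a b f y : dotv a a = 2 -> dotv b b = 2 -> sm f -> inball y ->
  Q a (fun y => f (reflection b y)) y = Q (reflection b a) f (reflection b y).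
Proof.
move=> a2 b2 smf yB.
have ba2 : dotv (reflection b a) (reflection b a) = 2 by rewrite reflection_isometry.
apply: (@reflection_quotientE _ a (fun y => Q (reflection b a) f (reflection b y))) => //.
  move=> z zB; rewrite reflection_conj// quot_eq// ?inball_reflection//.
  by rewrite reflection_isometry.
by apply: (sm_reflection b2 (quot_sm ba2 smf)).
Qed.

(** The scalar Dunkl operator in a direction v; working with all directions at once makes
    reflections act on v. *)
Definition sT v f y : R := \sum_(j < m) v ord0 j * dunkl Rp k j f y.

Hypothesis Rp2 : forall a, a \in Rp -> dotv a a = 2.

Lemma sTE v f y : differentiable f y ->
  sT v f y = 'D_v f y + \sum_(a <- Rp) k a * dotv a v * Q a f y.
Proof.
move=> df; rewrite /sT /dunkl.
under eq_bigr do rewrite mulrDr.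
rewrite big_split /=; congr (_ + _).
  rewrite deriveE// [in RHS](row_sum_unitv v) raddf_sum /=.
  by apply: eq_bigr => j _; rewrite linearZ /= deriveE.
under eq_bigr do rewrite mulr_sumr.
rewrite exchange_big /=; apply: eq_bigr => a _.
rewrite {1}/dotv mulr_sumr mulr_suml; apply: eq_bigr => j _.
by rewrite /GRing.scale /=; ring.
Qed.

Lemma sT_sm v f : sm f -> sm (sT v f).
Proof.
move=> smf; have [g smg hg] := sm_derive v smf.
apply: (@sm_ext _ _ _ (fun y => g y + \sum_(a <- Rp | a \in Rp) k a * dotv a v * Q a f y)).
  move=> y yB; have [df e] := hg y yB; rewrite sTE// e; congr (_ + _).
  by rewrite [RHS]big_seq_cond [LHS]big_seq_cond; apply: eq_bigl => a; rewrite andbT andbb.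
apply: sm_add => //; apply: sm_sum => a /Rp2 a2.
by apply: sm_scale; exact: quot_sm.
Qed.

Lemma sT_iter_sm v n f : sm f -> sm (iter n (sT v) f).
Proof. by move=> smf; elim: n => //= n; exact: sT_sm. Qed.

Let sum_roots (F G : E -> R) : (forall a, dotv a a = 2 -> F a = G a) ->
  \sum_(a <- Rp) F a = \sum_(a <- Rp) G a.
Proof.
move=> FG; rewrite big_seq [RHS]big_seq; apply: eq_bigr => a aR; apply: FG; exact: Rp2.
Qed.

Lemma sT_ext v f g y : sm f -> (forall z, inball z -> f z = g z) -> inball y ->
  sT v f y = sT v g y.
Proof.
move=> smf fg yB; have smg := sm_ext fg smf.
rewrite !sTE; try exact: sm_differentiable yB.
congr (_ + _).
  by apply: near_eq_derive; apply: filterS (inball_nbhs yB) => z /fg.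
by apply: sum_roots => a a2; rewrite (quot_ext a2 smf fg).
Qed.

Let isD v f y : sm f -> inball y -> is_derive y v f ('D_v f y).
Proof. by move=> smf yB; split => //; apply: diff_derivable; exact: sm_differentiable yB. Qed.

Lemma sT_add v f g y : sm f -> sm g -> inball y ->
  sT v (fun y => f y + g y) y = sT v f y + sT v g y.
Proof.
move=> smf smg yB; rewrite !sTE; try exact: sm_differentiable yB; last first.
  by apply: sm_differentiable yB; exact: sm_add.
have [_ ->] := is_deriveDl (isD v smf yB) (isD v smg yB).
rewrite addrACA -big_split /=; congr (_ + _); apply: sum_roots => a a2.
by rewrite quot_add//; ring.
Qed.

Lemma sT_scale v c f y : sm f -> inball y -> sT v (fun y => c * f y) y = c * sT v f y.
Proof.
move=> smf yB; rewrite !sTE; try exact: sm_differentiable yB; last first.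
  by apply: sm_differentiable yB; exact: sm_scale.
have [_ ->] := is_deriveMl (is_derive_cst (c : R) y v) (isD v smf yB).
rewrite /cst mul0r add0r mulrDr mulr_sumr; congr (_ + _); apply: sum_roots => a a2.
by rewrite quot_scale//; ring.
Qed.

(** The commutator of T_v with multiplication by <w, .>; the reflection terms come from the twisted
    Leibniz rule. *)
Lemma sT_lin v w f y : sm f -> inball y -> sT v (fun y => dotv w y * f y) y =
  dotv w v * f y + dotv w y * sT v f y +
  \sum_(a <- Rp) k a * dotv a v * dotv a w * f (reflection a y).
Proof.
move=> smf yB; rewrite !sTE; try exact: sm_differentiable yB; last first.
  by apply: sm_differentiable yB; exact: sm_lin.
have dw : is_derive y v (dotv w) (dotv w v).
  by split; [apply: diff_derivable; exact: dotv_differentiable|exact: dotv_derive].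
have [_ ->] := is_deriveMl dw (isD v smf yB).
rewrite mulrDr -!addrA; congr (_ + (_ + _)).
rewrite mulr_sumr -big_split /=; apply: sum_roots => a a2.
by rewrite quot_lin//; ring.
Qed.

(** |y|^2 is invariant under reflections, so the ordinary Leibniz rule holds. *)
Lemma sT_sqnorm v f y : sm f -> inball y -> sT v (fun y => dotv y y * f y) y =
  2 * dotv v y * f y + dotv y y * sT v f y.
Proof.
move=> smf yB; rewrite !sTE; try exact: sm_differentiable yB; last first.
  by apply: sm_differentiable yB; exact: sm_sqnorm.
have dw : is_derive y v (fun y : E => dotv y y) (2 * dotv v y).
  by split; [apply: diff_derivable; exact: sqnorm_differentiable|exact: sqnorm_derive].
have [_ ->] := is_deriveMl dw (isD v smf yB).
rewrite mulrDr -!addrA; congr (_ + (_ + _)).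
rewrite mulr_sumr; apply: sum_roots => a a2.
by rewrite quot_sqnorm//; ring.
Qed.

Lemma sT_cst v c y : inball y -> sT v (fun=> c) y = 0.
Proof.
move=> yB; rewrite sTE; last exact: differentiable_cst.
rewrite derive_cst add0r (sum_roots (G := fun=> 0)) ?big1_eq// => a a2.
by rewrite (@quot_rad a a2 (fun=> c))// mulr0.
Qed.

Lemma sT_dir v w c f y : sT (c *: v + w) f y = c * sT v f y + sT w f y.
Proof.
by rewrite /sT mulr_sumr -big_split /=; apply: eq_bigr => j _; rewrite !mxE; ring.
Qed.

Lemma sT_sum (I : Type) (r : seq I) (P : pred I) (F : I -> E -> R) v y :
  (forall i, P i -> sm (F i)) -> inball y ->
  sT v (fun y => \sum_(i <- r | P i) F i y) y = \sum_(i <- r | P i) sT v (F i) y.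
Proof.
move=> smF yB; elim: r => [|i r IH].
  by under eq_fun do rewrite big_nil; rewrite big_nil sT_cst.
rewrite big_cons -IH; have [Pi|nPi] := boolP (P i).
  rewrite -(sT_add v (smF i Pi) (sm_sum r smF) yB).
  by congr (sT v _ y); apply/funext => z; rewrite big_cons Pi.
by congr (sT v _ y); apply/funext => z; rewrite big_cons (negPf nPi).
Qed.

End Dunkl.

(** * Equivariance and commutativity of Dunkl operators *)

Section DunklCommute.
Variables (R : realType) (m : nat) (rho : R).
Local Notation E := 'rV[R]_m.
Variables (Rs Rp : {fset E}) (k : E -> R).
Implicit Types (a b u v w x y z : E) (f g d : E -> R).
Local Notation sm := (sm rho).
Local Notation inball := (inball rho).
Local Notation Q a f := (reflection_quotient f a).
Local Notation T := (sT Rp k).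

Hypotheses (rs : root_system Rs) (ns : normalized Rs) (ps : positive_subsystem Rs Rp)
  (mk : multiplicity_function Rs k).

Lemma Rp_sub a : a \in Rp -> a \in Rs.
Proof. by have [h _ _] := ps; move=> ap; apply/h; left. Qed.

Lemma Rp_norm a : a \in Rp -> dotv a a = 2.
Proof. by move/Rp_sub; exact: ns. Qed.

Lemma roots_perm : perm_eq Rs (enum_fset Rp ++ map -%R (enum_fset Rp)).
Proof.
have [h1 h2 _] := ps.
have memN a : (a \in map -%R (enum_fset Rp)) = (- a \in Rp).
  apply/mapP/idP => [[b bR ->]|aR]; first by rewrite opprK.
  by exists (- a); rewrite ?opprK.
apply: uniq_perm; first exact: fset_uniq.
  rewrite cat_uniq fset_uniq (map_inj_uniq (@oppr_inj _)) fset_uniq andbT.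
  apply/hasPn => a; rewrite memN => Na; apply/negP => aR.
  by apply: (h2 a).
move=> a; rewrite mem_cat memN; apply/idP/orP => /h1 //.
Qed.

Lemma roots_reflection_perm b : b \in Rs -> perm_eq (map (reflection b) (enum_fset Rs)) Rs.
Proof.
have [_ _ h] := rs; move=> bR; have b2 := ns bR.
have inj : injective (reflection b) by move=> x y /(congr1 (reflection b)); rewrite !reflectionK.
apply: uniq_perm; rewrite ?fset_uniq ?map_inj_uniq ?fset_uniq// => a.
apply/mapP/idP => [[c cR ->]|aR].
  suff : reflection b c \in Rs by [].
  by rewrite -(h b bR); apply/imfsetP; exists c.
have : a \in [fset reflection b c | c in Rs]%fset by rewrite h.
by move=> /imfsetP[c /= cR ->]; exists c.
Qed.

Lemma mult_reflection a b : a \in Rs -> b \in Rs -> k (reflection b a) = k a.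
Proof.
move=> aR bR; apply: (mk (s := [:: b])) => // c; rewrite inE => /eqP ->//.
Qed.

Lemma mult_opp a : a \in Rs -> k (- a) = k a.
Proof. by move=> aR; rewrite -(reflection_self (ns aR)) mult_reflection. Qed.

(** [Rp] itself is not stable under reflections; but for even [G] its sum is half of the sum over
    [Rs], which the reflection permutes. *)
Lemma sum_reflection b (G : E -> R) : b \in Rs ->
  (forall a, a \in Rs -> G (- a) = G a) ->
  \sum_(a <- Rp) G (reflection b a) = \sum_(a <- Rp) G a.
Proof.
move=> bR Gev; have b2 := ns bR.
have half (H : E -> R) : (forall a, a \in Rs -> H (- a) = H a) ->
    \sum_(a <- Rs) H a = 2 * \sum_(a <- Rp) H a.
  move=> Hev; rewrite (perm_big _ roots_perm)/= big_cat big_map /= mulr2n mulrDl mul1r.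
  congr (_ + _); rewrite big_seq [RHS]big_seq; apply: eq_bigr => a /Rp_sub; exact: Hev.
have n2 : 2 != 0 :> R by rewrite pnatr_eq0.
apply: (mulfI n2); rewrite -(half (fun a => G (reflection b a))); last first.
  move=> a aR; rewrite -scaleN1r reflectionZ scaleN1r Gev//.
  by have := roots_reflection_perm bR => /perm_mem <-; apply: map_f.
by rewrite -half// -[RHS](perm_big _ (roots_reflection_perm bR)) /= big_map.
Qed.

Lemma sT_reflection b v f y : b \in Rs -> sm f -> inball y ->
  T v f (reflection b y) = T (reflection b v) (fun z => f (reflection b z)) y.
Proof.
move=> bR smf yB; have b2 := ns bR.
have byB : inball (reflection b y) by rewrite inball_reflection.
have smfb := sm_reflection b2 smf.
rewrite !sTE; [|exact: sm_differentiable smfb yB|exact: sm_differentiable smf byB].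
congr (_ + _).
  have dr : differentiable (reflection b) y by exact: reflection_differentiable.
  have df := sm_differentiable smf byB.
  have D : differentiable (f \o reflection b) y by exact: differentiable_comp.
  have cr : continuous (reflection b).
    by move=> z; apply: differentiable_continuous; exact: reflection_differentiable.
  by rewrite [RHS](deriveE _ D) diff_comp// /= (diff_lin _ cr) /= reflectionK// deriveE.
rewrite -(@sum_reflection b (fun a => k a * dotv a v * Q a f (reflection b y)))//; last first.
  move=> a aR; rewrite mult_opp// dotvNl (quot_opp (ns aR) smf)//; ring.
rewrite big_seq [RHS]big_seq; apply: eq_bigr => a aR.
have a2 := Rp_norm aR.
rewrite /= (mult_reflection (Rp_sub aR) bR) dotv_reflection//; congr (_ * _).
exact: (esym (quot_reflection a2 b2 smf yB)).
Qed.

Lemma sT_rad phi : smooth rho phi -> exists2 psi, smooth rho psi &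
  forall v y, inball y -> T v (fun z => phi (dotv z z)) y = dotv (2 *: v) y * psi (dotv y y).
Proof.
move=> [Phi [P0 dP]]; exists (Phi 1%N).
  by exists (fun i => Phi i.+1); split => // i x; exact: dP.
move=> v y yB; have y1 : `|dotv y y| < rho by rewrite ger0_norm// dotv_ge0.
have [df e] := rad_derive v (dP 0%N _ y1); rewrite P0 in df e.
rewrite sTE// e dotvZl big_seq big1 ?addr0// => a aR.
by rewrite (quot_rad (Rp_norm aR) phi yB) mulr0.
Qed.

(* By induction on the construction of [f], with the Jacobi identity for
   [[T_u, T_v], <w, .>] and [T_u, <w, .>] = <w, u> + sum k_a <a, u> <a, w> s_a. *)
Lemma sT_comm u v f y : sm f -> inball y -> T u (T v f) y = T v (T u f) y.
Proof.
move=> smf; elim: smf u v y => {f} [phi h|w f smf IH|f g smf IHf smg IHg|f g fg smf IH] u v y yB.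
- have [psi hpsi Tphi] := sT_rad h; have [chi hchi Tpsi] := sT_rad hpsi.
  have smphi := sm_rad m h; have smpsi := sm_rad m hpsi.
  have step u' v' : T u' (T v' (fun z => phi (dotv z z))) y =
     2 * dotv v' u' * psi (dotv y y) + 4 * dotv v' y * dotv u' y * chi (dotv y y) +
     \sum_(a <- Rp) k a * dotv a u' * dotv a v' * (2 * psi (dotv y y)).
    rewrite (sT_ext k Rp_norm u' (sT_sm k Rp_norm v' smphi) (Tphi v') yB).
    rewrite (sT_lin k Rp_norm _ _ smpsi yB) Tpsi// !dotvZl; congr (_ + _); first by ring.
    rewrite big_seq [RHS]big_seq; apply: eq_bigr => a aR.
    by rewrite (reflection_isometry (Rp_norm aR)) dotvZr; ring.
  rewrite !step (dotvC v u); congr (_ + _); first by ring.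
  by apply: eq_bigr => a _; ring.
- have smT x : sm (T x f) by exact: (sT_sm k Rp_norm _ smf).
  have smR e : e \in Rp -> sm (fun z => f (reflection e z)).
    by move=> eR; apply: sm_reflection smf; exact: Rp_norm.
  (* Equivariance moves the reflection inside the operator, T_v (f o s_a) - <a, v> T_a (f o s_a),
     and makes the sum over the roots symmetric in u' and v'. Only T_u' T_v' f is left to the
     induction hypothesis. *)
  have step u' v' : T u' (T v' (fun z => dotv w z * f z)) y =
     dotv w v' * T u' f y + dotv w u' * T v' f y + dotv w y * T u' (T v' f) y +
     \sum_(a <- Rp) k a * dotv a w * (dotv a u' * T v' (fun z => f (reflection a z)) y +
        dotv a v' * T u' (fun z => f (reflection a z)) y
        - dotv a u' * dotv a v' * T a (fun z => f (reflection a z)) y).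
    pose g z := dotv w v' * f z + dotv w z * T v' f z +
      \sum_(a <- Rp | a \in Rp) k a * dotv a v' * dotv a w * f (reflection a z).
    have sm1 : sm (fun z => dotv w v' * f z) by exact: sm_scale.
    have sm2 : sm (fun z => dotv w z * T v' f z) by exact: sm_lin.
    have smS a : a \in Rp -> sm (fun z => k a * dotv a v' * dotv a w * f (reflection a z)).
      by move=> aR; apply: sm_scale; exact: smR.
    have Tg z : inball z -> T v' (fun z => dotv w z * f z) z = g z.
      by move=> zB; rewrite (sT_lin k Rp_norm _ _ smf zB) /g; congr (_ + _); exact: big_seq.
    rewrite (sT_ext k Rp_norm u' (sT_sm k Rp_norm v' (sm_lin w smf)) Tg yB).
    have sm12 := sm_add sm1 sm2; have sm3 := sm_sum (enum_fset Rp) smS.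
    rewrite /g (sT_add k Rp_norm _ sm12 sm3 yB) (sT_add k Rp_norm _ sm1 sm2 yB).
    rewrite (sT_scale k Rp_norm _ _ smf yB) (sT_lin k Rp_norm _ _ (smT v') yB).
    rewrite (sT_sum k Rp_norm _ _ smS yB) -!addrA; congr (_ + (_ + (_ + _))).
    rewrite [X in X + _]big_seq -big_split /= [RHS]big_seq; apply: eq_bigr => a aR.
    rewrite (sT_scale k Rp_norm _ _ (smR a aR) yB) (sT_reflection _ (Rp_sub aR) smf yB).
    rewrite (reflection_root _ (Rp_norm aR)) [v' - _]addrC -scaleNr sT_dir.
    ring.
  rewrite !step IH//; congr (_ + _); first by ring.
  by apply: eq_bigr => a _; ring.
- have smT x h : sm h -> sm (T x h) by move=> smh; exact: (sT_sm k Rp_norm _ smh).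
  have step u' v' : T u' (T v' (fun z => f z + g z)) y = T u' (T v' f) y + T u' (T v' g) y.
    rewrite -(sT_add k Rp_norm _ (smT _ _ smf) (smT _ _ smg) yB).
    apply: (sT_ext k Rp_norm _ (smT _ _ (sm_add smf smg)) _ yB) => z zB.
    exact: (sT_add k Rp_norm _ smf smg zB).
  by rewrite !step IHf// IHg.
- have smT x : sm (T x f) by exact: (sT_sm k Rp_norm _ smf).
  have step u' v' : T u' (T v' g) y = T u' (T v' f) y.
    symmetry; apply: (sT_ext k Rp_norm _ (smT v') _ yB) => z zB.
    exact: (sT_ext k Rp_norm _ smf fg zB).
  by rewrite !step IH.
Qed.

End DunklCommute.

(** * Powers of a Dunkl operator as functions of the direction *)

Section DunklIterates.
Variables (R : realType) (m : nat) (rho : R).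
Local Notation E := 'rV[R]_m.
Variables (Rs Rp : {fset E}) (k : E -> R).
Implicit Types (a b u v w x y z : E) (f g d : E -> R).
Local Notation sm := (sm rho).
Local Notation inball := (inball rho).
Local Notation T := (sT Rp k).

Hypotheses (rs : root_system Rs) (ns : normalized Rs) (ps : positive_subsystem Rs Rp)
  (mk : multiplicity_function Rs k).

Let Rn := Rp_norm ns ps.

Lemma iter_sm n x f : sm f -> sm (iter n (T x) f).
Proof. exact: sT_iter_sm. Qed.

Lemma iter_sT_ext n x f g y : sm f -> (forall z, inball z -> f z = g z) -> inball y ->
  iter n (T x) f y = iter n (T x) g y.
Proof.
move=> smf fg; elim: n y => [|n IH] y yB; first exact: fg.
by rewrite !iterS; apply: (sT_ext k Rn _ (iter_sm n x smf) _ yB).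
Qed.

Lemma iter_sT_lin n x c f g y : sm f -> sm g -> inball y ->
  iter n (T x) (fun z => c * f z + g z) y = c * iter n (T x) f y + iter n (T x) g y.
Proof.
move=> smf smg; elim: n y => [//|n IH] y yB; rewrite !iterS.
have smn := iter_sm n x smf; have smn' := iter_sm n x smg.
rewrite (sT_ext k Rn _ (iter_sm n x (sm_add (sm_scale c smf) smg)) IH yB).
by rewrite (sT_add k Rn _ (sm_scale c smn) smn' yB) (sT_scale k Rn _ _ smn yB).
Qed.

Lemma iter_sT_cst0 n x y : inball y -> iter n (T x) (fun=> 0) y = 0.
Proof.
elim: n y => [//|n IH] y yB; rewrite iterS.
by rewrite (sT_ext k Rn _ (iter_sm n x (sm_cst m rho 0)) IH yB) (sT_cst k Rn _ _ yB).
Qed.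

Lemma iter_sT_sum n x (I : Type) (r : seq I) (c : I -> R) (F : I -> E -> R) y :
  (forall i, sm (F i)) -> inball y ->
  iter n (T x) (fun z => \sum_(i <- r) c i * F i z) y = \sum_(i <- r) c i * iter n (T x) (F i) y.
Proof.
move=> smF yB; elim: r => [|i r IH].
  by under eq_fun do rewrite big_nil; rewrite big_nil iter_sT_cst0.
rewrite big_cons -IH -(iter_sT_lin n x (c i) (smF i) (sm_sum r (fun j _ => sm_scale (c j) (smF j))) yB).
by congr (iter n _ _ y); apply/funext => z; rewrite big_cons.
Qed.

Lemma iter_sT_poly n x v f y : sm f -> inball y ->
  exists2 p : {poly R}, (size p <= n.+1)%N &
    forall t, iter n (T (x + t *: v)) f y = p.[t].
Proof.
move=> smf yB; elim: n f smf => [|n IH] f smf.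
  by exists (f y)%:P => [|t]; rewrite ?hornerC// size_polyC leq_b1.
have [p1 s1 h1] := IH _ (sT_sm k Rn v smf); have [p2 s2 h2] := IH _ (sT_sm k Rn x smf).
exists (p1 * 'X + p2) => [|t].
  apply: leq_trans (size_polyD _ _) _; rewrite geq_max (leq_trans s2)// andbT.
  have [->|p0] := eqVneq p1 0; first by rewrite mul0r size_poly0.
  by rewrite size_mulX.
have E z : T (x + t *: v) f z = t * T v f z + T x f z by rewrite addrC sT_dir.
rewrite iterSr (_ : T (x + t *: v) f = fun z => t * T v f z + T x f z); last exact/funext.
rewrite (iter_sT_lin _ _ _ (sT_sm k Rn v smf) (sT_sm k Rn x smf) yB) h1 h2.
by rewrite hornerD hornerMX mulrC.
Qed.

Lemma sT_coords x f z : T x f z = \sum_(j < m) x ord0 j * T (unitv R j) f z.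
Proof.
rewrite {1}/sT; apply: eq_bigr => j _; congr (_ * _).
rewrite /sT (bigD1 j)//= mxE !eqxx mul1r big1 ?addr0// => i /negPf ij.
by rewrite mxE eqxx ij mul0r.
Qed.

Lemma iter_sT_coords n u x f y : sm f -> inball y ->
  iter n (T x) (T u f) y = \sum_(j < m) u ord0 j * iter n (T x) (T (unitv R j) f) y.
Proof.
move=> smf yB; rewrite -(iter_sT_sum n x _ _ (fun j => sT_sm k Rn (unitv R j) smf) yB).
by congr (iter n _ _ y); apply/funext => z; exact: sT_coords.
Qed.

(** The Leibniz rule for the n-th power of T_x = sum x_j T_j; commutativity collects the n
    contributions into one. *)
Lemma iter_sT_derive n f y : sm f -> inball y -> forall x,
  differentiable (fun x => iter n (T x) f y) x /\
  forall v, 'D_v (fun x => iter n (T x) f y) x = n%:R * iter n.-1 (T x) (T v f) y.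
Proof.
move=> smf yB; elim: n f smf => [|n IH] f smf x.
  split; first exact: differentiable_cst.
  by move=> v; rewrite derive_cst mul0r.
pose F j x := iter n (T x) (T (unitv R j) f) y.
have E : (fun x => iter n.+1 (T x) f y) = \sum_(j < m) (fun x => dotv (unitv R j) x * F j x).
  apply/funext => z; rewrite fct_sumE iterSr iter_sT_coords//.
  by apply: eq_bigr => j _; rewrite dotvC dotv_delta.
have smj j : sm (T (unitv R j) f) by exact: (sT_sm k Rn _ smf).
have dF j := IH _ (smj j) x.
split.
  rewrite E; apply: differentiable_sum => j; apply: differentiableM.
    exact: dotv_differentiable.
  by have [] := dF j.
move=> v; rewrite E derive_sum; last first.
  move=> j; apply: diff_derivable; apply: differentiableM; first exact: dotv_differentiable.
  by have [] := dF j.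
have dj j : 'D_v (fun x => dotv (unitv R j) x * F j x) x =
   v ord0 j * F j x + x ord0 j * (n%:R * iter n.-1 (T x) (T v (T (unitv R j) f)) y).
  have [d1 d2] := dF j.
  have h1 : is_derive x v (dotv (unitv R j)) (v ord0 j).
    split; first by apply: diff_derivable; exact: dotv_differentiable.
    by rewrite dotv_derive dotvC dotv_delta.
  have h2 : is_derive x v (F j) (n%:R * iter n.-1 (T x) (T v (T (unitv R j) f)) y).
    by split => //; exact: diff_derivable.
  by have [_ ->] := is_deriveMl h1 h2; rewrite dotvC dotv_delta.
under eq_bigr do rewrite dj.
rewrite big_split /= -iter_sT_coords// -[n.+1%:R]natr1 mulrDl mul1r addrC; congr (_ + _).
case: n {IH F E dF dj} => [|n]; first by rewrite mul0r big1// => j _; rewrite mul0r mulr0.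
under eq_bigr do rewrite mulrCA.
rewrite -mulr_sumr; congr (_ * _); rewrite iterSr /=.
have smv := sT_sm k Rn v smf.
rewrite iter_sT_coords//; apply: eq_bigr => j _; congr (_ * _).
apply: iter_sT_ext => //; first exact: (sT_sm k Rn v (smj j)).
by move=> z zB; exact: (sT_comm rs ns ps mk v _ smf zB).
Qed.

End DunklIterates.

Section CauchySchwarz.
Variables (R : realType) (m : nat).
Implicit Types (u v : 'rV[R]_m).

Lemma enorm_ge0 u : 0 <= enorm u. Proof. exact: sqrtr_ge0. Qed.

Lemma enorm_sqr u : enorm u ^+ 2 = dotv u u.
Proof. by rewrite sqr_sqrtr// dotv_ge0. Qed.

Lemma dotv_eq0 u : dotv u u = 0 -> u = 0.
Proof.
move=> /eqP; rewrite psumr_eq0; last by move=> i _; rewrite -expr2 sqr_ge0.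
move=> /allP h; apply/rowP => j; rewrite mxE.
by have := h j (mem_index_enum _); rewrite /= -expr2 sqrf_eq0 => /eqP.
Qed.

Lemma enorm_eq0 u : enorm u = 0 -> u = 0.
Proof. by move=> h; apply: dotv_eq0; rewrite -enorm_sqr h expr0n. Qed.

(** The squared norm of |v|^2 u - <u, v> v is |v|^2 (|u|^2 |v|^2 - <u, v>^2). *)
Lemma dotv_le u v : `|dotv u v| <= enorm u * enorm v.
Proof.
have [->|v0] := eqVneq v 0; first by rewrite dotv0 normr0 mulr_ge0// enorm_ge0.
have vv : 0 < dotv v v.
  by rewrite lt_def dotv_ge0 andbT; apply/eqP => /dotv_eq0 /eqP; rewrite (negPf v0).
rewrite -ler_sqr ?nnegrE ?mulr_ge0 ?enorm_ge0// exprMn !enorm_sqr real_normK ?num_real//.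
have := dotv_ge0 (dotv v v *: u - dotv u v *: v).
rewrite !(dotvDr, dotvDl, dotvNr, dotvNl, dotvZr, dotvZl) (dotvC v u) => h.
rewrite -(ler_pM2l vv) -subr_ge0; apply: le_trans h _; rewrite le_eqVlt; apply/orP; left.
by apply/eqP; ring.
Qed.

Lemma enormZ c u : enorm (c *: u) = `|c| * enorm u.
Proof. by rewrite /enorm dotvZr dotvZl mulrA -expr2 sqrtrM ?sqr_ge0// sqrtr_sqr. Qed.

End CauchySchwarz.

(** * Homogeneous polynomials and order of vanishing *)

Section Homogeneous.
Variables (R : realType) (m : nat) (rho : R).
Local Notation E := 'rV[R]_m.
Variables (Rs Rp : {fset E}) (k : E -> R).
Implicit Types (a b u v w x y z : E) (f g d : E -> R).
Local Notation sm := (sm rho).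
Local Notation inball := (inball rho).
Local Notation T := (sT Rp k).

Hypotheses (rho0 : 0 < rho).
Hypotheses (rs : root_system Rs) (ns : normalized Rs) (ps : positive_subsystem Rs Rp)
  (mk : multiplicity_function Rs k).

Let Rn := Rp_norm ns ps.

(* [homog n C f]: f is a homogeneous polynomial of degree n that is a sum of
   products of linear forms, with C bounding the sum of the products of their
   norms; unlike a coefficient norm, C is invariant under reflections. *)
Inductive homog : nat -> R -> (E -> R) -> Prop :=
| hom_zero n : homog n 0 (fun=> 0)
| hom_cst c : homog 0 `|c| (fun=> c)
| hom_lin n C w f : homog n C f -> homog n.+1 (enorm w * C) (fun y => dotv w y * f y)
| hom_add n C C' f g : homog n C f -> homog n C' g -> homog n (C + C') (fun y => f y + g y)
| hom_le n C C' f : C <= C' -> homog n C f -> homog n C' f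
| hom_ext n C f g : (forall y, inball y -> f y = g y) -> homog n C f -> homog n C g.

Lemma hom_sm n C f : homog n C f -> sm f.
Proof.
elim=> {n C f} [n|c|n C w f _ IH|n C C' f g _ IHf _ IHg|n C C' f _ _ IH|n C f g fg _ IH] //.
- exact: sm_cst.
- exact: sm_cst.
- exact: sm_lin.
- exact: sm_add.
- exact: sm_ext IH.
Qed.

Lemma hom_ge0 n C f : homog n C f -> 0 <= C.
Proof.
elim=> {n C f} // [n C w f _ IH|n C C' f g _ IHf _ IHg|n C C' f CC _ IH].
- by rewrite mulr_ge0// enorm_ge0.
- exact: addr_ge0.
- exact: le_trans CC.
Qed.

Lemma inball0 : inball (0 : E). Proof. by change (dotv (0 : E) 0 < rho); rewrite dotv0. Qed.

Lemma hom_at0 n C f : homog n C f -> if n is 0%N then is_true (`|f 0| <= C) else f 0 = 0.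
Proof.
elim=> {n C f} [n|c|n C w f _ IH|n C C' f g _ IHf _ IHg|n C C' f CC _ IH|n C f g fg _ IH] //.
- by case: n => //; rewrite normr0.
- by rewrite dotv0 mul0r.
- case: n IHf IHg => [h1 h2|n -> ->]; last by rewrite addr0.
  by apply: le_trans (ler_normD _ _) _; exact: lerD.
- by case: n IH => // h; exact: le_trans CC.
- by case: n IH; rewrite fg ?inball0.
Qed.

Lemma hom0_cst n C f : homog n C f -> n = 0%N -> exists c, forall y, inball y -> f y = c.
Proof.
elim=> {n C f} [n|c|n C w f _ IH|n C C' f g _ IHf _ IHg|n C C' f CC _ IH|n C f g fg _ IH] //.
- by exists 0.
- by exists c.
- move=> n0; have [c hc] := IHf n0; have [c' hc'] := IHg n0.
  by exists (c + c') => y yB; rewrite hc// hc'.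
- by move=> /IH[c hc]; exists c => y yB; rewrite -fg// hc.
Qed.

Lemma hom_scale n C c f : homog n C f -> homog n (`|c| * C) (fun y => c * f y).
Proof.
elim=> {n C f} [n|c'|n C w f _ IH|n C C' f g _ IHf _ IHg|n C C' f CC _ IH|n C f g fg _ IH].
- by rewrite mulr0; apply: hom_ext (hom_zero n) => y _; rewrite mulr0.
- by rewrite -normrM; exact: hom_cst.
- by rewrite mulrCA; apply: hom_ext (hom_lin w IH) => y _; rewrite mulrCA.
- by rewrite mulrDr; apply: hom_ext (hom_add IHf IHg) => y _; rewrite mulrDr.
- by apply: hom_le IH; rewrite ler_wpM2l.
- by apply: hom_ext IH => y yB; rewrite fg.
Qed.

Lemma hom_sum (I : Type) (r : seq I) (P : pred I) n (C : I -> R) (F : I -> E -> R) :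
  (forall i, P i -> homog n (C i) (F i)) ->
  homog n (\sum_(i <- r | P i) C i) (fun y => \sum_(i <- r | P i) F i y).
Proof.
move=> h; elim: r => [|i r IH].
  by rewrite big_nil; apply: hom_ext (hom_zero n) => y _; rewrite big_nil.
rewrite big_cons; have [Pi|nPi] := boolP (P i).
  by apply: hom_ext (hom_add (h i Pi) IH) => y _; rewrite big_cons Pi.
by apply: hom_ext IH => y _; rewrite big_cons (negPf nPi).
Qed.

Lemma hom_reflection a n C f : dotv a a = 2 -> homog n C f -> homog n C (fun y => f (reflection a y)).
Proof.
move=> a2.
elim=> {n C f} [n|c'|n C w f _ IH|n C C' f g _ IHf _ IHg|n C C' f CC _ IH|n C f g fg _ IH].
- exact: hom_zero.
- exact: hom_cst.
- have -> : enorm w = enorm (reflection a w) by rewrite /enorm reflection_isometry.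
  by apply: hom_ext (hom_lin (reflection a w) IH) => y _; rewrite dotv_reflection.
- exact: hom_add.
- exact: hom_le IH.
- by apply: hom_ext IH => y yB; rewrite fg// inball_reflection.
Qed.

(** 1 accounts for the derivative; the root a contributes |k a| |a|^2 = 2 |k a| by the
    Cauchy-Schwarz inequality. *)
Definition dunkl_const : R := 1 + \sum_(a <- Rp) 2 * `|k a|.

Lemma dunkl_const_ge1 : 1 <= dunkl_const.
Proof. by rewrite lerDl sumr_ge0// => a _; rewrite mulr_ge0. Qed.

(** A new linear factor adds one commutator, of size at most |w| |v| C [dunkl_const], which raises
    the factor from n to n + 1. In degree 0 the bound is 0. *)
Lemma hom_sT v n C f : homog n C f -> homog n.-1 (n%:R * C * dunkl_const * enorm v) (T v f).
Proof.
have K0 : 0 <= dunkl_const by apply: le_trans dunkl_const_ge1.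
elim=> {n C f} [n|c|n C w f hf IH|n C C' f g hf IHf hg IHg|n C C' f CC hf IH|n C f g fg hf IH].
- rewrite mulr0 !mul0r; apply: hom_ext (hom_zero _) => y yB.
  by rewrite (sT_cst k Rn _ _ yB).
- rewrite !mul0r; apply: hom_ext (hom_zero _) => y yB.
  by rewrite (sT_cst k Rn _ _ yB).
- have smf := hom_sm hf; have C0 := hom_ge0 hf.
  have h2 : homog n (enorm w * (n%:R * C * dunkl_const * enorm v)) (fun y => dotv w y * T v f y).
    (* For n = 0 the truncated degree [n.-1] would give <w, .> T_v f degree 1 instead of 0; there
       T_v f vanishes. *)
    case: n hf IH => [|n] hf IH; last exact: hom_lin.
    have [c hc] := hom0_cst hf erefl.
    rewrite !mul0r mulr0; apply: hom_ext (hom_zero 0) => y yB.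
    by rewrite (sT_ext k Rn v smf hc yB) (sT_cst k Rn _ _ yB) mulr0.
  have h1 := hom_scale (dotv w v) hf.
  have h3 := @hom_sum _ (enum_fset Rp) (mem Rp) n _ _
     (fun a aR => hom_scale (k a * dotv a v * dotv a w) (hom_reflection (Rn aR) hf)).
  apply: hom_ext (hom_le _ (hom_add (hom_add h1 h2) h3)).
    by move=> y yB; rewrite (sT_lin k Rn _ _ smf yB); congr (_ + _); exact/esym/big_seq.
  have ra a : a \in Rp -> enorm a ^+ 2 = 2 by move=> aR; rewrite enorm_sqr Rn.
  have S : \sum_(a <- Rp | a \in Rp) `|k a * dotv a v * dotv a w| * C <=
     enorm w * enorm v * C * \sum_(a <- Rp) 2 * `|k a|.
    rewrite mulr_sumr [leRHS]big_seq; apply: ler_sum => a aR.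
    rewrite !normrM mulrAC.
    apply: (@le_trans _ _ (`|k a| * (enorm a * enorm v) * C * (enorm a * enorm w))).
      apply: ler_pM; rewrite ?mulr_ge0 ?dotv_le//.
      by rewrite ler_wpM2r// ler_wpM2l// dotv_le.
    rewrite le_eqVlt; apply/orP; left; apply/eqP; rewrite -(ra a aR); ring.
  have D : `|dotv w v| * C <= enorm w * enorm v * C by rewrite ler_wpM2r// dotv_le.
  apply: le_trans (lerD (lerD D (lexx _)) S) _.
  rewrite le_eqVlt; apply/orP; left; apply/eqP; rewrite /dunkl_const -natr1; ring.
- have smf := hom_sm hf; have smg := hom_sm hg.
  have -> : n%:R * (C + C') * dunkl_const * enorm v =
      n%:R * C * dunkl_const * enorm v + n%:R * C' * dunkl_const * enorm v by ring.
  apply: hom_ext (hom_add IHf IHg) => y yB.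
  by rewrite (sT_add k Rn _ smf smg yB).
- apply: hom_le IH; do 2 (apply: ler_wpM2r; rewrite ?enorm_ge0//).
  by rewrite ler_wpM2l.
- apply: hom_ext IH => y yB; exact: (sT_ext k Rn v (hom_sm hf) fg yB).
Qed.

Lemma hom_iter_sT x n j C f : homog (n + j) C f ->
  homog j ((n + j)`!%:R / j`!%:R * C * (dunkl_const * enorm x) ^+ n) (iter n (T x) f).
Proof.
elim: n j => [|n IH] j.
  by rewrite add0n expr0 mulr1 divff ?mul1r// pnatr_eq0 -lt0n fact_gt0.
rewrite addSnnS => /IH /(hom_sT x) /=; apply: hom_le.
have nz i : i`!%:R != 0 :> R by rewrite pnatr_eq0 -lt0n fact_gt0.
rewrite le_eqVlt; apply/orP; left; apply/eqP; rewrite [j.+1`!]factS natrM exprS.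
by field; rewrite nz ?natr1 ?nat1r pnatr_eq0.
Qed.

Lemma hom_iter_bound x n C f : homog n C f ->
  `|iter n (T x) f 0| <= n`!%:R * C * (dunkl_const * enorm x) ^+ n.
Proof.
rewrite -{1}(addn0 n) => /(@hom_iter_sT x) /hom_at0.
by rewrite addn0 fact0 divr1.
Qed.

(** For n < j a form of positive degree is evaluated at 0; for n > j the first j operators leave a
    constant, killed by the next one. *)
Lemma hom_iter_neq x n j C f : homog j C f -> n != j -> iter n (T x) f 0 = 0.
Proof.
move=> hf; rewrite neq_ltn => /orP[nj|jn].
  move: hf; rewrite -(subnKC nj) addSnnS => /(@hom_iter_sT x) /hom_at0 //.
have hj : homog 0 (j`!%:R * C * (dunkl_const * enorm x) ^+ j) (iter j (T x) f).
  by move: hf; rewrite -{1}(addn0 j) => /(@hom_iter_sT x); rewrite addn0 fact0 divr1.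
have [c hc] := hom0_cst hj erefl.
rewrite -(subnK jn) addnS -addSn iterD.
have smj := hom_sm hj.
rewrite (iter_sT_ext k ns ps _ _ smj hc inball0) iterSr.
rewrite (iter_sT_ext k ns ps _ _ (sT_sm k Rn x (sm_cst m rho c)) (g := fun=> 0) _ inball0).
  by rewrite (iter_sT_cst0 k ns ps _ _ inball0).
by move=> z zB; rewrite (sT_cst k Rn _ _ zB).
Qed.

(** Vanishing at 0 to order 2L, in the exact form that the Leibniz rule for |y|^2 handles. Below,
    each operator is charged a whole factor |y|^2; this is wasteful but harmless, since L is
    arbitrary. *)
Definition van L f := exists2 g, sm g & forall y, inball y -> f y = dotv y y ^+ L * g y.

Lemma van_sm L f : van L f -> sm f.
Proof. by move=> [g smg e]; apply: sm_ext (sm_sqnormX L smg) => y /e. Qed.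

Lemma van_sT x L f : van L.+1 f -> van L (T x f).
Proof.
elim: L f => [|L IH] f [g smg e].
  exists (T x f) => [|y _]; last by rewrite expr0 mul1r.
  by apply: (sT_sm k Rn); apply: (van_sm (L := 1)); exists g.
pose h y := dotv y y ^+ L.+1 * g y.
have smh : sm h by exact: sm_sqnormX.
have [g' smg' e'] : van L (T x h) by apply: IH; exists g.
exists (fun y => dotv (2 *: x) y * g y + g' y).
  by apply: sm_add => //; exact: sm_lin.
move=> y yB.
have fe z : inball z -> f z = dotv z z * h z by move=> zB; rewrite e// /h exprS mulrA.
rewrite -(sT_ext k Rn x (sm_sqnorm smh) (fun z zB => esym (fe z zB)) yB).
rewrite (sT_sqnorm k Rn _ smh yB) e'// /h dotvZl !exprS; ring.
Qed.

Lemma van_iter x L n f : van (n + L) f -> van L (iter n (T x) f).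
Proof. by elim: n L => // n IH L; rewrite addSnnS => /IH /(van_sT x). Qed.

Lemma van_iter_at0 x n f : van n.+1 f -> iter n (T x) f 0 = 0.
Proof.
rewrite -addn1 => /(van_iter x)[g _ ->]; last exact: inball0.
by rewrite dotv0 expr1 mul0r.
Qed.

End Homogeneous.

(** * Clifford-valued functions *)

Section CliffordCoordinates.
Variables (R : realType) (m : nat).
Local Notation E := 'rV[R]_m.
Local Notation Cl := (clifford R m).
Implicit Types (a b c : Cl) (A B : {set 'I_m}).

Lemma clcoef_le_norm a A : `|clcoef a A| <= `|a|.
Proof.
by rewrite [leRHS]/Num.Def.normr /= mx_normrE; exact: (le_bigmax _ _ (ord0, enum_rank A)).
Qed.

Lemma clnorm_le a e : 0 <= e -> (forall A, `|clcoef a A| <= e) -> `|a| <= e.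
Proof.
move=> e0 h; rewrite [leLHS]/Num.Def.normr /= mx_normrE; apply/bigmax_leP; split => // -[i j] _ /=.
by have := h (enum_val j); rewrite /clcoef enum_valK (ord1 i).
Qed.

Definition clproj A a : R := clcoef a A.

Lemma clproj_linear A : linear (clproj A).
Proof. by move=> k a b; rewrite /clproj clcoefD clcoefZ. Qed.

HB.instance Definition _ A := GRing.isLinear.Build R Cl R *:%R (clproj A) (clproj_linear A).

Lemma clcoef_sum (I : Type) (r : seq I) (P : pred I) (F : I -> Cl) A :
  clcoef (\sum_(i <- r | P i) F i) A = \sum_(i <- r | P i) clcoef (F i) A.
Proof. exact: (raddf_sum (clproj A)). Qed.

Lemma clcoefB a b A : clcoef (a - b) A = clcoef a A - clcoef b A.
Proof. exact: (raddfB (clproj A)). Qed.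

Lemma clcoef0 A : clcoef (0 : Cl) A = 0.
Proof. exact: (raddf0 (clproj A)). Qed.

Lemma blade_sum a : a = \sum_A clcoef a A *: blade R A.
Proof.
apply: clP => B; rewrite clcoef_sum (bigD1 B)//= clcoefZ clmakeE eqxx mulr1.
rewrite big1 ?addr0// => A /negPf AB; rewrite clcoefZ clmakeE eq_sym AB mulr0 //.
Qed.

Lemma clcoef_mull c a A : clcoef (c * a) A = \sum_B clcoef (c * blade R B) A * clcoef a B.
Proof.
rewrite {1}(blade_sum a) mulr_sumr clcoef_sum; apply: eq_bigr => B _.
by rewrite -scalerAr clcoefZ mulrC.
Qed.

Lemma clcoef_mulr c a A : clcoef (a * c) A = \sum_B clcoef (blade R B * c) A * clcoef a B.
Proof.
rewrite {1}(blade_sum a) mulr_suml clcoef_sum; apply: eq_bigr => B _.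
by rewrite -scalerAl clcoefZ mulrC.
Qed.

Lemma clcoef_continuous A : continuous (fun a : Cl => clcoef a A).
Proof. by move=> a; exact: coord_continuous. Qed.

Lemma clifford_cvg (T : Type) (F : set_system T) (FF : Filter F) (g : T -> Cl) (l : Cl) :
  (forall A, clcoef (g t) A @[t --> F] --> clcoef l A) -> g t @[t --> F] --> l.
Proof.
move=> h; apply/cvgrPdist_le => e e0.
have : \forall t \near F, forall A, `|clcoef l A - clcoef (g t) A| <= e.
  by apply: filter_forall => A; have /cvgrPdist_le/(_ e e0) := h A.
apply: filterS => t ht; apply: clnorm_le; first exact: ltW.
by move=> A; rewrite clcoefB.
Qed.

Section Derivative.
Variables (V : normedModType R) (f : V -> Cl) (x : V).

Let fsum : f = \sum_(i < #|{set 'I_m}|) (fun y => clcoef (f y) (enum_val i) *: blade R (enum_val i)).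
Proof.
apply/funext => y; rewrite fct_sumE {1}(blade_sum (f y)).
by rewrite (reindex (@enum_val {set 'I_m} predT))//=; exists enum_rank => A _;
   rewrite ?enum_valK ?enum_rankK.
Qed.

Lemma clifford_differentiable :
  (forall A, differentiable (fun y => clcoef (f y) A) x) -> differentiable f x.
Proof.
by move=> df; rewrite fsum; apply: differentiable_sum => i; exact: differentiableZl.
Qed.

Lemma clifford_derive v : (forall A, derivable (fun y => clcoef (f y) A) x v) ->
  derivable f x v /\ forall A, clcoef ('D_v f x) A = 'D_v (fun y => clcoef (f y) A) x.
Proof.
move=> df.
have D : derivable (f : V -> 'M[R]_(1, #|{set 'I_m}|)) x v.
  apply/derivable_mxP => i j; rewrite (ord1 i).
  by have := df (enum_val j); rewrite /clcoef enum_valK.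
split => // A; rewrite /clcoef.
have -> : 'D_v f x = 'D_v (f : V -> 'M[R]_(1, #|{set 'I_m}|)) x by [].
by rewrite derive_mx// mxE.
Qed.

End Derivative.

Lemma clvecE (y : E) A : clcoef (clvec y) A = dotv (\row_j clcoef (@clgen R m j) A) y.
Proof.
by rewrite /clvec clcoef_sum; apply: eq_bigr => j _; rewrite clcoefZ mxE mulrC.
Qed.

Lemma clvecZ k (y : E) : clvec (k *: y) = k *: clvec y :> Cl.
Proof. by apply: clP => A; rewrite clcoefZ !clvecE dotvZr. Qed.

(** Adding the double sum to its transpose makes the off-diagonal terms cancel by anticommutation;
    hence the detour through twice the square. *)
Lemma clvec_sqr (y : E) : clvec y * clvec y = - (dotv y y)%:A :> Cl.
Proof.
have two (a : Cl) : a + a = 0 -> a = 0.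
  move=> h; apply: clP => A; have := congr1 (clproj A) h.
  by rewrite /clproj clcoefD clcoef0 => ?; lra.
have sq : clvec y * clvec y = \sum_(i < m) \sum_(j < m) (y ord0 i * y ord0 j) *: (clgen i * clgen j) :> Cl.
  rewrite /clvec mulr_suml; apply: eq_bigr => i _; rewrite mulr_sumr; apply: eq_bigr => j _.
  by rewrite -scalerAl -scalerAr scalerA.
have sq' : clvec y * clvec y = \sum_(i < m) \sum_(j < m) (y ord0 i * y ord0 j) *: (clgen j * clgen i) :> Cl.
  rewrite sq exchange_big /=; apply: eq_bigr => i _; apply: eq_bigr => j _.
  by rewrite [y ord0 j * _]mulrC.
have H : clvec y * clvec y + clvec y * clvec y = - ((dotv y y)%:A + (dotv y y)%:A) :> Cl.
  rewrite {1}sq sq' -big_split /=.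
  transitivity (\sum_(i < m) (- (2 * (y ord0 i * y ord0 i))) *: (1 : Cl)).
    apply: eq_bigr => i _; rewrite -big_split /= (bigD1 i)//= clgen_sqr -scalerDr big1 ?addr0.
      by rewrite -opprD scalerN scaleNr -mulr2n -scaler_nat scalerA mulrC.
    by move=> j ji; rewrite -scalerDr clgen_anticomm 1?eq_sym// addNr scaler0.
  rewrite -scaler_suml sumrN -mulr_sumr -/(dotv y y) scaleNr -scalerDl; congr (- (_ *: _)).
  by ring.
by apply/eqP; rewrite -subr_eq0 opprK; apply/eqP/two; rewrite addrACA H addNr.
Qed.

End CliffordCoordinates.

Section CliffordDunkl.
Variables (R : realType) (m : nat) (rho : R).
Local Notation E := 'rV[R]_m.
Local Notation Cl := (clifford R m).
Variables (Rs Rp : {fset E}) (k : E -> R).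
Implicit Types (a b u v w x y z : E) (f g : E -> Cl) (c : Cl) (A B : {set 'I_m}).
Local Notation sm := (sm rho).
Local Notation inball := (inball rho).
Local Notation homog := (homog rho).
Local Notation T := (sT Rp k).

Hypotheses (rho0 : 0 < rho).
Hypotheses (rs : root_system Rs) (ns : normalized Rs) (ps : positive_subsystem Rs Rp)
  (mk : multiplicity_function Rs k).

Let Rn := Rp_norm ns ps.

Definition clsm f := forall A, sm (fun y => clcoef (f y) A).

(** The limit on the hyperplane is taken in the Clifford algebra; it may be read coordinatewise
    because every coordinate is known to converge. *)
Lemma quotient_clcoef f a y A : dotv a a = 2 -> clsm f -> inball y ->
  clcoef (reflection_quotient f a y) A = reflection_quotient (fun z => clcoef (f z) A) a y.
Proof.
move=> a2 smf yB.
have qE z : inball z -> dotv a z != 0 ->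
    (dotv a z)^-1 *: (f z - f (reflection a z)) =
    clmake (fun B => reflection_quotient (fun z => clcoef (f z) B) a z).
  move=> zB az; apply: clP => B; rewrite clmakeE clcoefZ clcoefB.
  by rewrite (quot_eq a2 (smf B) zB) mulKf.
rewrite {1}/reflection_quotient; case: ifPn => [_|ay]; last by rewrite qE// clmakeE.
set F := within _ _.
have FP : ProperFilter F.
  apply: Build_ProperFilter_ex => // P; rewrite /F /within /= => nP.
  by have [z [Pz az]] := root_dir_dense a2 nP; exists z; exact: Pz.
have cd : (clmake (fun B => reflection_quotient (fun z => clcoef (f z) B) a z) : Cl) @[z --> F]
    --> (clmake (fun B => reflection_quotient (fun z => clcoef (f z) B) a y) : Cl).
  apply: clifford_cvg => B; rewrite clmakeE; under eq_fun do rewrite clmakeE.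
  apply: cvg_trans (sm_continuous (quot_sm a2 (smf B)) yB).
  exact: cvg_fmap2 (@cvg_within _ _ _ _).
suff -> : lim ((dotv a z)^-1 *: (f z - f (reflection a z)) @[z --> F]) =
    (clmake (fun B => reflection_quotient (fun z => clcoef (f z) B) a y) : Cl).
  by rewrite clmakeE.
apply/cvg_lim => //; apply: cvg_trans cd; apply: near_eq_cvg; rewrite /F !near_withinE.
by have := inball_nbhs yB; apply: filterS => z zB az; rewrite qE.
Qed.

Lemma dunkl_along_clcoef v f y A : clsm f -> inball y ->
  clcoef (dunkl_along Rp k v f y) A = T v (fun z => clcoef (f z) A) y.
Proof.
move=> smf yB; rewrite /dunkl_along clcoef_sum; apply: eq_bigr => j _.
rewrite clcoefZ; congr (_ * _); rewrite /dunkl clcoefD; congr (_ + _).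
  have [] // := @clifford_derive R m _ f y (unitv R j).
  by move=> B; apply: diff_derivable; exact: sm_differentiable (smf B) yB.
rewrite clcoef_sum big_seq [RHS]big_seq; apply: eq_bigr => a aR.
by rewrite clcoefZ (quotient_clcoef _ (Rn aR) smf yB).
Qed.

(** The iterated operator built from scalar ones. It agrees with iterates of [dunkl_along] on the
    ball, but needs no vector-valued limits. *)
Definition clT n x f y : Cl := clmake (fun A => iter n (T x) (fun z => clcoef (f z) A) y).

Lemma clTE n x f y A : clcoef (clT n x f y) A = iter n (T x) (fun z => clcoef (f z) A) y.
Proof. exact: clmakeE. Qed.

Lemma iter_dunkl_along n x f y : clsm f -> inball y ->
  iter n (dunkl_along Rp k x) f y = clT n x f y.
Proof.
move=> smf; elim: n y => [|n IH] y yB; apply: clP => A; rewrite clmakeE// !iterS.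
have eqA B z : inball z -> iter n (T x) (fun z => clcoef (f z) B) z =
    clcoef (iter n (dunkl_along Rp k x) f z) B.
  by move=> zB; rewrite IH// clmakeE.
have smA B : sm (iter n (T x) (fun z => clcoef (f z) B)) by exact: (iter_sm k ns ps).
rewrite dunkl_along_clcoef//; last by move=> B; exact: sm_ext (eqA B) (smA B).
by rewrite (sT_ext k Rn _ (smA A) (eqA A) yB).
Qed.

Lemma clT_ext n x f g y : clsm f -> (forall z, inball z -> f z = g z) -> inball y ->
  clT n x f y = clT n x g y.
Proof.
move=> smf fg yB; apply: clP => A; rewrite !clmakeE.
by apply: (iter_sT_ext k ns ps _ _ (smf A) _ yB) => z zB; rewrite fg.
Qed.

Lemma clsm_sum (I : Type) (r : seq I) (F : I -> E -> Cl) : (forall i, clsm (F i)) ->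
  clsm (fun z => \sum_(i <- r) F i z).
Proof.
move=> h A; apply: (@sm_ext _ _ _ (fun z => \sum_(i <- r) clcoef (F i z) A)).
  by move=> y _; rewrite clcoef_sum.
by apply: sm_sum => i _; exact: h.
Qed.

Lemma clsmD f g : clsm f -> clsm g -> clsm (fun z => f z + g z).
Proof.
by move=> hf hg A; apply: sm_ext (sm_add (hf A) (hg A)) => y _; rewrite clcoefD.
Qed.

Lemma clsm_mull c f : clsm f -> clsm (fun z => c * f z).
Proof.
move=> h A; apply: (@sm_ext _ _ _ (fun z => \sum_B clcoef (c * blade R B) A * clcoef (f z) B)).
  by move=> y _; rewrite [RHS]clcoef_mull.
by apply: sm_sum => B _; apply: sm_scale; exact: h.
Qed.

Lemma clsm_mulr c f : clsm f -> clsm (fun z => f z * c).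
Proof.
move=> h A; apply: (@sm_ext _ _ _ (fun z => \sum_B clcoef (blade R B * c) A * clcoef (f z) B)).
  by move=> y _; rewrite [RHS]clcoef_mulr.
by apply: sm_sum => B _; apply: sm_scale; exact: h.
Qed.

Lemma clT_sum n x (I : Type) (r : seq I) (F : I -> E -> Cl) y : (forall i, clsm (F i)) -> inball y ->
  clT n x (fun z => \sum_(i <- r) F i z) y = \sum_(i <- r) clT n x (F i) y.
Proof.
move=> smF yB; apply: clP => A; rewrite clmakeE clcoef_sum.
under [RHS]eq_bigr do rewrite clTE -[iter _ _ _ _]mul1r.
rewrite -(iter_sT_sum k ns ps n x r (fun=> 1) (fun i => smF i A) yB).
by congr (iter n _ _ y); apply/funext => z; rewrite clcoef_sum; apply: eq_bigr => i _; rewrite mul1r.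
Qed.

Lemma clT_add n x f g y : clsm f -> clsm g -> inball y ->
  clT n x (fun z => f z + g z) y = clT n x f y + clT n x g y.
Proof.
move=> smf smg yB; apply: clP => A; rewrite clcoefD !clTE.
rewrite -[X in X + _]mul1r -(iter_sT_lin k ns ps n x 1 (smf A) (smg A) yB).
by congr (iter n _ _ y); apply/funext => z; rewrite clcoefD mul1r.
Qed.

Lemma clT_mull n x c f y : clsm f -> inball y ->
  clT n x (fun z => c * f z) y = c * clT n x f y.
Proof.
move=> smf yB; apply: clP => A; rewrite clTE clcoef_mull.
under [RHS]eq_bigr do rewrite clTE.
have /= <- := iter_sT_sum k ns ps n x (index_enum _) (fun B => clcoef (c * blade R B) A)
  (F := fun B y => clcoef (f y) B) smf yB.
by congr (iter n _ _ y); apply/funext => z; rewrite clcoef_mull.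
Qed.

Lemma clT_mulr n x c f y : clsm f -> inball y ->
  clT n x (fun z => f z * c) y = clT n x f y * c.
Proof.
move=> smf yB; apply: clP => A; rewrite clTE clcoef_mulr.
under [RHS]eq_bigr do rewrite clTE.
have /= <- := iter_sT_sum k ns ps n x (index_enum _) (fun B => clcoef (blade R B * c) A)
  (F := fun B y => clcoef (f y) B) smf yB.
by congr (iter n _ _ y); apply/funext => z; rewrite clcoef_mulr.
Qed.

Lemma clT_sm n x f : clsm f -> clsm (clT n x f).
Proof.
move=> smf A; apply: sm_ext (iter_sm k ns ps n x (smf A)) => y _.
by rewrite clmakeE.
Qed.

Lemma clvec_sqrX l (y : E) : clvec y ^+ l.*2 = ((-1) ^+ l * dotv y y ^+ l)%:A :> Cl.
Proof.
rewrite -muln2 mulnC exprM expr2 clvec_sqr -exprMn mulN1r -scaleNr.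
elim: l => [|l IH]; first by rewrite !expr0 scale1r.
by rewrite !exprS IH -scalerAl mul1r scalerA.
Qed.

Lemma clvec_sm : clsm (@clvec R m).
Proof.
move=> A; apply: (@sm_ext _ _ _ (fun y => dotv (\row_j clcoef (@clgen R m j) A) y * 1)).
  by move=> y _; rewrite mulr1 clvecE.
by apply: sm_lin; exact: sm_cst.
Qed.

Lemma clvecX_even_coef l (y : E) A :
  clcoef (clvec y ^+ l.*2) A = dotv y y ^+ l * ((-1) ^+ l * clcoef (1 : Cl) A).
Proof. by rewrite clvec_sqrX clcoefZ mulrCA mulrA. Qed.

Lemma clvecX_odd_coef l (y : E) A :
  clcoef (clvec y ^+ l.*2.+1) A = dotv y y ^+ l * ((-1) ^+ l * clcoef (clvec y) A).
Proof. by rewrite exprS clvec_sqrX -scalerAr mulr1 clcoefZ mulrCA mulrA. Qed.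

Lemma clvecX_sm n : clsm (fun y => clvec y ^+ n).
Proof.
move=> A; rewrite -[n]odd_double_half; case: (odd n) => /=.
  rewrite add1n; apply: sm_ext (sm_sqnormX n./2 (sm_scale ((-1) ^+ n./2) (clvec_sm A))) => y _.
  by rewrite clvecX_odd_coef.
rewrite add0n; apply: sm_ext (sm_sqnormX n./2 (sm_cst m rho ((-1) ^+ n./2 * clcoef (1 : Cl) A))) => y _.
by rewrite clvecX_even_coef.
Qed.

Lemma sT_sqnormX v L (g : E -> R) y : sm g -> inball y ->
  T v (fun z => dotv z z ^+ L * g z) y =
  L%:R * 2 * dotv v y * dotv y y ^+ L.-1 * g y + dotv y y ^+ L * T v g y.
Proof.
move=> smg yB; elim: L => [|L IH].
  rewrite expr0 !mul0r add0r mul1r.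
  by apply: esym; apply: (sT_ext k Rn _ smg) => // z _; rewrite expr0 mul1r.
pose h z := dotv z z ^+ L * g z; have smh : sm h by exact: sm_sqnormX.
have e z : inball z -> dotv z z * h z = dotv z z ^+ L.+1 * g z.
  by rewrite /h mulrA exprS.
rewrite -(sT_ext k Rn v (sm_sqnorm smh) e yB) (sT_sqnorm k Rn _ smh yB) IH /h.
rewrite -natr1; case: L {IH h smh e} => [|L] /=; first by rewrite !expr0 !expr1; ring.
by rewrite !exprS; ring.
Qed.

(* [gamma = (1 - m) / 2] makes the Dunkl dimension m + 2 gamma equal to 1, so that
   the Dunkl-Dirac operator acts on the powers of y as -d/dy on those of one
   variable. *)
Lemma dirac_clvecX n y : gamma Rp k = (1 - m%:R) / 2 -> inball y ->
  \sum_(j < m) clgen j * clT 1 (unitv R j) (fun z => clvec z ^+ n) y =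
  - (n%:R : R) *: clvec y ^+ n.-1.
Proof.
move=> gk yB.
have sum_clgen : \sum_(j < m) y ord0 j *: clgen j = clvec y :> Cl by [].
rewrite -[n]odd_double_half; set l := n./2; case: (odd n) => /=; last first.
  rewrite add0n.
  (* Even powers are radial, so reflections contribute nothing. *)
  have E j : clT 1 (unitv R j) (fun z => clvec z ^+ l.*2) y =
      ((-1) ^+ l * (l%:R * 2 * y ord0 j * dotv y y ^+ l.-1)) *: (1 : Cl).
    apply: clP => A; rewrite clTE clcoefZ /=.
    under eq_fun do rewrite clvecX_even_coef.
    rewrite (sT_sqnormX _ _ (sm_cst m rho ((-1) ^+ l * clcoef (1 : Cl) A)) yB).
    by rewrite (sT_cst k Rn _ _ yB) mulr0 addr0 dotvC dotv_delta; ring.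
  transitivity (((-1) ^+ l * (l%:R * 2 * dotv y y ^+ l.-1)) *: (clvec y : Cl)).
    rewrite -sum_clgen scaler_sumr; apply: eq_bigr => j _.
    by rewrite E -scalerAr mulr1 scalerA; congr (_ *: _); ring.
  case: (l) => [|l']; first by rewrite !mul0r mulr0 !scale0r oppr0 scale0r.
  rewrite doubleS -[l'.*2.+2.-1]/(l'.*2.+1) [clvec y ^+ _]exprS clvec_sqrX -[clvec y * _]scalerAr mulr1 scalerA.
  congr (_ *: _); rewrite -mul2n -!natr1 natrM /= exprS; ring.
rewrite add1n.
have E v : clT 1 v (fun z => clvec z ^+ l.*2.+1) y =
    ((-1) ^+ l * (l%:R * 2 * dotv v y * dotv y y ^+ l.-1)) *: clvec y +
    ((-1) ^+ l * dotv y y ^+ l) *: (clvec v + \sum_(a <- Rp) (k a * dotv a v) *: clvec a).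
  apply: clP => A; rewrite clTE clcoefD !clcoefZ clcoefD [clcoef (\sum_(a <- Rp) _) A]clcoef_sum /=.
  under eq_fun do rewrite clvecX_odd_coef.
  rewrite (sT_sqnormX _ _ (sm_scale ((-1) ^+ l) (clvec_sm A)) yB).
  rewrite (sT_scale k Rn _ _ (clvec_sm A) yB).
  have -> : T v (fun z => clcoef (clvec z) A) y =
     clcoef (clvec v) A + \sum_(a <- Rp) clcoef ((k a * dotv a v) *: clvec a) A.
    set w := \row_j clcoef (@clgen R m j) A.
    have e z : inball z -> dotv w z * 1 = clcoef (clvec z) A by rewrite mulr1 clvecE.
    rewrite -(sT_ext k Rn v (sm_lin w (sm_cst m rho 1)) e yB).
    rewrite (sT_lin k Rn _ _ (sm_cst m rho 1) yB) (sT_cst k Rn _ _ yB) mulr0 addr0 mulr1.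
    rewrite clvecE; congr (_ + _); apply: eq_bigr => a _.
    by rewrite clcoefZ clvecE mulr1 [dotv a w]dotvC.
  by ring.
have clA (c1 c2 : R) (X Y Z : Cl) : X * (c1 *: Y + c2 *: Z) = c1 *: (X * Y) + c2 *: (X * Z).
  by rewrite mulrDr -!(clscaleAr _ X).
under eq_bigr do rewrite E clA.
rewrite big_split /= -scaler_sumr.
(* The Dirac operator applied to y itself: - m from the derivatives and - 2 gamma from the roots,
   whose squares are - 2. *)
have S1 : \sum_(j < m) clgen j * (clvec (unitv R j) + \sum_(a <- Rp) (k a * dotv a (unitv R j)) *: clvec a)
   = -1 :> Cl.
  under eq_bigr do rewrite mulrDr.
  rewrite big_split /=.
  have -> : \sum_(j < m) clgen j * clvec (unitv R j) = - (m%:R)%:A :> Cl.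
    have -> : (m%:R : R) = \sum_(j < m) 1 by rewrite sumr_const card_ord.
    rewrite -scaleNr -sumrN scaler_suml; apply: eq_bigr => j _.
    rewrite scaleN1r -(@clgen_sqr R m j); congr (_ * _); rewrite /clvec (bigD1 j)//= mxE !eqxx scale1r.
    by rewrite big1 ?addr0// => i /negPf ij; rewrite mxE eqxx ij scale0r.
  under eq_bigr do rewrite mulr_sumr.
  rewrite exchange_big /=.
  have -> : \sum_(a <- Rp) \sum_(j < m) clgen j * ((k a * dotv a (unitv R j)) *: clvec a) =
     - (2 * gamma Rp k)%:A :> Cl.
    rewrite -scaleNr /gamma mulr_sumr -sumrN scaler_suml big_seq [RHS]big_seq.
    apply: eq_bigr => a aR.
    transitivity (k a *: (clvec a * clvec a) : Cl).
      rewrite {2}/clvec mulr_suml scaler_sumr; apply: eq_bigr => j _.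
      by rewrite dotv_delta -scalerAr -scalerAl scalerA.
    by rewrite clvec_sqr Rn// scalerN scalerA scaleNr mulrC.
  rewrite gk -opprD -scalerDl.
  have -> : m%:R + 2 * ((1 - m%:R) / 2) = 1 :> R by field.
  by rewrite scale1r.
rewrite S1.
have -> : \sum_(i < m) ((-1) ^+ l * (l%:R * 2 * dotv (unitv R i) y * dotv y y ^+ l.-1)) *:
    (clgen i * clvec y) = ((-1) ^+ l * (l%:R * 2 * dotv y y ^+ l.-1)) *: (clvec y * clvec y) :> Cl.
  rewrite -{2}sum_clgen mulr_suml scaler_sumr; apply: eq_bigr => j _.
  by rewrite -clscaleAl scalerA dotvC dotv_delta; congr (_ *: _); ring.
rewrite clvec_sqr clvec_sqrX !scalerN !scalerA.
rewrite -!scaleNr -scalerDl; congr (_ *: _).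
rewrite /GRing.scale /= -[l.*2.+1%:R]natr1 -mul2n natrM.
by case: (l) => [|l'] /=; [rewrite !expr0; ring|rewrite !exprS; ring].
Qed.

End CliffordDunkl.

(** * The terms of the exponential series *)

Section SliceExpansion.
Variables (R : realType) (m : nat).
Local Notation E := 'rV[R]_m.
Local Notation Cl := (clifford R m).
Implicit Types (c : Cl) (A B : {set 'I_m}) (s t r : R).

Lemma finite_lower_bound (I : finType) (F : I -> R) : (forall i, 0 < F i) ->
  exists2 r, 0 < r & forall i, r <= F i.
Proof.
move=> F0; have S0 : 0 < 1 + \sum_i (F i)^-1.
  by rewrite ltr_pwDl// sumr_ge0// => i _; rewrite invr_ge0 ltW.
exists (1 + \sum_i (F i)^-1)^-1; first by rewrite invr_gt0.
move=> i; rewrite -[leRHS]invrK lef_pV2 ?posrE ?invr_gt0//.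
rewrite (bigD1 i)//= addrCA lerDl addr_ge0// sumr_ge0// => j _.
by rewrite invr_ge0 ltW.
Qed.

Lemma finite_upper_bound (I : finType) (F : I -> R) : (forall i, 0 < F i) ->
  exists2 r, 0 < r & forall i, F i <= r.
Proof.
move=> F0; exists (1 + \sum_i F i); first by rewrite ltr_pwDl// sumr_ge0// => i _; exact: ltW.
by move=> i; rewrite (bigD1 i)//= addrCA lerDl addr_ge0// sumr_ge0// => j _; exact: ltW.
Qed.

Lemma stem_cr_pair D (alpha beta : R * R -> Cl) A : holomorphic_stem D alpha beta ->
  cr_pair D (fun z => clcoef (alpha z) A) (fun z => clcoef (beta z) A).
Proof.
move=> h z /h[da db e1 e2].
have cp : continuous (@clproj R m A) by move=> c; exact: (@clcoef_continuous R m A c).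
have dp c : differentiable (clproj A) c by exact: linear_differentiable.
have H (g : R * R -> Cl) v : differentiable g z ->
    differentiable (fun z => clcoef (g z) A) z /\
    'D_v (fun z => clcoef (g z) A) z = clcoef ('D_v g z) A.
  move=> dg; have D1 : differentiable (clproj A \o g) z by exact: differentiable_comp.
  by split => //; rewrite (deriveE _ D1) diff_comp// /= (diff_lin _ cp) (deriveE _ dg).
have [a1 a2] := H _ (1, 0) da; have [_ a3] := H _ (0, 1) da.
have [b1 b2] := H _ (1, 0) db; have [_ b3] := H _ (0, 1) db.
split; [exact: a1|exact: b1|exact: (etrans a2 (etrans (congr1 (clproj A) e1) (esym b3)))|].
apply: (etrans a3); apply: (etrans _ (congr1 -%R (esym b2))).
by rewrite e2 -[RHS]mulN1r -clcoefZ scaleN1r.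
Qed.

Lemma psum_shiftn (rho x : R) (c : nat -> R) L : radius_ge rho c -> `|x| < rho ->
  radius_ge rho (fun n => c (n + L)%N) /\
  psum c x = \sum_(l < L) c l * x ^+ l + x ^+ L * psum (fun n => c (n + L)%N) x.
Proof.
move=> h xr; elim: L => [|L [IH1 IH2]].
  rewrite big_ord0 expr0 add0r mul1r.
  by have -> : (fun n => c (n + 0)%N) = c by apply/funext => n; rewrite addn0.
have E : (fun n => c (n + L.+1)%N) = (fun n => c (n.+1 + L)%N).
  by apply/funext => n; rewrite addSnnS.
split.
  rewrite E => q qr; have [C hC] := IH1 q qr.
  have q0 : 0 <= q by case/andP: qr.
  have [->|q1] := eqVneq q 0.
    exists `|c (1 + L)%N| => n; case: n => [|n]; first by rewrite expr0 mulr1.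
    by rewrite expr0n mulr0.
  have qp : 0 < q by rewrite lt_def q1.
  by exists (C / q) => n; rewrite ler_pdivlMr// -mulrA -exprSr.
rewrite IH2 (psum_shift IH1 xr) big_ord_recr /= -addrA add0n E; congr (_ + _).
by rewrite mulrDr exprSr; ring.
Qed.

(** The n-th Taylor coefficient of the stem function at a real point. Its imaginary part is absent
    because beta and its real derivatives vanish on the axis. *)
Definition stem_coef (alpha : R * R -> Cl) n s : Cl :=
  clmake (fun A => axis_coef (fun z => clcoef (alpha z) A) n s).

Lemma stem_coef_derive D (alpha beta : R * R -> Cl) A n s :
  open D -> holomorphic_stem D alpha beta -> D (s, 0) ->
  is_derive s 1 (fun s => clcoef (stem_coef alpha n s) A)
    (n.+1%:R * clcoef (stem_coef alpha n.+1 s) A).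
Proof.
move=> oD h Ds; rewrite clmakeE; under eq_fun do rewrite clmakeE.
exact: axis_coef_derive oD (stem_cr_pair A h) Ds.
Qed.

(** alpha is a power series in |y|^2, and beta is |y| times another one, so that (y / |y|) beta is y
    times a radial function. Cutting both series after L terms leaves a remainder |y|^(2L) g with g
    in the class, to which Dunkl operators apply. *)
Lemma slice_expansion (D : set (R * R)) (f : R * E -> Cl) (alpha beta : R * R -> Cl) s0 :
  (0 < m)%N -> open D -> stem_function D alpha beta -> holomorphic_stem D alpha beta ->
  (forall x, axial_domain D x -> f x = alpha (x.1, enorm x.2)
     + clvec ((enorm x.2)^-1 *: x.2) * beta (x.1, enorm x.2)) -> D (s0, 0) ->
  exists r rho C K, [/\ 0 < r, 0 < rho, 0 < C, 0 < K & forall s, `|s - s0| < r ->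
    [/\ D (s, 0), forall n, `|stem_coef alpha n s| <= C * K ^+ n &
      forall L, exists2 g, clsm rho g & forall y, inball rho y -> f (s, y) =
        \sum_(j < L.*2) clvec y ^+ j * stem_coef alpha j s + dotv y y ^+ L *: g y]].
Proof.
move=> m0 oD sf hol fE Ds0.
have b0 s : D (s, 0) -> beta (s, 0) = 0.
  move=> Ds; have [_] := sf _ Ds; rewrite /conjp /= oppr0 => h.
  apply: clP => A; have := congr1 (clproj A) h.
  rewrite /clproj -[in RHS]scaleN1r clcoefZ clcoef0 mulN1r => ?; lra.
pose u A (z : R * R) := clcoef (alpha z) A; pose v A (z : R * R) := clcoef (beta z) A.
have uv A : cr_pair D (u A) (v A) := stem_cr_pair A hol.
have v0 A s : D (s, 0) -> v A (s, 0) = 0 by move=> /b0 e; rewrite /v e clcoef0.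
(* The triple holds r, C and K for one coordinate; finiteness of the set of coordinates then
   provides common constants. *)
pose good A (p : R * R * R) := [/\ 0 < p.1.1, 0 < p.1.2, 0 < p.2 & forall s, `|s - s0| < p.1.1 ->
    [/\ D (s, 0), forall n, `|axis_coef (u A) n s| <= p.1.2 * p.2 ^+ n &
      forall t, 0 <= t < p.1.1 -> D (s, t) /\ forall L,
        `|u A (s, t) - \sum_(l < L) (-1) ^+ l * axis_coef (u A) l.*2 s * t ^+ l.*2|
           <= p.1.2 * (p.2 * t) ^+ L.*2 /\
        `|v A (s, t) - \sum_(l < L) (-1) ^+ l * axis_coef (u A) l.*2.+1 s * t ^+ l.*2.+1|
           <= p.1.2 * (p.2 * t) ^+ L.*2]].
have exg A : exists p, good A p.
  have [r [C [K [? ? ? ?]]]] := stem_expansion oD (uv A) (v0 A) Ds0.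
  by exists (r, C, K).
have [p hp] := choice exg.
have [r r0 hr] : exists2 r, 0 < r & forall A, r <= (p A).1.1.
  by apply: finite_lower_bound => A; case: (hp A).
have [C C0 hC] : exists2 r, 0 < r & forall A, (p A).1.2 <= r.
  by apply: finite_upper_bound => A; case: (hp A).
have [K K0 hK] : exists2 r, 0 < r & forall A, (p A).2 <= r.
  by apply: finite_upper_bound => A; case: (hp A).
pose t0 := Num.min r K^-1.
have t00 : 0 < t0 by rewrite lt_min r0 invr_gt0.
have t0r : t0 <= r by rewrite ge_min lexx.
have t0K : t0 * K <= 1 by rewrite -ler_pdivlMr// div1r ge_min lexx orbT.
(* |y| < t0 <= 1 / K stays within the disc of convergence; the square appears because [inball]
   bounds |y|^2. *)
pose rho := t0 ^+ 2.
exists r, rho, C, K; split => //; first by rewrite exprn_gt0.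
move=> s ss.
have gA A : [/\ D (s, 0), forall n, `|axis_coef (u A) n s| <= C * K ^+ n &
      forall t, 0 <= t < r -> D (s, t) /\ forall L,
        `|u A (s, t) - \sum_(l < L) (-1) ^+ l * axis_coef (u A) l.*2 s * t ^+ l.*2|
           <= C * (K * t) ^+ L.*2 /\
        `|v A (s, t) - \sum_(l < L) (-1) ^+ l * axis_coef (u A) l.*2.+1 s * t ^+ l.*2.+1|
           <= C * (K * t) ^+ L.*2].
  have [rA CA KA h] := hp A; have [Ds hn ht] := h s (lt_le_trans ss (hr A)).
  split => //.
    move=> n; apply: le_trans (hn n) _; apply: ler_pM => //; try exact: ltW.
    - by rewrite exprn_ge0// ltW.
    - by rewrite lerXn2r// nnegrE ltW.
  move=> t /andP[tp tr]; have [|Dst hL] := ht t; first by rewrite tp (lt_le_trans tr).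
  have bd L : (p A).1.2 * ((p A).2 * t) ^+ L.*2 <= C * (K * t) ^+ L.*2.
    apply: ler_pM => //; try exact: ltW.
    - by rewrite exprn_ge0// mulr_ge0// ltW.
    - by rewrite lerXn2r ?nnegrE ?mulr_ge0 ?(ltW K0) ?(ltW KA)// ler_wpM2r.
  by split => // L; have [h1 h2] := hL L; split; apply: le_trans (bd L).
split; first by case: (gA finset.set0).
  move=> n; apply: clnorm_le; first by rewrite mulr_ge0 ?exprn_ge0// ltW.
  by move=> A; rewrite clmakeE; case: (gA A).
pose c0 A l := (-1) ^+ l * axis_coef (u A) l.*2 s.
pose c1 A l := (-1) ^+ l * axis_coef (u A) l.*2.+1 s.
have K20 : 0 < K ^+ 2 by rewrite exprn_gt0.
have rhoK : rho * K ^+ 2 <= 1.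
  by rewrite /rho -exprMn exprn_ile1// mulr_ge0// ltW.
have rad0 A : radius_ge rho (c0 A).
  apply: (radius_geP K20 (C := C)) rhoK => l.
  by rewrite /c0 normrM normrX normrN1 expr1n mul1r -exprM mul2n; case: (gA A).
have rad1 A : radius_ge rho (c1 A).
  apply: (radius_geP K20 (C := C * K)) rhoK => l.
  rewrite /c1 normrM normrX normrN1 expr1n mul1r -exprM mul2n -mulrA -exprS.
  by case: (gA A).
have inb (y : E) : inball rho y -> 0 <= enorm y < t0 /\ enorm y ^+ 2 = dotv y y.
  move=> yB; rewrite enorm_ge0 enorm_sqr; split => //=.
  by rewrite -ltr_sqr ?nnegrE ?enorm_ge0 ?(ltW t00)// enorm_sqr.
have qt t : 0 <= t < t0 -> 0 <= (K * t) ^+ 2 < 1.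
  move=> /andP[tp tt]; rewrite sqr_ge0 /= -(expr1n _ 2) ltr_sqr ?nnegrE ?mulr_ge0 ?(ltW K0)//.
  by apply: lt_le_trans t0K; rewrite mulrC ltr_pM2r.
have tr t : 0 <= t < t0 -> 0 <= t < r by move=> /andP[-> /= h]; exact: lt_le_trans t0r.
have U A t : 0 <= t < t0 -> u A (s, t) = psum (c0 A) (t ^+ 2).
  move=> tt; apply: esym; apply: (psum_cvg (C := C) (qt t tt)) => L.
  have [_ _ /(_ t (tr t tt))[_ /(_ L)[h _]]] := gA A.
  rewrite -exprM mul2n; apply: le_trans h; rewrite le_eqVlt; apply/orP; left; apply/eqP.
  by congr (`|_ - _|); apply: eq_bigr => l _; rewrite -exprM mul2n.
have V A t : 0 <= t < t0 -> v A (s, t) = t * psum (c1 A) (t ^+ 2).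
  move=> tt; have [->|tn] := eqVneq t 0; first by rewrite mul0r v0//; case: (gA A).
  have tp : 0 < t by rewrite lt_def tn; case/andP: tt.
  suff -> : psum (c1 A) (t ^+ 2) = v A (s, t) / t by rewrite mulrC divfK.
  apply: (psum_cvg (C := C / t) (qt t tt)) => L.
  have [_ _ /(_ t (tr t tt))[_ /(_ L)[_ h]]] := gA A.
  rewrite -exprM mul2n mulrAC ler_pdivlMr// -[X in _ * X <= _](gtr0_norm tp) -normrM mulrBl divfK//.
  apply: le_trans h; rewrite le_eqVlt; apply/orP; left; apply/eqP; congr (`|_ - _|).
  by rewrite mulr_suml; apply: eq_bigr => l _; rewrite -exprM mul2n exprSr mulrA.
move=> L.
pose G0 (y : E) : Cl := clmake (fun A => psum (fun n => c0 A (n + L)%N) (dotv y y)).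
pose G1 (y : E) : Cl := clmake (fun A => psum (fun n => c1 A (n + L)%N) (dotv y y)).
have t00' : `|0 : R| < rho by rewrite normr0 exprn_gt0.
have smG0 : clsm rho G0.
  move=> A; apply: (@sm_ext _ _ _ (fun y : E => psum (fun n => c0 A (n + L)%N) (dotv y y))).
    by move=> y _; rewrite clmakeE.
  by apply: sm_rad; apply: psum_smooth; case: (psum_shiftn L (rad0 A) t00').
have smG1 : clsm rho G1.
  move=> A; apply: (@sm_ext _ _ _ (fun y : E => psum (fun n => c1 A (n + L)%N) (dotv y y))).
    by move=> y _; rewrite clmakeE.
  by apply: sm_rad; apply: psum_smooth; case: (psum_shiftn L (rad1 A) t00').
exists (fun y => G0 y + clvec y * G1 y).
  apply: clsmD => //; move=> A.
  apply: (@sm_ext _ _ _ (fun y : E => \sum_(j < m) dotv (unitv R j) y * clcoef (clgen j * G1 y) A)).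
    move=> y _; rewrite /clvec mulr_suml clcoef_sum; apply: eq_bigr => j _.
    by rewrite -clscaleAl clcoefZ dotvC dotv_delta.
  by apply: sm_sum => j _; apply: sm_lin; exact: clsm_mull.
move=> y yB; have [yt y2] := inb y yB.
have yr : `|dotv y y| < rho by rewrite ger0_norm ?dotv_ge0.
(* At y = 0 any unit vector serves as direction, and one exists because m > 0. *)
have ax : axial_domain D (s, y).
  have [_ _ /(_ _ (tr _ yt))[Dy _]] := gA finset.set0.
  have [y0|yn0] := eqVneq y 0.
    exists s, 0, (unitv R (Ordinal m0)); rewrite scale0r y0; split => //.
      by case: (gA finset.set0).
    by rewrite /enorm dotv_delta mxE !eqxx sqrtr1.
  have en0 : enorm y != 0 by apply/eqP => /enorm_eq0 /eqP; rewrite (negPf yn0).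
  exists s, (enorm y), ((enorm y)^-1 *: y); split => //.
    by rewrite enormZ ger0_norm ?invr_ge0 ?enorm_ge0// mulVf.
  by rewrite scalerA divff// scale1r.
pose H0 : Cl := clmake (fun A => psum (c0 A) (dotv y y)).
pose H1 : Cl := clmake (fun A => psum (c1 A) (dotv y y)).
have e0 : alpha (s, enorm y) = H0.
  by apply: clP => A; rewrite clmakeE -y2 -U.
have e1 : beta (s, enorm y) = enorm y *: H1.
  by apply: clP => A; rewrite clcoefZ clmakeE -y2 -V.
rewrite (fE _ ax) /= e0 e1.
have -> : clvec ((enorm y)^-1 *: y) * (enorm y *: H1) = clvec y * H1.
  have [y0|yn0] := eqVneq y 0.
    have -> : clvec y = 0 :> Cl by apply: clP => A; rewrite clvecE y0 dotv0 clcoef0.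
    have -> : clvec ((enorm y)^-1 *: y) = 0 :> Cl.
      by apply: clP => A; rewrite clvecE y0 scaler0 dotv0 clcoef0.
    by rewrite !mul0r.
  have en0 : enorm y != 0 by apply/eqP => /enorm_eq0 /eqP; rewrite (negPf yn0).
  by rewrite clvecZ -clscaleAl -clscaleAr scalerA mulVf// scale1r.
have E0 : H0 = \sum_(l < L) clvec y ^+ l.*2 * stem_coef alpha l.*2 s + dotv y y ^+ L *: G0 y.
  apply: clP => A; rewrite clcoefD clcoefZ !clmakeE clcoef_sum.
  have [_ ->] := psum_shiftn L (rad0 A) yr; congr (_ + _); apply: eq_bigr => l _.
  by rewrite clvec_sqrX -clscaleAl mul1r clcoefZ clmakeE /c0; ring.
have E1 : clvec y * H1 = \sum_(l < L) clvec y ^+ l.*2.+1 * stem_coef alpha l.*2.+1 s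
     + dotv y y ^+ L *: (clvec y * G1 y).
  have -> : H1 = \sum_(l < L) ((-1) ^+ l * dotv y y ^+ l) *: stem_coef alpha l.*2.+1 s + dotv y y ^+ L *: G1 y.
    apply: clP => A; rewrite clcoefD clcoefZ !clmakeE clcoef_sum.
    have [_ ->] := psum_shiftn L (rad1 A) yr; congr (_ + _); apply: eq_bigr => l _.
    by rewrite clcoefZ clmakeE /c1; ring.
  rewrite mulrDr mulr_sumr -clscaleAr; congr (_ + _); apply: eq_bigr => l _.
  by rewrite exprSr clvec_sqrX -clscaleAl mul1r -clscaleAl -clscaleAr.
rewrite E0 E1 scalerDr addrACA; congr (_ + _).
by rewrite (sum_double (fun j => clvec y ^+ j * stem_coef alpha j s)) big_split.
Qed.

End SliceExpansion.

(** * Images of the powers of y and terms of the exponential series *)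

Section IntertwinedPowers.
Variables (R : realType) (m : nat).
Local Notation E := 'rV[R]_m.
Local Notation Cl := (clifford R m).
Variables (Rs Rp : {fset E}) (k : E -> R).
Implicit Types (x y z v w : E) (c : Cl) (A B : {set 'I_m}) (s t r : R).
Local Notation T := (sT Rp k).

Hypotheses (rs : root_system Rs) (ns : normalized Rs) (ps : positive_subsystem Rs Rp)
  (mk : multiplicity_function Rs k).

Let Rn := Rp_norm ns ps.

Lemma hom_sqnormX l n C rho (f : E -> R) : homog rho n C f ->
  homog rho (l.*2 + n) (m%:R ^+ l * C) (fun y => dotv y y ^+ l * f y).
Proof.
move=> hf; elim: l => [|l IH].
  by rewrite expr0 mul1r; apply: hom_ext hf => y _; rewrite expr0 mul1r.
rewrite doubleS !addSn exprS -mulrA.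
have h := @hom_sum _ _ rho 'I_m (index_enum _) xpredT _ _ _
  (fun j _ => hom_lin (unitv R j) (hom_lin (unitv R j) IH)).
apply: hom_ext (hom_le _ h).
  move=> y _; rewrite exprS -mulrA; move: (_ * f y) => X.
  rewrite [in RHS]/dotv mulr_suml; apply: eq_bigr => j _.
  by rewrite dotvC dotv_delta mulrA.
have e1 j : enorm (unitv R j : E) = 1 by rewrite /enorm dotv_delta mxE !eqxx sqrtr1.
under eq_bigr do rewrite e1 !mul1r.
by rewrite sumr_const card_ord mulr_natl.
Qed.

(** y^(2l) is a multiple of |y|^(2l), and |y|^2 is a sum of m squares of unit linear forms; m^l is
    bounded by (m + 1)^n, whose base is at least 1 even for m = 0. *)
Lemma clvecX_hom : exists C M : R, [/\ 0 < C, 0 < M & forall rho n A,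
  homog rho n (C * M ^+ n) (fun y => clcoef (clvec y ^+ n) A)].
Proof.
pose w A : E := \row_j clcoef (@clgen R m j) A.
pose C := 1 + `|1 : Cl| + \sum_A enorm (w A).
have S0 : 0 <= \sum_A enorm (w A) by apply: sumr_ge0 => A _; exact: enorm_ge0.
have C1 : 1 <= C by rewrite /C -addrA lerDl addr_ge0.
have C0 : 0 < C by apply: lt_le_trans C1.
have M1 : 1 <= m%:R + 1 :> R by rewrite lerDr.
exists C, (m%:R + 1); split => //.
have Mb l n : (l <= n)%N -> m%:R ^+ l <= (m%:R + 1) ^+ n :> R.
  move=> ln; apply: (@le_trans _ _ ((m%:R + 1) ^+ l)); first by rewrite lerXn2r ?nnegrE// lerDl.
  by rewrite ler_weXn2l.
move=> rho n A; rewrite -[n]odd_double_half; set l := n./2; case: (odd n) => /=; last first.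
  rewrite add0n; have h := hom_sqnormX l (hom_cst m rho ((-1) ^+ l * clcoef (1 : Cl) A)).
  rewrite addn0 in h; apply: hom_ext (hom_le _ h).
    by move=> y _; rewrite clvecX_even_coef.
  rewrite mulrC; apply: ler_pM => //.
    rewrite normrM normrX normrN1 expr1n mul1r; apply: le_trans (clcoef_le_norm _ _) _.
    by rewrite /C -addrA addrCA lerDl addr_ge0.
  by apply: Mb; rewrite -addnn leq_addr.
rewrite add1n; have h := hom_sqnormX l (hom_lin (w A) (hom_cst m rho ((-1) ^+ l))).
rewrite addn1 in h; apply: hom_ext (hom_le _ h).
  by move=> y _; rewrite clvecX_odd_coef clvecE; ring.
rewrite mulrC normrX normrN1 expr1n mulr1; apply: ler_pM => //; first exact: enorm_ge0.
- rewrite /C (bigD1 A)//= addrCA lerDl !addr_ge0// sumr_ge0// => B _; exact: enorm_ge0.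
- by apply: Mb; rewrite -addnn (leq_trans (leq_addr l l))// leqnSn.
Qed.

(* The image of the n-th power of the vector variable under the inverse
   intertwining operator. *)
Definition ipow n x : Cl := (n`!%:R : R)^-1 *: clT Rp k n x (fun y => clvec y ^+ n) 0.

Lemma ipow_coef n x A : clcoef (ipow n x) A =
  n`!%:R^-1 * iter n (T x) (fun y => clcoef (clvec y ^+ n) A) 0.
Proof. by rewrite /ipow clcoefZ clTE. Qed.

(** The factor n! produced by n Dunkl operators on degree n cancels the 1 / n! of the
    exponential. *)
Lemma ipow_bound : exists C K : R, [/\ 0 < C, 0 < K & forall n x, `|ipow n x| <= C * (K * enorm x) ^+ n].
Proof.
have [C [M [C0 M0 h]]] := clvecX_hom.
have K1 := dunkl_const_ge1 Rp k; have K0 : 0 < dunkl_const Rp k by apply: lt_le_trans K1.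
exists C, (M * dunkl_const Rp k); split => //; first exact: mulr_gt0.
move=> n x; apply: clnorm_le.
  by rewrite mulr_ge0 ?(ltW C0)// exprn_ge0// mulr_ge0 ?enorm_ge0// ltW// mulr_gt0.
have nf : 0 < n`!%:R :> R by rewrite ltr0n fact_gt0.
move=> A; rewrite ipow_coef normrM normfV (gtr0_norm nf).
rewrite ler_pdivrMl//; apply: le_trans (hom_iter_bound k ltr01 ns ps x (h 1 n A)) _.
by rewrite le_eqVlt; apply/orP; left; apply/eqP; rewrite !exprMn; ring.
Qed.

Lemma ipow_scale n x l : ipow n (l *: x) = l ^+ n *: ipow n x.
Proof.
apply: clP => A; rewrite clcoefZ !ipow_coef mulrCA; congr (_ * _).
have sm0 : sm 1 (fun y : E => clcoef (clvec y ^+ n) A) by exact: clvecX_sm.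
have main j y : inball 1 y -> iter j (T (l *: x)) (fun y => clcoef (clvec y ^+ n) A) y =
    l ^+ j * iter j (T x) (fun y => clcoef (clvec y ^+ n) A) y.
  elim: j y => [|j IH] y yB; first by rewrite expr0 mul1r.
  rewrite !iterS (sT_ext k Rn (l *: x) (iter_sm k ns ps j (l *: x) sm0) IH yB).
  rewrite (sT_scale k Rn _ _ (iter_sm k ns ps j x sm0) yB) exprS [l * _]mulrC -mulrA; congr (_ * _).
  by rewrite /sT mulr_sumr; apply: eq_bigr => i _; rewrite mxE mulrA.
by apply: main; exact: inball0.
Qed.

Lemma ipow_poly n x v A : exists2 p : {poly R}, (size p <= n.+1)%N &
  forall t, clcoef (ipow n (x + t *: v)) A = p.[t].
Proof.
have sm0 : sm 1 (fun y : E => clcoef (clvec y ^+ n) A) by exact: clvecX_sm.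
have [p sp hp] := iter_sT_poly k ns ps n x v sm0 (inball0 m ltr01).
exists (n`!%:R^-1 *: p); first by apply: leq_trans (size_scale_leq _ _) sp.
by move=> t; rewrite ipow_coef hp hornerZ.
Qed.

Lemma ipow_differentiable n x A : differentiable (fun x => clcoef (ipow n x) A) x /\
  forall v, 'D_v (fun x => clcoef (ipow n x) A) x =
    n`!%:R^-1 * (n%:R * iter n.-1 (T x) (T v (fun y => clcoef (clvec y ^+ n) A)) 0).
Proof.
have sm0 : sm 1 (fun y : E => clcoef (clvec y ^+ n) A) by exact: clvecX_sm.
have [d1 d2] := iter_sT_derive rs ns ps mk n sm0 (inball0 m ltr01) x.
under eq_fun do rewrite ipow_coef.
have D : differentiable (fun x => n`!%:R^-1 * iter n (T x) (fun y => clcoef (clvec y ^+ n) A) 0) x.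
  by apply: differentiableM.
split => // v; rewrite -d2.
have hv : is_derive x v (fun x => iter n (T x) (fun y => clcoef (clvec y ^+ n) A) 0)
   ('D_v (fun x => iter n (T x) (fun y => clcoef (clvec y ^+ n) A) 0) x).
  by split => //; exact: diff_derivable.
have [_ ->] := is_deriveMl (is_derive_cst (n`!%:R^-1 : R) x v) hv.
by rewrite /cst mul0r add0r.
Qed.

Definition ipow_deriv n v x : Cl := clmake (fun A => 'D_v (fun x => clcoef (ipow n x) A) x).

Lemma ipow_deriv_coef n v x A :
  clcoef (ipow_deriv n v x) A = 'D_v (fun x => clcoef (ipow n x) A) x.
Proof. exact: clmakeE. Qed.

Lemma ipow_deriv0 n x : ipow_deriv n 0 x = 0.
Proof.
apply: clP => B; rewrite ipow_deriv_coef clcoef0.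
by rewrite deriveE ?linear0//; exact: (ipow_differentiable n x B).1.
Qed.

Lemma ipow_derivE n v x : ipow_deriv n v x =
  (n`!%:R^-1 * n%:R : R) *: clT Rp k n.-1 x (clT Rp k 1 v (fun y => clvec y ^+ n)) 0.
Proof.
apply: clP => A; rewrite ipow_deriv_coef clcoefZ clTE.
have [_ ->] := ipow_differentiable n x A; rewrite mulrA; congr (_ * _).
by congr (iter _ _ _ 0); apply/funext => y; rewrite clTE.
Qed.

Lemma ipow_dirac n x : gamma Rp k = (1 - m%:R) / 2 ->
  \sum_(j < m) clgen j * ipow_deriv n (unitv R j) x = - (n%:R : R) *: ipow n.-1 x.
Proof.
move=> gk; have B0 := inball0 m (@ltr01 R).
have smX n' : clsm 1 (fun y : E => clvec y ^+ n') by exact: clvecX_sm.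
have sm1 v : clsm 1 (clT Rp k 1 v (fun y => clvec y ^+ n)) by apply: (clT_sm k ns ps).
transitivity ((n`!%:R^-1 * n%:R : R) *: clT Rp k n.-1 x
   (fun y => \sum_(j < m) clgen j * clT Rp k 1 (unitv R j) (fun y => clvec y ^+ n) y) 0).
  rewrite (clT_sum k ns ps n.-1 x _ (fun j => clsm_mull (clgen j) (sm1 (unitv R j))) B0).
  rewrite scaler_sumr; apply: eq_bigr => j _.
  by rewrite ipow_derivE -clscaleAr (clT_mull k ns ps _ _ _ (sm1 _) B0).
have smS := clsm_sum (index_enum 'I_m) (fun j => clsm_mull (clgen j) (sm1 (unitv R j))).
have dn y := @dirac_clvecX R m 1 Rs Rp k ns ps n y gk.
rewrite (clT_ext k ns ps n.-1 x smS dn B0).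
have smX' := clsm_mull ((- n%:R : R)%:A) (smX n.-1).
have e (y : E) : inball 1 y -> (- (n%:R : R))%:A * clvec y ^+ n.-1 = - (n%:R : R) *: (clvec y ^+ n.-1 : Cl).
  by move=> _; rewrite -clscaleAl mul1r.
rewrite -(clT_ext k ns ps n.-1 x smX' e B0) (clT_mull k ns ps _ _ _ (smX n.-1) B0).
rewrite -clscaleAl mul1r scalerA /ipow scalerA.
case: n {sm1 smS dn smX' e} => [|n]; first by rewrite mulr0 mul0r oppr0 scale0r mul0r scale0r.
rewrite /= factS natrM; congr (_ *: _).
have nn : n`!%:R != 0 :> R by rewrite pnatr_eq0 -lt0n fact_gt0.
by field; rewrite nn ?natr1 ?nat1r pnatr_eq0.
Qed.

Lemma exp_dunkl_termE (D : set (R * R)) (f : R * E -> Cl) (alpha beta : R * R -> Cl) s x n :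
  (0 < m)%N -> open D -> stem_function D alpha beta -> holomorphic_stem D alpha beta ->
  (forall x : R * E, axial_domain D x -> f x = alpha (x.1, enorm x.2)
     + clvec ((enorm x.2)^-1 *: x.2) * beta (x.1, enorm x.2)) -> D (s, 0) ->
  exp_dunkl_term Rp k f (s, x) n = ipow n x * stem_coef alpha n s.
Proof.
move=> m0 oD sf hol fE Ds.
have [r [rho [C [K [r0 rho0 C0 K0 h]]]]] := slice_expansion m0 oD sf hol fE Ds.
have [|_ _ hL] := h s; first by rewrite subrr normr0.
(* n + 1 factors |y|^2 outlast n operators, and the 2 n + 2 powers of the main part include the
   n-th, the only one that survives at 0. *)
have [g smg hg] := hL n.+1.
have B0 := inball0 m rho0.
have smX j : clsm rho (fun y : E => clvec y ^+ j * stem_coef alpha j s).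
  by apply: clsm_mulr; exact: clvecX_sm.
have smS := clsm_sum (index_enum 'I_(n.+1.*2)) (fun j => smX j).
have smG : clsm rho (fun y => dotv y y ^+ n.+1 *: g y).
  by move=> A; apply: sm_ext (sm_sqnormX n.+1 (smg A)) => y _; rewrite clcoefZ.
have smf : clsm rho (fun y => f (s, y)).
  by move=> A; apply: sm_ext (clsmD smS smG A) => y yB; rewrite hg.
rewrite /exp_dunkl_term /= (iter_dunkl_along k ns ps n x smf B0).
rewrite (clT_ext k ns ps n x smf hg B0) (clT_add k ns ps n x smS smG B0).
have /= -> := clT_sum k ns ps n x (index_enum 'I_(n.+1.*2))
  (F := fun (j : 'I_(n.+1.*2)) y => clvec y ^+ j * stem_coef alpha j s) (fun j => smX j) B0.
have -> : clT Rp k n x (fun y => dotv y y ^+ n.+1 *: g y) 0 = 0.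
  apply: clP => A; rewrite clTE clcoef0; apply: (van_iter_at0 k rho0 ns ps x).
  by exists (fun y => clcoef (g y) A) => // y _; rewrite clcoefZ.
rewrite addr0.
have nlt : (n < n.+1.*2)%N by rewrite -addnn ltn_addr.
have [C' [M [_ _ hh]]] := clvecX_hom.
rewrite (bigD1 (Ordinal nlt))//= [X in _ + X]big1 ?addr0.
  by rewrite (clT_mulr k ns ps _ _ _ (clvecX_sm rho n) B0) /ipow -clscaleAl.
move=> j jn; rewrite (clT_mulr k ns ps _ _ _ (clvecX_sm rho j) B0).
suff -> : clT Rp k n x (fun y => clvec y ^+ j) 0 = 0 by rewrite mul0r.
apply: clP => A; rewrite clTE clcoef0.
apply: (hom_iter_neq k rho0 ns ps x (hh rho j A)).
by apply: contra jn => /eqP e; apply/eqP/val_inj.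
Qed.

End IntertwinedPowers.

(** * Markov's inequality and termwise differentiation *)

Section MarkovInequality.
Variable R : realType.

Lemma prod_dist_nodes (N i : nat) : (i <= N)%N ->
  \prod_(j < N.+1 | j != i :> nat) `|i%:R - j%:R : R| = i`!%:R * (N - i)`!%:R.
Proof.
move=> iN; rewrite -(big_mkord (fun j => j != i) (fun j => `|i%:R - j%:R : R|)).
rewrite (@big_cat_nat _ _ _ i)//= ?leqW// [X in _ * X]big_mkcond big_ltn//= eqxx mul1r.
congr (_ * _).
  rewrite big_nat_cond [in LHS]big_mkcond/= fact_prod.
  rewrite (big_addn 0 _ 1) subn1 /= natr_prod.
  rewrite big_nat_rev/= big_nat [RHS]big_nat; apply: eq_bigr => j ji.
  rewrite add0n; have -> : ((0 <= i - j.+1 < i) && (i - j.+1 != i))%N by lia.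
  rewrite -natrB; last by lia.
  by rewrite ger0_norm ?ler0n//; congr _%:R; lia.
rewrite -[i.+1]add1n big_addn fact_prod natr_prod.
have -> : (N.+1 - i = (N - i).+1)%N by lia.
rewrite big_nat [RHS]big_nat; apply: eq_bigr => j ji.
have -> : (j + i != i)%N by lia.
by rewrite distrC natrD addrK ger0_norm.
Qed.

(** The central binomial coefficient is the largest: the step from distance l to l + 1 from the
    middle multiplies the right-hand side by (n + l + 1) / (n - l). *)
Lemma fact_sqr_le (n i : nat) : (i <= n.*2)%N -> (n`! * n`! <= i`! * (n.*2 - i)`!)%N.
Proof.
have main l : (l <= n)%N -> (n`! * n`! <= (n - l)`! * (n + l)`!)%N.
  elim: l => [|l IH] ln; first by rewrite subn0 addn0.
  apply: leq_trans (IH (ltnW ln)) _; rewrite addnS factS -(subnSK ln) factS.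
  move: (n - l.+1)`! (n + l)`! => a b; have ab : (n - l.+1 <= n + l)%N by lia.
  by nia.
move=> i2; case: (leqP i n) => h.
  have := main (n - i)%N (leq_subr _ _).
  have -> : (n - (n - i) = i)%N by lia.
  by have -> : (n + (n - i) = n.*2 - i)%N by lia.
have := main (i - n)%N; rewrite [in X in _ -> X]mulnC.
have -> : (n - (i - n) = n.*2 - i)%N by lia.
have -> : (n + (i - n) = i)%N by lia.
by apply; lia.
Qed.

Lemma nat_dist (i j : nat) : i != j -> 1 <= `|i%:R - j%:R : R|.
Proof.
move=> ij; wlog lij : i j ij / (i < j)%N => [th|].
  have := ij; rewrite neq_ltn => /orP[h|h]; first exact: th.
  by rewrite distrC; apply: th => //; rewrite eq_sym.
by rewrite distrC -natrB ?(ltnW lij)// ger0_norm ?ler0n// ler1n subn_gt0.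
Qed.

(* Markov's inequality up to a constant, by Lagrange interpolation of p - p(0) at
   the nodes (i - n) d / n for i <= 2 n. *)
Lemma markov_inequality (p : {poly R}) (n : nat) (d M : R) : (size p <= n.+1)%N -> 0 < d ->
  (forall t, `|t| <= d -> `|p.[t]| <= M) -> `|p^`().[0]| <= 6 * n%:R ^+ 2 * M / d.
Proof.
move=> sp d0 pM.
have [n0|n0] := posnP n.
  rewrite n0 in sp *; rewrite (size1_polyC sp) derivC horner0 normr0.
  by rewrite expr2 !mulr0 !mul0r.
pose h := d / n%:R; have nR : 0 < n%:R :> R by rewrite ltr0n.
have h0 : 0 < h by rewrite divr_gt0.
pose x (i : nat) := (i%:R - n%:R) * h.
have x_inj : injective x.
  move=> i j /(mulIf (lt0r_neq0 h0)) /(addIr _) /eqP; rewrite eqr_nat => /eqP //.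
have N0 : (0 < n.*2.+1)%N by [].
(* The 2 n + 1 nodes are symmetric, with 0 as the n-th. Subtracting p(0) removes that node's term
   from the interpolation, at the price of the bound 2 M. *)
pose q := p - p.[0]%:P.
have sq : (size q <= n.*2.+1)%N.
  apply: leq_trans (size_polyD _ _) _; rewrite size_polyN geq_max (leq_trans sp)/=; last by lia.
  by apply: leq_trans (size_polyC_leq1 _) _.
have q' : q^`() = p^`() by rewrite derivB derivC subr0.
have xn : x n = 0 by rewrite /x subrr mul0r.
have nlt : (n < n.*2.+1)%N by lia.
pose o := Ordinal nlt.
rewrite -q' (lagrange_gen N0 x_inj sq) (raddf_sum (@deriv R))/= horner_sum (bigD1 o)//=.
rewrite xn /q hornerD hornerN hornerC subrr mul0r deriv0 horner0 add0r -/q.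
have nodes a : (a <= n.*2)%N ->
    \prod_(j < n.*2.+1 | j != a :> nat) `|x a - x j| = h ^+ n.*2 * (a`!%:R * (n.*2 - a)`!%:R).
  move=> a2; rewrite -prod_dist_nodes//.
  have a2' : (a < n.*2.+1)%N by [].
  have -> : n.*2 = n.*2.+1.-1 by [].
  rewrite -[X in h ^+ X.-1](card_ord n.*2.+1) -(cardC1 (Ordinal a2')) -prodr_const -big_split /=.
  apply: eq_big => // j _.
  by rewrite /x -mulrBl opprB addrA subrK normrM (gtr0_norm h0) mulrC.
have M0 : 0 <= M by apply: le_trans (pM 0 _); rewrite ?normr0 // ltW.
have bd (i : 'I_n.*2.+1) : i != o -> `|((q.[x i])%:P * tnth (lagrange n.*2.+1 x) i)^`().[0]| <= 2 * M / h.
  move=> io.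
  rewrite lagrangeE// mulrA -polyCM mul_polyC derivZ hornerZ (bigD1 o) 1?eq_sym//= xn polyC0 subr0.
  rewrite derivM derivX mul1r; set P := \prod_(_ < _ | _) _.
  rewrite [(_ + _).[0]]hornerD [('X * _).[0]]hornerM !hornerX mul0r addr0 hornerM hornerX.
  have hp j : `|('X - (x j)%:P).[x i]| = `|x i - x j| by rewrite hornerXsubC.
  have P_i : `|x i| * `|P.[x i]| = h ^+ n.*2 * (i`!%:R * (n.*2 - i)`!%:R).
    rewrite -(nodes i); last by rewrite -ltnS.
    rewrite (bigD1 o)/=; last by rewrite eq_sym.
    rewrite xn subr0 /P horner_prod normr_prod; congr (_ * _).
    by apply: eq_bigr => j _; rewrite hornerXsubC.
  have P_0 : `|x i| * `|P.[0]| = h ^+ n.*2 * (n`!%:R * n`!%:R).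
    have := nodes o; have -> : (n.*2 - o)%N = n by rewrite /=; lia.
    move=> <-; last by rewrite /=; lia.
    rewrite (bigD1 i)//=.
    rewrite xn sub0r normrN /P horner_prod normr_prod; congr (_ * _).
    apply: eq_big => [j|j _]; first by rewrite andbC.
    by rewrite hornerXsubC sub0r normrN.
  have iN : (i <= n.*2)%N by rewrite -ltnS.
  have in_ : i != n :> nat by apply: contra io => /eqP e; apply/eqP/val_inj.
  have xi_h : h <= `|x i|.
    rewrite normrM (gtr0_norm h0) ler_peMl ?(ltW h0)//.
    by have := nat_dist in_.
  have xi_d : `|x i| <= d.
    rewrite normrM (gtr0_norm h0) /h mulrCA ger_pMr// ler_pdivrMr// mul1r.
    rewrite ler_norml lerBlDr -natrD ler_nat lerBrDl addrN ler0n/=.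
    by rewrite addnn.
  have xi0 : 0 < `|x i| by apply: lt_le_trans xi_h.
  (* The i-th basis polynomial is X P / (x_i P(x_i)), with derivative P(0) / (x_i P(x_i)) at 0. Both
     values of P are products of node distances, compared by [fact_sqr_le]. *)
  have le0i : `|P.[0]| <= `|P.[x i]|.
    rewrite -(ler_pM2l xi0) P_0 P_i ler_pM2l ?exprn_gt0// -!natrM ler_nat.
    exact: fact_sqr_le.
  have Pi0 : 0 < `|P.[x i]|.
    rewrite -(pmulr_rgt0 _ xi0) P_i mulr_gt0 ?exprn_gt0// -natrM ltr0n muln_gt0 !fact_gt0 //.
  have qi : `|q.[x i]| <= 2 * M.
    rewrite hornerD hornerN hornerC; apply: le_trans (ler_normB _ _) _.
    rewrite mulr2n mulrDl mul1r lerD ?pM// normr0 ltW//.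
  rewrite !normrM normfV normrM -mulrA; apply: ler_pM => //.
  rewrite invfM -mulrA -[leRHS]mulr1; apply: ler_pM => //.
  - by rewrite lef_pV2.
  - by rewrite ler_pdivrMl ?mulr1.
apply: le_trans (ler_norm_sum _ _ _) _.
(* There are 2 n terms and h = d / n, hence the sum is 4 n^2 M / d, within the stated constant 6. *)
apply: (@le_trans _ _ (\sum_(i < n.*2.+1 | i != o) 2 * M / h)).
  by apply: ler_sum => i io; exact: bd.
rewrite sumr_const cardC1 card_ord -[n.*2.+1.-1]/(n.*2) -muln2 -(mulr_natl _ (n * 2)) natrM /h invf_div.
have c0 : 0 <= n%:R ^+ 2 * M / d by rewrite divr_ge0 ?(ltW d0)// mulr_ge0// exprn_ge0// ltW.
have -> : n%:R * 2 * (2 * M * (n%:R / d)) = 4 * (n%:R ^+ 2 * M / d) by ring.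
have -> : 6 * n%:R ^+ 2 * M / d = 6 * (n%:R ^+ 2 * M / d) by ring.
lra.
Qed.

End MarkovInequality.

(** * Tails of geometrically dominated series *)

Section GeometricTail.
Variables (R : realType) (u : nat -> R) (C q : R).
Hypotheses (q0 : 0 <= q) (q1 : q < 1) (uC : forall n, `|u n| <= C * q ^+ n).

Let C0 : 0 <= C.
Proof. by have := uC 0; rewrite expr0 mulr1; apply: le_trans. Qed.

Lemma geometric_is_cvg : cvgn (series u).
Proof.
apply: normed_cvg; apply: series_le_cvg (@is_cvg_geometric_series R C q _) => //.
- by move=> n /=.
- by move=> n; rewrite /geometric; apply: mulr_ge0 => //; exact: exprn_ge0.
- by rewrite ger0_norm.
Qed.

Lemma geometric_tail N : `|limn (series u) - series u N| <= C / (1 - q) * q ^+ N.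
Proof.
have q1' : 0 < 1 - q by rewrite subr_gt0.
have part j : `|series u (N + j)%N - series u N| <= C * (q ^+ N - q ^+ (N + j)) / (1 - q).
  elim: j => [|j IH]; first by rewrite addn0 !subrr normr0 mulr0 mul0r.
  rewrite addnS seriesSr addrAC; apply: le_trans (ler_normD _ _) _.
  apply: le_trans (lerD IH (uC _)) _; rewrite le_eqVlt; apply/orP; left; apply/eqP.
  by rewrite exprS; field; rewrite lt0r_neq0.
have cv : (fun M => `|series u M - series u N|) @ \oo --> `|limn (series u) - series u N|.
  by apply: cvg_norm; apply: cvgB; [exact: geometric_is_cvg|exact: cvg_cst].
rewrite -(cvg_lim _ cv)//; apply: limr_le; first by apply: cvgP cv.
exists N => // M /= NM; rewrite -(subnKC NM); apply: le_trans (part _) _.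
rewrite mulrAC ler_wpM2l//; first by rewrite divr_ge0// ltW.
by rewrite gerBl exprn_ge0.
Qed.

Lemma geometric_sum_le : `|limn (series u)| <= C / (1 - q).
Proof.
by have := geometric_tail 0; rewrite /series /= big_geq// subr0 expr0 mulr1.
Qed.

End GeometricTail.

Lemma cvg_bigsum (R : realType) (T : Type) (F : set_system T) (FF : Filter F) (I : Type)
    (s : seq I) (f : I -> T -> R) (l : I -> R) : (forall i, f i t @[t --> F] --> l i) ->
  \sum_(i <- s) f i t @[t --> F] --> \sum_(i <- s) l i.
Proof.
move=> fl; elim: s => [|i s IH].
  by under eq_fun do rewrite big_nil; rewrite big_nil; exact: cvg_cst.
by under eq_fun do rewrite big_cons; rewrite big_cons; apply: cvgD.
Qed.

(** * Termwise differentiation under geometric domination *)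

Section TermwiseDifferentiation.
Variables (R : realType) (V : normedModType R).
Implicit Types (x y z h v : V).

Lemma is_derive_line (f : V -> R) z v t : differentiable f (z + t *: v) ->
  is_derive t (1 : R) (fun t => f (z + t *: v)) ('D_v f (z + t *: v)).
Proof.
move=> df; have df' := @diff_derivable _ _ _ f _ v df.
suff E : (fun h : R => h^-1 *: (f (z + (h *: (1 : R) + t) *: v) - f (z + t *: v))) =
    (fun h : R => h^-1 *: (f (h *: v + (z + t *: v)) - f (z + t *: v))).
  by split; rewrite /derivable /derive ?E.
apply/funext => h; congr (_ *: (f _ - _)).
by rewrite [h *: (1 : R)]mulr1 scalerDl addrCA.
Qed.

Lemma convex_ball x z y r t : 0 <= t <= 1 -> `|z - x| < r -> `|y - x| < r ->
  `|z + t *: (y - z) - x| < r.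
Proof.
move=> /andP[t0 t1] zx yx.
have -> : z + t *: (y - z) - x = (1 - t) *: (z - x) + t *: (y - x).
  by rewrite scalerBl scale1r -[RHS]addrA [- (t *: _) + _]addrC -scalerBr opprB addrA subrK addrAC.
apply: le_lt_trans (ler_normD _ _) _; rewrite !normrZ (ger0_norm t0) ger0_norm ?subr_ge0//.
have [->|t0'] := eqVneq t 0; first by rewrite subr0 mul1r mul0r addr0.
have t0'' : 0 < t by rewrite lt_neqAle eq_sym t0'.
have := ler_wpM2l (_ : 0 <= 1 - t) (ltW zx); rewrite subr_ge0 => /(_ t1).
have : t * `|y - x| < t * r by rewrite ltr_pM2l.
by lra.
Qed.

Lemma mean_value_bound (f : V -> R) x r B z y : 0 <= B ->
  (forall w, `|w - x| < r -> differentiable f w) ->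
  (forall w h, `|w - x| < r -> `|'D_h f w| <= B * `|h|) ->
  `|z - x| < r -> `|y - x| < r -> `|f y - f z| <= B * `|y - z|.
Proof.
move=> B0 df bf zx yx; set v := y - z.
have dg (t : R) : 0 <= t <= 1 -> is_derive t (1 : R) (fun t => f (z + t *: v)) ('D_v f (z + t *: v)).
  by move=> t01; apply: is_derive_line; apply: df; exact: convex_ball.
have [||t] := @MVT_segment R (fun t => f (z + t *: v)) (fun t => 'D_v f (z + t *: v)) 0 1 ler01.
- by move=> s; rewrite in_itv/= => /andP[s0 s1]; apply: dg; rewrite !ltW.
- apply: continuous_in_subspaceT => s; rewrite inE /= in_itv /= => s01.
  apply/differentiable_continuous/derivable1_diffP.
  by have [] := dg _ s01.
rewrite in_itv /= => t01; rewrite scale1r scale0r addr0 subr0 mulr1 [z + v]addrC subrK => ->.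
by apply: bf; exact: convex_ball.
Qed.

Variables (g : nat -> V -> R) (x : V) (r C q : R).
Hypotheses (q0 : 0 <= q) (q1 : q < 1).
Hypothesis gd : forall n z, `|z - x| < r -> differentiable (g n) z.
Hypothesis gb : forall n z, `|z - x| < r -> `|g n z| <= C * q ^+ n.
Hypothesis gdb : forall n z h, `|z - x| < r -> `|'D_h (g n) z| <= C * q ^+ n * `|h|.

Variable G : V -> R.
Hypothesis GE : forall z, `|z - x| < r -> G z = limn (series (g^~ z)).
Let L z h := limn (series (fun n => 'D_h (g n) z)).

Let DC z h : `|z - x| < r -> forall n, `|'D_h (g n) z| <= (C * `|h|) * q ^+ n.
Proof. by move=> zx n; rewrite mulrAC; exact: gdb. Qed.

Let C0 z : `|z - x| < r -> 0 <= C.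
Proof. by move=> /(gb 0); rewrite expr0 mulr1; exact: le_trans. Qed.

(** Lets the sum of the derivatives be packaged as the candidate differential. *)
Lemma termwise_linear z : `|z - x| < r -> linear (L z).
Proof.
move=> zx c h1 h2; rewrite /L.
have c1 := geometric_is_cvg q0 q1 (DC h1 zx).
have c2 := geometric_is_cvg q0 q1 (DC h2 zx).
have -> : (fun n => 'D_(c *: h1 + h2) (g n) z) = c *: (fun n => 'D_h1 (g n) z) + (fun n => 'D_h2 (g n) z).
  apply/funext => n; have D h := deriveE h (gd n zx).
  by rewrite D linearD linearZ /= -!D.
apply: cvg_lim => //; rewrite seriesD seriesZ; apply: cvgD => //.
apply: cvgM; [exact: cvg_cst|exact: c1].
Qed.

Lemma termwise_partial N z : `|z - x| < r -> differentiable (\sum_(i < N) g i) z /\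
  forall v, 'D_v (\sum_(i < N) g i) z = \sum_(i < N) 'D_v (g i) z.
Proof.
move=> zx; split; first by apply: differentiable_sum => i; exact: gd.
by move=> v; rewrite derive_sum// => i; apply: diff_derivable; exact: gd.
Qed.

(** A finite partial sum is differentiable; the remainders of the other terms are bounded by the
    mean value theorem by 2 C q^n |y - z|, and the tail of these is small relative to |y - z|. *)
Lemma termwise_differentiable z : `|z - x| < r ->
  differentiable G z /\ forall v, 'D_v G z = L z v.
Proof.
move=> zx; have C_ := C0 zx; have q1' : 0 < 1 - q by rewrite subr_gt0.
pose Lc := GRing.isLinear.Build R V R *:%R (L z) (termwise_linear zx).
pose L' : {linear V -> R} := HB.pack (L z) Lc.
have -> : L z = L' by [].
apply: approx_differentiable.
  apply: bounded_linear_continuous; apply/linear_boundedP.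
  near=> M => y /=; apply: le_trans (geometric_sum_le q0 q1 (DC y zx)) _.
  by rewrite mulrAC ler_wpM2r//; near: M; apply: nbhs_pinfty_ge; rewrite num_real.
move=> e e0; pose B := C / (1 - q).
have B0 : 0 <= B by rewrite divr_ge0// ltW.
have [N qN] : exists N, 2 * B * q ^+ N <= e / 2.
  have := @cvg_geometric R (2 * B) q; rewrite ger0_norm// => /(_ q1).
  move/cvgrPdist_le => /(_ (e / 2)); rewrite divr_gt0// => /(_ isT)[N _ /(_ N (leqnn N))] /=.
  rewrite sub0r normrN /geometric ger0_norm; first by exists N.
  by rewrite mulr_ge0 ?exprn_ge0// mulr_ge0.
have [dS DS] := termwise_partial N zx.
have e2 : 0 < e / 2 by rewrite divr_gt0.
have [d d0 hd] := differentiable_approx dS e2.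
exists (Num.min d (r - `|z - x|)); first by rewrite lt_min d0 subr_gt0.
move=> y; rewrite lt_min => /andP[/hd yd yr].
have yx : `|y - x| < r.
  rewrite -(subrK z y) -addrA; apply: le_lt_trans (ler_normD _ _) _.
  by rewrite -ltrBrDr.
pose rho n := g n y - g n z - 'D_(y - z) (g n) z.
have rhob n : `|rho n| <= (2 * C * `|y - z|) * q ^+ n.
  have k1 : `|g n y - g n z| <= C * q ^+ n * `|y - z|.
    apply: (@mean_value_bound (g n) x r) => //; first by rewrite mulr_ge0// exprn_ge0.
    - by move=> w; exact: gd.
    - by move=> w h; exact: gdb.
  have k2 := gdb n (y - z) zx.
  by apply: le_trans (ler_normB _ _) _; apply: le_trans (lerD k1 k2) _;
    rewrite le_eqVlt; apply/orP; left; apply/eqP; ring.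
have -> : G y - G z - L z (y - z) = limn (series rho).
  rewrite !GE//.
  apply/esym/cvg_lim => //.
  have -> : rho = (g^~ y) - (g^~ z) - (fun n => 'D_(y - z) (g n) z) by [].
  rewrite !seriesD !seriesN; apply: cvgB; last exact: geometric_is_cvg q0 q1 (DC _ zx).
  apply: cvgB; exact: geometric_is_cvg q0 q1 (fun n => gb n _).
have tl := geometric_tail q0 q1 rhob N.
have sE : series rho N = \sum_(i < N) g i y - \sum_(i < N) g i z - 'D_(y - z) (\sum_(i < N) g i) z.
  by rewrite /series /= big_mkord DS -!sumrB.
have E w : (\sum_(i < N) g i) w = \sum_(i < N) g i w by rewrite fct_sumE.
move: yd; rewrite !E -sE => yd.
have yz0 : 0 <= `|y - z| by [].
have := ler_wpM2r yz0 qN.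
have -> : 2 * B * q ^+ N * `|y - z| = 2 * C * `|y - z| / (1 - q) * q ^+ N.
  by rewrite /B; ring.
move=> t2; have := le_trans tl t2 => t3.
rewrite -(subrK (series rho N) (limn _)); apply: le_trans (ler_normD _ _) _.
by lra.
Unshelve. all: by end_near. Qed.

Lemma termwise_derive_cvg z v : `|z - x| < r -> series (fun n => 'D_v (g n) z) @ \oo --> 'D_v G z.
Proof.
move=> zx; have [_ ->] := termwise_differentiable zx.
exact: geometric_is_cvg q0 q1 (DC v zx).
Qed.

(** Three-epsilon argument: the tails of the differentiated series at z and at w are bounded alike,
    and the finite part is continuous. *)
Lemma termwise_derive_continuous v z : `|z - x| < r ->
  (forall n, {for z, continuous ('D_v (g n))}) -> {for z, continuous ('D_v G)}.
Proof.
move=> zx cg; have C_ := C0 zx; have q1' : 0 < 1 - q by rewrite subr_gt0.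
pose B := C * `|v| / (1 - q).
have B0 : 0 <= B by rewrite divr_ge0 ?mulr_ge0// ltW.
apply/cvgrPdist_le => e e0.
have e3 : 0 < e / 3 by rewrite divr_gt0.
have [N qN] : exists N, B * q ^+ N <= e / 3.
  have := @cvg_geometric R B q; rewrite ger0_norm// => /(_ q1).
  move/cvgrPdist_le => /(_ (e / 3) e3)[N _ /(_ N (leqnn N))] /=.
  rewrite sub0r normrN /geometric ger0_norm; first by exists N.
  by rewrite mulr_ge0 ?exprn_ge0.
have cS : \sum_(i < N) 'D_v (g i) w @[w --> z] --> \sum_(i < N) 'D_v (g i) z.
  by apply: cvg_bigsum => i; exact: cg.
have /cvgrPdist_le/(_ _ e3) hS := cS.
have zr : \forall w \near z, `|w - x| < r.
  apply/nbhs_normP; exists (r - `|z - x|); first by rewrite /= subr_gt0.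
  move=> w /=; rewrite distrC => wz; rewrite -(subrK z w) -addrA.
  by apply: le_lt_trans (ler_normD _ _) _; rewrite -ltrBrDr.
near=> w.
have wx : `|w - x| < r by near: w.
have Dw := (termwise_differentiable wx).2 v; have Dz := (termwise_differentiable zx).2 v.
have t1 := geometric_tail q0 q1 (DC v wx) N; have t2 := geometric_tail q0 q1 (DC v zx) N.
have : `|\sum_(i < N) 'D_v (g i) z - \sum_(i < N) 'D_v (g i) w| <= e / 3 by near: w.
rewrite Dw Dz; move: t1 t2; rewrite /series /= !big_mkord -/(L z v) -/(L w v) -/B.
set a := \sum_(_ < _) _; set b := \sum_(_ < _) _; move: (L z v) (L w v) => l1 l2 t1 t2 t3.
have t1' := le_trans t1 qN; have t2' := le_trans t2 qN.
rewrite ler_norml in t1'; rewrite ler_norml in t2'; rewrite ler_norml in t3; rewrite ler_norml.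
lra.
Unshelve. all: by end_near. Qed.

End TermwiseDifferentiation.

(** * Limits and derivatives of Clifford products *)

Section CliffordProducts.
Variables (R : realType) (m : nat).
Local Notation Cl := (clifford R m).
Implicit Types (a b c : Cl) (A B : {set 'I_m}).

Lemma clcoefM a b A : clcoef (a * b) A =
  \sum_B \sum_C clcoef (blade R B * blade R C) A * (clcoef a B * clcoef b C).
Proof.
rewrite clcoef_mulr; apply: eq_bigr => B _; rewrite clcoef_mull mulr_suml.
by apply: eq_bigr => C _; rewrite mulrA mulrAC.
Qed.

Lemma clcoefM_cvg (T : Type) (F : set_system T) (FF : Filter F) (u w : T -> Cl) a b :
  (forall B, clcoef (u t) B @[t --> F] --> clcoef a B) ->
  (forall B, clcoef (w t) B @[t --> F] --> clcoef b B) ->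
  forall A, clcoef (u t * w t) A @[t --> F] --> clcoef (a * b) A.
Proof.
move=> hu hw A; under eq_fun do rewrite clcoefM; rewrite clcoefM.
apply: cvg_bigsum => B; apply: cvg_bigsum => C.
by apply: cvgM; [exact: cvg_cst|exact: cvgM].
Qed.

Section Derivation.
Variables (V : normedModType R) (u w : V -> Cl).

Lemma is_derive_bigsum (I : Type) (s : seq I) (f : I -> V -> R) (df : I -> R) (x v : V) :
  (forall i, is_derive x v (f i) (df i)) ->
  is_derive x v (fun y => \sum_(i <- s) f i y) (\sum_(i <- s) df i).
Proof.
move=> h; elim: s => [|i s IH].
  by rewrite big_nil; under eq_fun do rewrite big_nil; exact: is_derive_cst.
by rewrite big_cons; under eq_fun do rewrite big_cons; exact: is_deriveDl.
Qed.

Lemma differentiable_bigsum (I : Type) (s : seq I) (f : I -> V -> R) (x : V) :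
  (forall i, differentiable (f i) x) -> differentiable (fun y => \sum_(i <- s) f i y) x.
Proof.
move=> h; elim: s => [|i s IH].
  by under eq_fun do rewrite big_nil; exact: differentiable_cst.
by under eq_fun do rewrite big_cons; exact: differentiableD.
Qed.

Lemma clifford_leibniz x v a b :
  (forall B, is_derive x v (fun y => clcoef (u y) B) (clcoef a B)) ->
  (forall B, is_derive x v (fun y => clcoef (w y) B) (clcoef b B)) ->
  forall A, is_derive x v (fun y => clcoef (u y * w y) A) (clcoef (a * w x + u x * b) A).
Proof.
move=> hu hw A; under eq_fun do rewrite clcoefM.
rewrite clcoefD !clcoefM -big_split /=; apply: is_derive_bigsum => B.
rewrite -big_split /=; apply: is_derive_bigsum => C; rewrite -mulrDr.
have := is_deriveMl (is_derive_cst (clcoef (blade R B * blade R C) A) x v) (is_deriveMl (hu B) (hw C)).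
by move/is_derive_eq; apply; rewrite mul0r add0r.
Qed.

Lemma clifford_mul_differentiable x :
  (forall B, differentiable (fun y => clcoef (u y) B) x) ->
  (forall B, differentiable (fun y => clcoef (w y) B) x) ->
  forall A, differentiable (fun y => clcoef (u y * w y) A) x.
Proof.
move=> hu hw A; under eq_fun do rewrite clcoefM.
apply: differentiable_bigsum => B; apply: differentiable_bigsum => C.
by apply: differentiableM => //; apply: differentiableM.
Qed.

End Derivation.

Lemma clifford_geometric (u : nat -> Cl) (C q : R) : 0 <= q -> q < 1 ->
  (forall n, `|u n| <= C * q ^+ n) ->
  (forall A, clcoef (limn (series u)) A = limn (series (fun n => clcoef (u n) A))) /\
  forall N, `|limn (series u) - series u N| <= C / (1 - q) * q ^+ N.
Proof.
move=> q0 q1 uC; have q1' : 0 < 1 - q by rewrite subr_gt0.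
have C0 : 0 <= C by have := uC 0; rewrite expr0 mulr1; apply: le_trans.
have cC A n : `|clcoef (u n) A| <= C * q ^+ n by apply: le_trans (clcoef_le_norm _ _) (uC n).
have sE N A : clcoef (series u N) A = series (fun n => clcoef (u n) A) N.
  by rewrite /series /= clcoef_sum.
have cv : series u @ \oo --> (clmake (fun A => limn (series (fun n => clcoef (u n) A))) : Cl).
  apply: clifford_cvg => A; under eq_fun do rewrite sE.
  rewrite clmakeE; exact: geometric_is_cvg q0 q1 (cC A).
have lE A : clcoef (limn (series u)) A = limn (series (fun n => clcoef (u n) A)).
  by rewrite (cvg_lim _ cv)// clmakeE.
split => // N; apply: clnorm_le; first by rewrite mulr_ge0 ?exprn_ge0// divr_ge0// ltW.
by move=> A; rewrite clcoefB lE sE; exact: geometric_tail q0 q1 (cC A) N.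
Qed.

End CliffordProducts.

Section ProjectionComposition.
Variables (R : realType) (U V : normedModType R).

Lemma is_derive_comp_fst (f : U -> R) (z h : U * V) : differentiable f z.1 ->
  differentiable (fun y : U * V => f y.1) z /\
  is_derive z h (fun y : U * V => f y.1) ('D_h.1 f z.1).
Proof.
move=> df; have dF : differentiable (fun y : U * V => f y.1) z.
  by apply: (@differentiable_comp _ _ _ _ fst f) => //; exact: differentiable_proj1.
by split => //; split => //; exact: diff_derivable.
Qed.

Lemma is_derive_comp_snd (f : V -> R) (z h : U * V) : differentiable f z.2 ->
  differentiable (fun y : U * V => f y.2) z /\
  is_derive z h (fun y : U * V => f y.2) ('D_h.2 f z.2).
Proof.
move=> df; have dF : differentiable (fun y : U * V => f y.2) z.
  by apply: (@differentiable_comp _ _ _ _ snd f) => //; exact: differentiable_proj2.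
by split => //; split => //; exact: diff_derivable.
Qed.

End ProjectionComposition.

(** * Monogenicity *)

Section ExponentialTerms.
Variables (R : realType) (m : nat).
Local Notation E := 'rV[R]_m.
Local Notation Cl := (clifford R m).
Variables (Rs Rp : {fset E}) (k : E -> R).
Hypotheses (rs : root_system Rs) (ns : normalized Rs) (ps : positive_subsystem Rs Rp)
  (mk : multiplicity_function Rs k).
Variables (D : set (R * R)) (alpha beta : R * R -> Cl).
Hypotheses (oD : open D) (hol : holomorphic_stem D alpha beta).
Implicit Types (A B : {set 'I_m}) (z h : R * E).
Local Notation a_ := (stem_coef alpha).
Local Notation P_ := (ipow Rp k).

Definition eterm n z : Cl := P_ n z.2 * a_ n z.1.

(** The derivative in direction h, with (n + 1) a_(n+1) written for the derivative of a_n. *)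
Definition eterm_deriv n h z : Cl :=
  ipow_deriv Rp k n h.2 z.2 * a_ n z.1 + (h.1 * n.+1%:R) *: (P_ n z.2 * a_ n.+1 z.1).

Lemma ipow_deriv_continuous n v B : continuous (fun x => clcoef (ipow_deriv Rp k n v x) B).
Proof.
move=> x; under eq_fun do rewrite ipow_deriv_coef (ipow_differentiable rs ns ps mk n _ B).2.
have sm0 : sm 1 (fun y : E => clcoef (clvec y ^+ n) B) by exact: clvecX_sm.
have [d1 _] := iter_sT_derive rs ns ps mk n.-1 (sT_sm k (Rp_norm ns ps) v sm0) (inball0 m ltr01) x.
apply: (@differentiable_continuous _ _ _ _ (fun x => n`!%:R^-1 * (n%:R * iter n.-1 (sT Rp k x)
  (sT Rp k v (fun y => clcoef (clvec y ^+ n) B)) 0))).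
by apply: differentiableM => //; apply: differentiableM.
Qed.

Lemma stem_coef_diff n B z h : D (z.1, 0) ->
  differentiable (fun y => clcoef (a_ n y.1) B) z /\
  is_derive z h (fun y => clcoef (a_ n y.1) B) (clcoef ((h.1 * n.+1%:R) *: a_ n.+1 z.1) B).
Proof.
move=> Dz; have da := stem_coef_derive B n oD hol Dz.
have df : differentiable (fun s => clcoef (a_ n s) B) z.1 by apply/derivable1_diffP; case: da.
have [d1 d2] := is_derive_comp_fst h df; split => //; move: d2 => /is_derive_eq; apply.
rewrite deriveE// -[h.1]mulr1 linearZ /= -deriveE// clcoefZ -mulrA.
by case: da => _ ->; rewrite mulr1.
Qed.

Lemma ipow_diff n B z h :
  differentiable (fun y : R * E => clcoef (P_ n y.2) B) z /\
  is_derive z h (fun y : R * E => clcoef (P_ n y.2) B) (clcoef (ipow_deriv Rp k n h.2 z.2) B).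
Proof.
have [df _] := ipow_differentiable rs ns ps mk n z.2 B.
by rewrite ipow_deriv_coef; exact: is_derive_comp_snd.
Qed.

Lemma eterm_is_derive n h A z : D (z.1, 0) ->
  is_derive z h (fun y => clcoef (eterm n y) A) (clcoef (eterm_deriv n h z) A).
Proof.
move=> Dz; have := clifford_leibniz (fun B => (ipow_diff n B z h).2) (fun B => (stem_coef_diff n B h Dz).2) A.
by move/is_derive_eq; apply; rewrite /eterm_deriv clscaleAr.
Qed.

Lemma eterm_differentiable n A z : D (z.1, 0) -> differentiable (fun y => clcoef (eterm n y) A) z.
Proof.
move=> Dz; apply: clifford_mul_differentiable => B; first exact: (ipow_diff n B z 0).1.
exact: (stem_coef_diff n B 0 Dz).1.
Qed.

Lemma near_domain z : D (z.1, 0) -> \forall w \near z, D (w.1, 0).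
Proof.
move=> Dz; have /nbhs_normP[d d0 hd] : nbhs (z.1, 0 : R) D by exact: open_nbhs_nbhs.
apply/nbhs_normP; exists d => // w /=; rewrite prod_normE gt_max => /andP[w1 _].
by apply: hd; rewrite /= plane_norm_ltP /= w1 subrr normr0.
Qed.

Lemma eterm_deriv_continuous n h A z : D (z.1, 0) ->
  {for z, continuous ('D_h (fun y => clcoef (eterm n y) A))}.
Proof.
move=> Dz; rewrite /prop_for /continuous_at.
have [_ ->] := eterm_is_derive n h A Dz.
have e : \forall w \near z, clcoef (eterm_deriv n h w) A = 'D_h (fun y => clcoef (eterm n y) A) w.
  have := near_domain Dz; apply: filterS => w Dw; by have [_ ->] := eterm_is_derive n h A Dw.
apply: cvg_trans (near_eq_cvg e) _.
have cP n' B : clcoef (P_ n' w.2) B @[w --> z] --> clcoef (P_ n' z.2) B.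
  exact: differentiable_continuous (ipow_diff n' B z 0).1.
have ca n' B : clcoef (a_ n' w.1) B @[w --> z] --> clcoef (a_ n' z.1) B.
  exact: differentiable_continuous (stem_coef_diff n' B 0 Dz).1.
have cd B : clcoef (ipow_deriv Rp k n h.2 w.2) B @[w --> z] --> clcoef (ipow_deriv Rp k n h.2 z.2) B.
  apply: (@cvg_comp _ _ _ (snd : R * E -> E) (fun x => clcoef (ipow_deriv Rp k n h.2 x) B)); first exact: cvg_snd.
  exact: ipow_deriv_continuous.
have FF : Filter (nbhs z) := nbhs_filter z.
have c1 := @clcoefM_cvg _ _ _ _ (nbhs_filter z) _ _ _ _ cd (ca n) A.
have c2 := @clcoefM_cvg _ _ _ _ (nbhs_filter z) _ _ _ _ (cP n) (ca n.+1) A.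
have -> : (fun w => clcoef (eterm_deriv n h w) A) = fun w =>
    clcoef (ipow_deriv Rp k n h.2 w.2 * a_ n w.1) A + (h.1 * n.+1%:R) * clcoef (P_ n w.2 * a_ n.+1 w.1) A.
  by apply/funext => w; rewrite clcoefD clcoefZ.
rewrite /eterm_deriv clcoefD clcoefZ.
have c3 := @cvgMl_tmp _ _ _ FF _ (h.1 * n.+1%:R) _ c2.
have c4 := @cvgD _ _ _ _ FF _ _ _ _ c1 c3.
exact: c4.
Qed.

End ExponentialTerms.

Section TermDecay.
Variables (R : realType) (m : nat).
Local Notation E := 'rV[R]_m.
Local Notation Cl := (clifford R m).
Variables (Rs Rp : {fset E}) (k : E -> R).
Hypotheses (rs : root_system Rs) (ns : normalized Rs) (ps : positive_subsystem Rs Rp)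
  (mk : multiplicity_function Rs k) (gk : gamma Rp k = (1 - m%:R) / 2).
Variables (alpha : R * R -> Cl).
Implicit Types (A B : {set 'I_m}) (z h x : R * E) (v : E) (d r q M : R).
Local Notation a_ := (stem_coef alpha).
Local Notation P_ := (ipow Rp k).
Local Notation eterm := (eterm Rp k alpha).

Lemma eterm_scale n z l : eterm n (z.1, l *: z.2) = l ^+ n *: eterm n z.
Proof. by rewrite /eterm /= (ipow_scale k ns ps) clscaleAl. Qed.

(* Homogeneity in the vector variable trades a smaller neighbourhood for geometric
   decay. *)
Lemma eterm_geometric x d M : 0 < d ->
  (forall n z, `|z - x| < d -> `|eterm n z| <= M) ->
  exists2 q, 0 < q < 1 &
    forall n z, `|z - x| < d / 4 -> `|eterm n z| <= M * (q ^+ 3) ^+ n.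
Proof.
move=> d0 bM; have X0 : 0 < `|x.2| + 1 by rewrite ltr_wpDl.
(* With l = (1 + e)^3 one has l - 1 <= 7 e. The first bound gives l <= 2 and the second 7 e |x.2| <=
   d / 4, so (z.1, l z.2) stays within d of x. The cube provides three powers of q: two absorb the
   n^2 of Markov's inequality and one is left for summation. *)
pose e := Num.min (1 / 7) (d / (28 * (`|x.2| + 1))).
have e0 : 0 < e by rewrite lt_min !divr_gt0// mulr_gt0.
have e7 : e <= 1 / 7 by rewrite /e ge_min lexx.
have ed : e * (28 * (`|x.2| + 1)) <= d.
  by rewrite -ler_pdivlMr ?mulr_gt0// /e ge_min lexx orbT.
have mu0 : 0 < 1 + e by lra.
exists (1 + e)^-1; first by rewrite invr_gt0 mu0 invf_lt1//; lra.
move=> n z zx; pose l := (1 + e) ^+ 3.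
have l0 : 0 < l by rewrite exprn_gt0.
have l7 : l - 1 <= 7 * e.
  by rewrite /l; have := mulr_ge0 (ltW e0) (ltW e0); nra.
have l1 : 0 <= l - 1 by rewrite /l; have := mulr_ge0 (ltW e0) (ltW e0); nra.
have [z1 z2] : `|z.1 - x.1| < d / 4 /\ `|z.2 - x.2| < d / 4.
  by move: zx; rewrite prod_normE gt_max => /andP.
have := bM n (z.1, l *: z.2); rewrite eterm_scale normrZ gtr0_norm ?exprn_gt0// => h.
rewrite exprVn exprVn -/l ler_pdivlMr ?exprn_gt0// mulrC; apply: h.
rewrite prod_normE gt_max; apply/andP; split => /=; first by lra.
have -> : l *: z.2 - x.2 = l *: (z.2 - x.2) + (l - 1) *: x.2.
  by rewrite scalerBr scalerBl scale1r addrA subrK.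
apply: le_lt_trans (ler_normD _ _) _; rewrite (normrZ l) (normrZ (l - 1)) (gtr0_norm l0) (ger0_norm l1).
have k1 : l * `|z.2 - x.2| <= 2 * (d / 4) by apply: ler_pM => //; [exact: ltW|lra|exact: ltW].
have k2 : (l - 1) * `|x.2| <= 7 * e * `|x.2| by rewrite ler_wpM2r.
have k3 : 0 <= e * `|x.2| by rewrite mulr_ge0// ltW.
by lra.
Qed.

Lemma sqr_geometric_bound n q : 0 < q -> q < 1 ->
  n%:R ^+ 2 * (q ^+ 3) ^+ n <= (1 - q)^-1 ^+ 2 * q ^+ n.
Proof.
move=> q0 q1; have h := linear_geometric_bound n (ltW q0) q1.
have -> : n%:R ^+ 2 * (q ^+ 3) ^+ n = (n%:R * q ^+ n) ^+ 2 * q ^+ n.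
  by rewrite -exprM mulnC mulnS mulnS muln1 !exprD; ring.
have a0 : 0 <= n%:R * q ^+ n by rewrite mulr_ge0// exprn_ge0// ltW.
rewrite ler_wpM2r ?exprn_ge0 ?(ltW q0)//.
by apply: lerXn2r => //; rewrite nnegrE// (le_trans a0 h).
Qed.

(** On the line z.2 + t v the term is a polynomial in t of degree at most n, the right factor being
    constant, so Markov's inequality needs only the bound on the term itself. *)
Lemma eterm_dirderiv x r (M : nat -> R) n z v A : 0 < r ->
  (forall n z, `|z - x| < r -> `|eterm n z| <= M n) -> `|z - x| < r / 2 ->
  `|clcoef (ipow_deriv Rp k n v z.2 * a_ n z.1) A| <= 12 * n%:R ^+ 2 * M n / r * `|v|.
Proof.
move=> r0 bM zx; set c := a_ n z.1.
have hp B := ipow_poly k ns ps n z.2 v B.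
pose pB B := projT1 (cid2 (hp B)).
have pBs B : (size (pB B) <= n.+1)%N by rewrite /pB; case: cid2.
have pBE B t : clcoef (P_ n (z.2 + t *: v)) B = (pB B).[t] by rewrite /pB; case: cid2.
pose p : {poly R} := \sum_B clcoef (blade R B * c) A *: pB B.
have sp : (size p <= n.+1)%N.
  apply: leq_trans (size_sum _ _ _) _; apply/bigmax_leqP => B _.
  by apply: leq_trans (size_scale_leq _ _) _.
have pE t : clcoef (eterm n (z.1, z.2 + t *: v)) A = p.[t].
  rewrite /eterm /= clcoef_mulr /p horner_sum; apply: eq_bigr => B _.
  by rewrite hornerZ pBE.
have p'E : p^`().[0] = clcoef (ipow_deriv Rp k n v z.2 * c) A.
  rewrite clcoef_mulr /p (raddf_sum (@deriv R)) /= horner_sum; apply: eq_bigr => B _.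
  rewrite derivZ hornerZ; congr (_ * _); rewrite ipow_deriv_coef.
  have [df _] := ipow_differentiable rs ns ps mk n z.2 B.
  have z0 : z.2 + (0 : R) *: v = z.2 by rewrite scale0r addr0.
  have := @is_derive_line _ _ (fun y => clcoef (P_ n y) B) z.2 v 0.
  rewrite z0 => /(_ df) [_ <-].
  have [_ <-] := @is_derive_poly R (pB B) 0.
  by have -> : (fun t : R => clcoef (P_ n (z.2 + t *: v)) B) = horner (pB B) by apply/funext => t.
have z2 : `|z.1 - x.1| < r / 2 /\ `|z.2 - x.2| < r / 2.
  by move: zx; rewrite prod_normE gt_max => /andP.
have pM (d : R) : d * `|v| <= r / 2 -> forall t, `|t| <= d -> `|p.[t]| <= M n.
  move=> dv t td; rewrite -pE; apply: le_trans (clcoef_le_norm _ _) _; apply: bM.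
  rewrite prod_normE gt_max /=; apply/andP; split; first by lra.
  rewrite addrAC; apply: le_lt_trans (ler_normD _ _) _; rewrite normrZ.
  have : `|t| * `|v| <= d * `|v| by rewrite ler_wpM2r.
  by lra.
have [v0|v0] := eqVneq v 0.
  by rewrite v0 (ipow_deriv0 rs ns ps mk) mul0r clcoef0 !normr0 mulr0.
have nv : 0 < `|v| by rewrite normr_gt0.
(* For |t| up to this value the line moves by at most r / 2 and stays within r of x; this turns the
   constant 6 into 12. *)
have d0 : 0 < r / 2 / `|v| by rewrite !divr_gt0.
have := markov_inequality sp d0 (pM _ _); rewrite divfK ?lt0r_neq0// lexx => /(_ isT).
rewrite p'E => /le_trans; apply; rewrite le_eqVlt; apply/orP; left; apply/eqP.
by field; rewrite !lt0r_neq0.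
Qed.

Lemma eterm_timederiv n z : (n.+1%:R : R) *: (P_ n z.2 * a_ n.+1 z.1) =
  - \sum_(j < m) clgen j * (ipow_deriv Rp k n.+1 (unitv R j) z.2 * a_ n.+1 z.1).
Proof.
have := ipow_dirac rs ns ps mk n.+1 z.2 gk; rewrite /= => h.
transitivity (- ((\sum_(j < m) clgen j * ipow_deriv Rp k n.+1 (unitv R j) z.2) * a_ n.+1 z.1)).
  by rewrite h scaleNr mulNr opprK clscaleAl.
by congr (- _); rewrite mulr_suml; apply: eq_bigr => j _; rewrite mulrA.
Qed.

Lemma eterm_decay x d M : 0 < d ->
  (forall n z, `|z - x| < d -> `|eterm n z| <= M) ->
  exists r C q, [/\ 0 < r, r <= d, 0 <= q, q < 1 & forall n z, `|z - x| < r ->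
    `|eterm n z| <= C * q ^+ n /\
    forall h A, `|clcoef (eterm_deriv Rp k alpha n h z) A| <= C * q ^+ n * `|h| ].
Proof.
move=> d0 bM; have [q /andP[q0 q1] hq] := eterm_geometric d0 bM.
have M0 : 0 <= M by apply: le_trans (bM 0%N x _) => //; rewrite subrr normr0.
(* Bounds left multiplication by the generators; summing over [A] as well makes it independent of
   the coordinate. *)
pose K0 : R := \sum_A \sum_(j < m) \sum_B `|clcoef (clgen j * blade R B) A| * `|unitv R j : E|.
have K00 : 0 <= K0.
  by apply: sumr_ge0 => A _; apply: sumr_ge0 => j _; apply: sumr_ge0 => B _; exact: mulr_ge0.
pose C1 : R := 12 * M / (d / 4) * (1 - q)^-1 ^+ 2.
have q1' : 0 <= (1 - q)^-1 by rewrite invr_ge0 subr_ge0 ltW.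
have d4 : 0 < d / 4 by rewrite divr_gt0.
have C10 : 0 <= C1 by rewrite mulr_ge0 ?exprn_ge0// divr_ge0 ?(ltW d4)// mulr_ge0.
have q0n n : 0 <= q ^+ n by rewrite exprn_ge0// ltW.
have dirb n z v A : `|z - x| < d / 8 ->
    `|clcoef (ipow_deriv Rp k n v z.2 * a_ n z.1) A| <= C1 * q ^+ n * `|v|.
  move=> zx; have e8 : d / 4 / 2 = d / 8 by field.
  have := eterm_dirderiv n v A d4 hq; rewrite e8 => /(_ _ zx) /le_trans; apply.
  rewrite ler_wpM2r// /C1.
  have -> : 12 * n%:R ^+ 2 * (M * (q ^+ 3) ^+ n) / (d / 4) =
    12 * M / (d / 4) * (n%:R ^+ 2 * (q ^+ 3) ^+ n) by ring.
  rewrite -[leRHS]mulrA ler_wpM2l ?sqr_geometric_bound//.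
  by rewrite divr_ge0 ?(ltW d4)// mulr_ge0.
(* One shrinking to d / 4 yields geometric decay, a further halving leaves room for Markov's
   inequality. The summands of the constant bound the term, its vector derivatives and its
   x_0-derivative. *)
exists (d / 8), (M + C1 + K0 * C1), q; split => //; first by rewrite divr_gt0.
- by rewrite ler_pdivrMr// ler_peMr ?(ltW d0)//; lra.
- exact: ltW.
move=> n z zx; split.
  apply: le_trans (hq n z _) _; first by lra.
  apply: ler_pM => //; first by rewrite exprn_ge0// exprn_ge0// ltW.
    by rewrite -addrA lerDl addr_ge0// mulr_ge0.
  apply: lerXn2r; rewrite ?nnegrE ?exprn_ge0 ?(ltW q0)//.
  by rewrite exprS ger_pMr// exprn_ile1// ltW.
move=> h A; rewrite clcoefD -scalerA eterm_timederiv clcoefZ.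
apply: le_trans (ler_normD _ _) _; rewrite normrM.
have hM : `|h.1| <= `|h| /\ `|h.2| <= `|h|.
  by rewrite prod_normE !le_max !lexx orbT.
have b1 : `|clcoef (ipow_deriv Rp k n h.2 z.2 * a_ n z.1) A| <= C1 * q ^+ n * `|h|.
  apply: le_trans (dirb _ _ _ _ zx) _; apply: ler_wpM2l; first exact: mulr_ge0.
  exact: (proj2 hM).
have b2 : `|clcoef (- \sum_(j < m) clgen j * (ipow_deriv Rp k n.+1 (unitv R j) z.2 * a_ n.+1 z.1)) A|
    <= K0 * C1 * q ^+ n.
  have -> : - (\sum_(j < m) clgen j * (ipow_deriv Rp k n.+1 (unitv R j) z.2 * a_ n.+1 z.1)) =
     0 - \sum_(j < m) clgen j * (ipow_deriv Rp k n.+1 (unitv R j) z.2 * a_ n.+1 z.1).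
    by rewrite sub0r.
  rewrite clcoefB clcoef0 sub0r normrN clcoef_sum.
  apply: (@le_trans _ _ (\sum_(j < m) \sum_B `|clcoef (clgen j * blade R B) A| * `|unitv R j : E| * (C1 * q ^+ n))).
    apply: le_trans (ler_norm_sum _ _ _) _; apply: ler_sum => j _.
    rewrite clcoef_mull; apply: le_trans (ler_norm_sum _ _ _) _; apply: ler_sum => B _.
    rewrite normrM -mulrA ler_wpM2l// mulrC; apply: le_trans (dirb _ _ _ _ zx) _.
    rewrite ler_wpM2r// ler_wpM2l// exprS ger_pMl ?ltW//.
    by rewrite exprn_gt0.
  under eq_bigr do rewrite -mulr_suml; rewrite -mulr_suml -[leRHS]mulrA.
  apply: ler_wpM2r; first exact: mulr_ge0.
  rewrite /K0 (bigD1 A)//= lerDl.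
  by apply: sumr_ge0 => B _; apply: sumr_ge0 => j _; apply: sumr_ge0 => B' _; exact: mulr_ge0.
have b3 := ler_pM (normr_ge0 h.1) (normr_ge0 _) (proj1 hM) b2.
apply: le_trans (lerD b1 b3) _.
have := mulr_ge0 (mulr_ge0 M0 (q0n n)) (normr_ge0 h).
move: (`|h|) => H; nra.
Qed.

End TermDecay.

(** * The Cauchy-Riemann operator on the sum of the series *)

Section LocalMonogenicity.
Variables (R : realType) (m : nat).
Local Notation E := 'rV[R]_m.
Local Notation Cl := (clifford R m).
Variables (Rs Rp : {fset E}) (k : E -> R).
Hypotheses (rs : root_system Rs) (ns : normalized Rs) (ps : positive_subsystem Rs Rp)
  (mk : multiplicity_function Rs k) (gk : gamma Rp k = (1 - m%:R) / 2).
Variables (D : set (R * R)) (alpha beta : R * R -> Cl).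
Hypotheses (oD : open D) (hol : holomorphic_stem D alpha beta).
Implicit Types (A B : {set 'I_m}) (z h x : R * E).
Local Notation a_ := (stem_coef alpha).
Local Notation P_ := (ipow Rp k).
Local Notation eterm := (eterm Rp k alpha).
Local Notation eterm_deriv := (eterm_deriv Rp k alpha).

Lemma eterm_cauchy_riemann n z :
  eterm_deriv n (1, 0) z + \sum_(j < m) clgen j * eterm_deriv n (0, unitv R j) z =
  (n.+1%:R : R) *: (P_ n z.2 * a_ n.+1 z.1) - (n%:R : R) *: (P_ n.-1 z.2 * a_ n z.1).
Proof.
rewrite {1}/eterm_deriv /= (ipow_deriv0 rs ns ps mk) mul0r add0r mul1r; congr (_ + _).
transitivity ((\sum_(j < m) clgen j * ipow_deriv Rp k n (unitv R j) z.2) * a_ n z.1).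
  rewrite mulr_suml; apply: eq_bigr => j _.
  by rewrite /eterm_deriv /= mul0r scale0r addr0 mulrA.
by rewrite (ipow_dirac rs ns ps mk n z.2 gk) -clscaleAl scaleNr.
Qed.

(** The telescoped sum is the x_0-derivative of the last term, so the decay of derivatives already
    sends it to 0. At n = 0 the truncated index [n.-1] carries the coefficient 0. *)
Lemma eterm_cauchy_riemann_sum N z :
  \sum_(n < N.+1) (eterm_deriv n (1, 0) z + \sum_(j < m) clgen j * eterm_deriv n (0, unitv R j) z) =
  eterm_deriv N (1, 0) z.
Proof.
have tE n : eterm_deriv n (1, 0) z = (n.+1%:R : R) *: (P_ n z.2 * a_ n.+1 z.1).
  by rewrite /eterm_deriv /= (ipow_deriv0 rs ns ps mk) mul0r add0r mul1r.
elim: N => [|N IH]; first by rewrite big_ord1 eterm_cauchy_riemann scale0r subr0 tE.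
by rewrite big_ord_recr /= IH eterm_cauchy_riemann !tE /= addrC subrK.
Qed.

Lemma eterm_series_monogenic (F : R * E -> Cl) x d M : 0 < d ->
  (forall z, `|z - x| < d -> D (z.1, 0)) ->
  (forall n z, `|z - x| < d -> `|eterm n z| <= M) ->
  (forall z, `|z - x| < d -> F z = limn (series (eterm^~ z))) ->
  [/\ differentiable F x, forall v, {for x, continuous ('D_v F)} & cauchy_riemann F x = 0].
Proof.
move=> d0 hD bM FE.
have [r [C [q [r0 rd q0 q1 h]]]] := eterm_decay rs ns ps mk gk d0 bM.
have hDr z : `|z - x| < r -> D (z.1, 0) by move=> zx; apply: hD; apply: lt_le_trans rd.
have gd A n z : `|z - x| < r -> differentiable (fun y => clcoef (eterm n y) A) z.
  by move=> zx; exact: (eterm_differentiable rs ns ps mk oD hol n A (hDr z zx)).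
have gb A n z : `|z - x| < r -> `|clcoef (eterm n z) A| <= C * q ^+ n.
  by move=> zx; apply: le_trans (clcoef_le_norm _ _) _; have [] := h n z zx.
have gD A n z v : `|z - x| < r -> 'D_v (fun y => clcoef (eterm n y) A) z = clcoef (eterm_deriv n v z) A.
  by move=> zx; have [_ ->] := eterm_is_derive rs ns ps mk oD hol n v A (hDr z zx).
have gdb A n z v : `|z - x| < r -> `|'D_v (fun y => clcoef (eterm n y) A) z| <= C * q ^+ n * `|v|.
  by move=> zx; rewrite gD//; have [_ ->] := h n z zx.
have GE A z : `|z - x| < r -> clcoef (F z) A = limn (series (fun n => clcoef (eterm n z) A)).
  move=> zx; rewrite FE; last exact: lt_le_trans rd.
  have [|-> //] := @clifford_geometric _ _ (eterm^~ z) C q q0 q1.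
  by move=> n; have [] := h n z zx.
have Fd A z : `|z - x| < r -> differentiable (fun y => clcoef (F y) A) z.
  by move=> zx; have [] := termwise_differentiable q0 q1 (gd A) (gb A) (gdb A) (GE A) zx.
have FD z v : `|z - x| < r -> forall A, clcoef ('D_v F z) A = 'D_v (fun y => clcoef (F y) A) z.
  by move=> zx; have [] := @clifford_derive _ _ _ F z v (fun A => @diff_derivable _ _ _ _ _ v (Fd A z zx)).
have xr : `|x - x| < r by rewrite subrr normr0.
split.
- by apply: clifford_differentiable => A; exact: Fd.
- move=> v; rewrite /prop_for /continuous_at; apply: clifford_cvg => A.
  rewrite FD//.
  have e : \forall w \near x, 'D_v (fun y => clcoef (F y) A) w = clcoef ('D_v F w) A.
    by apply/nbhs_normP; exists r => // w /=; rewrite distrC => wx; rewrite FD.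
  apply: cvg_trans (near_eq_cvg e) _.
  apply: (termwise_derive_continuous q0 q1 (gd A) (gb A) (gdb A) (GE A) xr) => n.
  exact: (@eterm_deriv_continuous _ _ _ _ _ rs ns ps mk _ _ _ oD hol n v A x (hDr x xr)).
apply: clP => A; rewrite clcoef0.
(* Partial sums are shifted by one to match the telescoped sum over [N.+1] terms. *)
have cvD v B : (fun N => \sum_(n < N.+1) clcoef (eterm_deriv n v x) B) @ \oo --> clcoef ('D_v F x) B.
  have := termwise_derive_cvg q0 q1 (gd B) (gb B) (gdb B) (GE B) (v := v) xr.
  rewrite -FD// => /(cvg_comp _ _ (@cvg_addnr 1)) c; apply: cvg_trans c.
  apply: near_eq_cvg; near=> N; rewrite /= addn1 /series /= big_mkord.
  by apply: eq_bigr => n _; rewrite gD.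
have S_cvg : (fun N => clcoef (eterm_deriv N (1, 0) x) A) @ \oo --> clcoef (cauchy_riemann F x) A.
  rewrite /cauchy_riemann clcoefD clcoef_sum.
  under eq_bigr do rewrite clcoef_mull.
  have -> : (fun N => clcoef (eterm_deriv N (1, 0) x) A) = fun N =>
      \sum_(n < N.+1) clcoef (eterm_deriv n (1, 0) x) A + \sum_(j < m) \sum_B
        clcoef (clgen j * blade R B) A * (\sum_(n < N.+1) clcoef (eterm_deriv n (0, unitv R j) x) B).
    apply/funext => N; rewrite -eterm_cauchy_riemann_sum clcoef_sum.
    under eq_bigr do rewrite clcoefD.
    rewrite big_split /=; congr (_ + _).
    under eq_bigr do rewrite clcoef_sum.
    rewrite exchange_big /=; apply: eq_bigr => j _.
    under eq_bigr do rewrite clcoef_mull.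
    rewrite exchange_big /=; apply: eq_bigr => B _.
    by rewrite mulr_sumr.
  apply: cvgD; first exact: cvD.
  apply: cvg_bigsum => j; apply: cvg_bigsum => B.
  by apply: cvgMr; exact: cvD.
(* The same sequence tends to 0, being dominated by C q^N. *)
apply/esym; apply: (cvg_unique _ _ S_cvg) => //.
have g0 := @cvg_geometric R (C * `|(1, 0) : R * E|) q.
rewrite ger0_norm// in g0; move/cvgr0Pnorm_le: (g0 q1) => {}g0.
apply/cvgr0Pnorm_le => e e0; apply: filterS (g0 e e0) => N /= gN.
apply: le_trans gN; apply: le_trans (ler_norm _); rewrite /geometric.
by have [_ /(_ (1, 0) A)] := h N x xr; rewrite mulrAC.
Unshelve. all: by end_near. Qed.

End LocalMonogenicity.

(** * Norm comparisons and uniform convergence *)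

Section UniformConvergence.
Variables (R : realType) (m : nat).
Local Notation E := 'rV[R]_m.
Local Notation Cl := (clifford R m).
Implicit Types (A B : {set 'I_m}).

(** The norm is the sup norm of the coordinates; the structure constants supply the factor for
    products. *)
Lemma clnormM : exists2 c : R, 0 <= c & forall a b : Cl, `|a * b| <= c * (`|a| * `|b|).
Proof.
exists (\sum_A \sum_B \sum_C `|clcoef (blade R B * blade R C : Cl) A|).
  by apply: sumr_ge0 => A _; apply: sumr_ge0 => B _; apply: sumr_ge0 => C _.
move=> a b; apply: clnorm_le.
  apply: mulr_ge0; last exact: mulr_ge0.
  by apply: sumr_ge0 => A _; apply: sumr_ge0 => B _; apply: sumr_ge0 => C _.
move=> A; apply: (@le_trans _ _ ((\sum_B \sum_C `|clcoef (blade R B * blade R C : Cl) A|) * (`|a| * `|b|))).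
  rewrite clcoefM mulr_suml; apply: le_trans (ler_norm_sum _ _ _) _; apply: ler_sum => B _.
  rewrite mulr_suml; apply: le_trans (ler_norm_sum _ _ _) _; apply: ler_sum => C _.
  by rewrite !normrM ler_wpM2l// ler_pM// clcoef_le_norm.
apply: ler_wpM2r; first exact: mulr_ge0.
rewrite [leRHS](bigD1 A)//= lerDl; apply: sumr_ge0 => B _.
by apply: sumr_ge0 => C _; apply: sumr_ge0.
Qed.

Lemma enorm_le (v : E) : enorm v <= m.+1%:R * `|v|.
Proof.
have h : 0 <= m.+1%:R * `|v| by rewrite mulr_ge0.
rewrite -[leRHS](ger0_norm h) -sqrtr_sqr; apply: ler_wsqrtr.
apply: (@le_trans _ _ (\sum_(j < m) `|v| ^+ 2)).
  apply: ler_sum => j _; rewrite -expr2 -real_normK ?num_real// lerXn2r ?nnegrE//.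
  by rewrite [leRHS]/Num.Def.normr /= mx_normrE; exact: (le_bigmax _ _ (ord0, j)).
rewrite sumr_const card_ord -(mulr_natl _ m) exprMn ler_wpM2r ?exprn_ge0//.
by rewrite -natrX ler_nat; rewrite (leq_trans (leqnSn m))// expnS expn1 leq_pmulr.
Qed.

(** In dimension 0 there are no nonzero roots, so gamma would be 0 instead of 1 / 2. *)
Lemma dim_gt0 (Rs Rp : {fset E}) (k : E -> R) : root_system Rs -> positive_subsystem Rs Rp ->
  gamma Rp k = (1 - m%:R) / 2 -> (0 < m)%N.
Proof.
move=> [R0 _ _] [RE _ _] gk; rewrite lt0n; apply/negP => /eqP m0.
move: gk; rewrite /gamma big_seq big1; first by rewrite m0; clear => ?; lra.
move=> a aRp; have : a \in Rs by apply/RE; left.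
suff -> : a = 0 by rewrite (negbTE R0).
apply/rowP => j; have : (j < 0)%N by rewrite -[X in (_ < X)%N]m0.
by [].
Qed.

Lemma uniform_cvgP (U : set (R * E)) (S : nat -> R * E -> Cl) (F : R * E -> Cl) :
  {uniform U, S @ \oo --> F} <->
  forall e : R, 0 < e -> \forall n \near \oo, forall z, U z -> `|F z - S n z| < e.
Proof.
split => [cv e e0|h P /uniform_nbhs[W [entW subP]]].
  have N : nbhs (F : {uniform` U -> Cl}) [set g | forall z, U z -> `|F z - g z| < e].
    apply/uniform_nbhs; exists [set xy | ball xy.1 e xy.2]; split.
      by rewrite -entourage_ballE; exists e.
    by move=> g hg z Uz; have := hg z Uz; rewrite -ball_normE.
  exact: (cv _ N).
move: entW; rewrite -entourage_ballE => -[e /= e0 hW].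
apply: filterS (h e e0) => n hn; apply: subP => z Uz; apply: hW => /=.
by rewrite -ball_normE; exact: hn.
Qed.

End UniformConvergence.

Lemma nbhs_dist_lt (R : realType) (V : normedModType R) (x : V) (d : R) : 0 < d ->
  nbhs x [set z | `|z - x| < d].
Proof. by move=> d0; apply/nbhs_normP; exists d => // z /=; rewrite distrC. Qed.

Lemma nbhs_ex_dist_lt (R : realType) (V : normedModType R) (x : V) (A : set V) : nbhs x A ->
  exists2 d : R, 0 < d & forall z, `|z - x| < d -> A z.
Proof.
by move=> /nbhs_normP[d d0 hd]; exists d => // z zx; apply: hd; rewrite /= distrC.
Qed.

Section ExponentialDomain.
Variables (R : realType) (m : nat).
Local Notation E := 'rV[R]_m.
Local Notation Cl := (clifford R m).
Variables (Rs Rp : {fset E}) (k : E -> R).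
Hypotheses (rs : root_system Rs) (ns : normalized Rs) (ps : positive_subsystem Rs Rp)
  (mk : multiplicity_function Rs k) (gk : gamma Rp k = (1 - m%:R) / 2).
Variables (D : set (R * R)) (f : R * E -> Cl) (alpha beta : R * R -> Cl).
Hypotheses (oD : open D) (sf : stem_function D alpha beta) (hol : holomorphic_stem D alpha beta).
Hypothesis fE : forall x, axial_domain D x -> f x = alpha (x.1, enorm x.2)
  + clvec ((enorm x.2)^-1 *: x.2) * beta (x.1, enorm x.2).
Implicit Types (x z : R * E).

Let m0 : (0 < m)%N := dim_gt0 rs ps gk.

Lemma exp_dunkl_term_eterm z : D (z.1, 0) -> exp_dunkl_term Rp k f z = eterm Rp k alpha ^~ z.
Proof.
by case: z => s v Ds; apply/funext => n; exact: (exp_dunkl_termE k ns ps v n m0 oD sf hol fE Ds).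
Qed.

Lemma real_axis_exp_dunkl_domain s : D (s, 0) -> exp_dunkl_domain Rp k D f (s, 0).
Proof.
move=> Ds; split => //.
have [r [rho [C [K [r0 rho0 C0 K0 h]]]]] := slice_expansion m0 oD sf hol fE Ds.
have [C' [K' [C'0 K'0 hP]]] := ipow_bound k ns ps.
have [c c0 hc] := clnormM R m.
(* K is the growth rate of the Taylor coefficients, K' that of the intertwined powers, and m + 1
   compares the Euclidean norm with the sup norm. For |z.2| <= 1 / (2 L) the terms are dominated by
   a series of ratio 1 / 2. *)
pose L := K * (K' * m.+1%:R); have L0 : 0 < L by rewrite !mulr_gt0.
pose d := Num.min r (1 / (2 * L)).
have d0 : 0 < d by rewrite lt_min r0 divr_gt0// mulr_gt0.
pose o : R * E := (s, 0).
exists [set z | `|z - o| < d].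
  exact: (nbhs_dist_lt o d0).
apply/uniform_cvgP => e e0.
pose B := c * (C' * C).
have B0 : 0 <= B by rewrite mulr_ge0// mulr_ge0// ltW.
have hz z : `|z - o| < d -> D (z.1, 0) /\ forall n, `|eterm Rp k alpha n z| <= B * (1 / 2) ^+ n.
  rewrite prod_normE gt_max /= subr0 => /andP[z1 z2].
  have [|Dz ha _] := h z.1; first by apply: lt_le_trans z1 _; rewrite ge_min lexx.
  split => // n; rewrite /eterm; apply: le_trans (hc _ _) _.
  rewrite /B -mulrA ler_wpM2l//.
  apply: (@le_trans _ _ ((C' * (K' * enorm z.2) ^+ n) * (C * K ^+ n))).
    by apply: ler_pM.
  have -> : C' * (K' * enorm z.2) ^+ n * (C * K ^+ n) = C' * C * (K * (K' * enorm z.2)) ^+ n.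
    by rewrite [(K * _) ^+ n]exprMn; ring.
  apply: ler_wpM2l; first by rewrite mulr_ge0 ?ltW.
  have a0 : 0 <= K * (K' * enorm z.2) by rewrite !mulr_ge0 ?enorm_ge0 ?ltW.
  apply: lerXn2r; rewrite ?nnegrE//.
  apply: (@le_trans _ _ (L * `|z.2|)).
    rewrite /L -!mulrA ler_pM2l// ler_pM2l//; exact: enorm_le.
  have : `|z.2| <= 1 / (2 * L) by apply: ltW; apply: lt_le_trans z2 _; rewrite ge_min lexx orbT.
  move=> hz2; apply: (@le_trans _ _ (L * (1 / (2 * L)))); first by rewrite ler_pM2l.
  by rewrite le_eqVlt; apply/orP; left; apply/eqP; field; rewrite lt0r_neq0.
have h1 : 0 <= 1 / 2 :> R by lra.
have h2 : 1 / 2 < 1 :> R by lra.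
have := @cvg_geometric R (B / (1 - 1 / 2)) (1 / 2); rewrite ger0_norm// => /(_ h2).
move/cvgr0Pnorm_lt => /(_ e e0); apply: filterS => N /= hN z /= zd.
have [Dz hb] := hz z zd.
rewrite /exp_dunkl exp_dunkl_term_eterm//.
have [_ ht] := clifford_geometric h1 h2 hb.
by apply: le_lt_trans (ht N) _; apply: le_lt_trans (ler_norm _) hN.
Qed.

(** From some N on, a term is the difference of two partial sums within 1 of the limit, hence at
    most 2 in norm; the finitely many earlier terms are continuous at x. *)
Lemma exp_dunkl_domain_bound x : exp_dunkl_domain Rp k D f x -> exists2 d, 0 < d &
  exists M, forall z, `|z - x| < d -> D (z.1, 0) /\ forall n, `|eterm Rp k alpha n z| <= M.
Proof.
move=> [Dx [U nU /uniform_cvgP/(_ 1 ltr01)[N _ hN]]].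
have nD := near_domain oD Dx.
have cN : \forall z \near x, forall i : 'I_N, `|eterm Rp k alpha i z| <= `|eterm Rp k alpha i x| + 1.
  have FF : Filter (nbhs x) := nbhs_filter x.
  apply: (@filter_forall _ _ (fun (i : 'I_N) z => `|eterm Rp k alpha i z| <= `|eterm Rp k alpha i x| + 1) _ FF) => i.
  have cf : {for x, continuous (eterm Rp k alpha i)}.
    apply: differentiable_continuous; apply: clifford_differentiable => A.
    exact: (eterm_differentiable rs ns ps mk oD hol i A Dx).
  have /cvgrPdist_le/(_ 1 ltr01) := cf; apply: filterS => z hz.
  rewrite -(subrK (eterm Rp k alpha i x) (eterm Rp k alpha i z)) addrC.
  by apply: le_trans (ler_normD _ _) _; rewrite lerD2l distrC.
have [d d0 hd] := nbhs_ex_dist_lt (filterI nU (filterI nD cN)).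
exists d => //; exists (2 + \sum_(i < N) (`|eterm Rp k alpha i x| + 1)) => z zx.
have [Uz [Dz Nz]] := hd z zx.
have S0 : 0 <= \sum_(i < N) (`|eterm Rp k alpha i x| + 1) by apply: sumr_ge0 => i _; rewrite addr_ge0.
split => // n; have [nN|Nn] := ltnP n N.
  apply: le_trans (Nz (Ordinal nN)) _; rewrite (bigD1 (Ordinal nN))//= addrCA lerDl.
  by rewrite addr_ge0// sumr_ge0// => i _; rewrite addr_ge0.
have k1 := hN n Nn z Uz; have k2 := hN n.+1 (leqW Nn) z Uz.
move: k1 k2 => /=; rewrite exp_dunkl_term_eterm//; set F := exp_dunkl _ _ _ _.
set S := series _ => k1 k2.
have -> : eterm Rp k alpha n z = (F - S n) - (F - S n.+1).
  by rewrite /S seriesSr opprB !addrA subrK addrAC subrr add0r.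
apply: le_trans (ler_normB _ _) _; lra.
Qed.

End ExponentialDomain.

(** The first conjunct keeps the second from being vacuous whenever D meets the real axis. *)
Theorem theorem5p1 (R : realType) (m : nat) (Rs Rp : {fset 'rV[R]_m})
    (k : 'rV[R]_m -> R) (D : set (R * R)) (f : R * 'rV[R]_m -> clifford R m) :
  root_system Rs -> normalized Rs -> positive_subsystem Rs Rp ->
  multiplicity_function Rs k -> ~ singular_multiplicity Rp k ->
  gamma Rp k = (1 - m%:R) / 2 ->
  open D -> conj_symmetric D -> slice_regular D f ->
  (forall s : R, D (s, 0) -> exp_dunkl_domain Rp k D f (s, 0)) /\
  monogenic_on (exp_dunkl_domain Rp k D f) (exp_dunkl Rp k f).
Proof.
move=> rs ns ps mk _ gk oD _ [alpha [beta [sf hol fE]]]; split.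
  by move=> s; exact: (real_axis_exp_dunkl_domain rs ns ps gk oD sf hol fE).
move=> x xdom.
have [d d0 [M hM]] := exp_dunkl_domain_bound rs ns ps mk gk oD sf hol fE xdom.
apply: (eterm_series_monogenic rs ns ps mk gk oD hol d0 (M := M)).
- by move=> z /hM[].
- by move=> n z /hM[_].
- by move=> z /hM[Dz _]; rewrite /exp_dunkl (exp_dunkl_term_eterm rs ns ps gk oD sf hol fE Dz).
Qed.
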